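(* Let $n\ge 2$, let $\psi\in\mathcal{S}(\mathbb{R})$ be a non-trivial window (i.e. $\psi\not\equiv 0$) and let $\eta\in\mathcal{S}(\mathbb{R})$ be a reconstruction window for $\psi$. If $f\in L^1(\mathbb{R}^n)$ is such that $\widehat{f}\in L^1(\mathbb{R}^n)$, then for almost every $\mathbf{x}\in\mathbb{R}^n$, $$f(\mathbf{x})=\frac{1}{C_{\psi,\eta}}\int_{\mathbb{S}^{n-1}}\int_{\mathbb{R}^{\times}}\int_{\mathbb{R}}DS_\psi f(\mathbf{u},b,a)\,\eta_{\mathbf{u},b,a}(\mathbf{x})\,|a|^{n-2}\,db\,da\,d\mathbf{u}.$$
   Context: $\mathbb{R}^\times=\mathbb{R}\setminus\{0\}$; $\mathbb{S}^{n-1}$ is the unit sphere of $\mathbb{R}^n$ and $d\mathbf{u}$ its surface measure. $\mathcal{S}(\mathbb{R})$ is the Schwartz space (complex-valued functions). The Fourier transform is $\widehat{g}(\boldsymbol{\xi})=\int g(\mathbf{x})e^{-i\mathbf{x}\cdot\boldsymbol{\xi}}\,d\mathbf{x}$. For $\psi\in\mathcal{S}(\mathbb{R})$, $\mathbf{u}\in\mathbb{S}^{n-1}$, $b\in\mathbb{R}$, $a\in\mathbb{R}^\times$, put $$\psi_{\mathbf{u},b,a}(\mathbf{x})=\frac{|a|}{(2\pi)^{n/2}}\,\psi\big(a(\mathbf{x}\cdot\mathbf{u}-b)\big)\,e^{ia(\mathbf{x}\cdot\mathbf{u})},\qquad \mathbf{x}\in\mathbb{R}^n,$$ and, for $f\in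 L^1(\mathbb{R}^n)$, the directional Stockwell transform of $f$ is $DS_\psi f(\mathbf{u},b,a)=\int_{\mathbb{R}^n}f(\mathbf{x})\,\overline{\psi_{\mathbf{u},b,a}(\mathbf{x})}\,d\mathbf{x}$. A function $\eta\in\mathcal{S}(\mathbb{R})$ is a reconstruction window for a non-trivial $\psi\in\mathcal{S}(\mathbb{R})$ if the (Lebesgue) integral $$C_{\psi,\eta}=\frac{1}{\pi}\int_{\mathbb{R}}\overline{\widehat{\psi}(\xi-1)}\,\widehat{\eta}(\xi-1)\,\frac{d\xi}{|\xi|^n}$$ is nonzero and finite. The triple integral is an iterated integral in the order written ($b$ innermost, then $a$, then $\mathbf{u}$). *)

(* Defs.v *)
From HB Require Import structures.
From mathcomp Require Import all_boot all_order all_algebra.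
From mathcomp Require Import all_classical all_reals all_analysis.
From mathcomp Require Import measurable_realfun.
From mathcomp Require Import complex.
Import Order.TTheory GRing.Theory Num.Theory.
Import numFieldNormedType.Exports.

Set Implicit Arguments.
Unset Strict Implicit.
Unset Printing Implicit Defensive.

Local Open Scope classical_set_scope.
Local Open Scope ring_scope.

(* Points of R^n are n-tuples: the library equips [n.-tuple R] with the product
   sigma-algebra, i.e. the Borel sets of R^n. *)

Section euclidean.
Context {R : realType} {n : nat}.
Implicit Types x y : n.-tuple R.

Definition dotp x y : R := \sum_(i < n) tnth x i * tnth y i.

Definition enorm x : R := Num.sqrt (dotp x x).

Definition normalize x : n.-tuple R := [tuple (enorm x)^-1 * tnth x i | i < n].

Definition unit_sphere : set (n.-tuple R) := [set u | enorm u = 1].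

Lemma measurable_enorm : measurable_fun [set: n.-tuple R] enorm.
Proof.
rewrite (_ : enorm = (@powR R ^~ 2^-1) \o (fun x => dotp x x)); last first.
  by apply/funext => x /=; rewrite powR12_sqrt ?sumr_ge0// => i _; exact: sqr_ge0.
apply: (measurableT_comp (measurable_powR _)).
apply: measurable_sum => i.
by apply: measurable_funM; exact: measurable_tnth.
Qed.

Lemma measurable_normalize : measurable_fun [set: n.-tuple R] normalize.
Proof.
apply/measurable_fun_tnthP => i.
rewrite (_ : _ \o _ = (fun x => (enorm x `^ (-1)) * tnth x i)); last first.
  by apply/funext => x /=; rewrite tnth_mktuple powR_inv1// sqrtr_ge0.
apply: measurable_funM; last exact: measurable_tnth.
exact: (measurableT_comp (measurable_powR _) measurable_enorm).
Qed.

End euclidean.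

Arguments unit_sphere {R} n.

Section lebesgue.
Variable R : realType.

Let consp n (p : measurableTypeR R * n.-tuple R) : n.+1.-tuple R :=
  [tuple of p.1 :: p.2].

(* Lebesgue measure on R^n is the n-fold product of the one on R, transported
   from R * (R * ...) to tuples. *)
Fixpoint lebesgue_tuple (n : nat) : set (n.-tuple R) -> \bar R :=
  match n with
  | 0 => \d_([tuple] : 0.-tuple R)
  | m.+1 => pushforward (lebesgue_measure \x @lebesgue_tuple m)%E
              (fun p => [tuple of p.1 :: p.2])
  end.

Let measurable_consp n : measurable_fun setT (@consp n).
Proof.
apply: (@measurable_cons _ _ (measurableTypeR R * n.-tuple R)%type R fst n snd).
  exact: measurable_fst.
exact: measurable_snd.
Qed.

Section step.
Variables (n : nat) (mu : {sigma_finite_measure set (n.-tuple R) -> \bar R}).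

Definition lebesgue_step : set (n.+1.-tuple R) -> \bar R :=
  pushforward (lebesgue_measure \x mu)%E (fun p => [tuple of p.1 :: p.2]).

Let step_measurable (A : set (n.+1.-tuple R)) :
  measurable A -> measurable (@consp n @^-1` A).
Proof. by move=> mA; rewrite -[X in measurable X]setTI; exact: measurable_consp. Qed.

Let step0 : lebesgue_step set0 = 0%E.
Proof. by rewrite /lebesgue_step /pushforward preimage_set0 measure0. Qed.

Let step_ge0 A : (0 <= lebesgue_step A)%E.
Proof. exact: (measure_ge0 (lebesgue_measure \x mu)%E). Qed.

Let step_sigma_additive : semi_sigma_additive lebesgue_step.
Proof.
move=> F mF tF mUF; rewrite /lebesgue_step /pushforward preimage_bigcup.
apply: (@measure_semi_sigma_additive _ _ _ (lebesgue_measure \x mu)%E) => [k||].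
- exact: step_measurable.
- apply/trivIsetP => /= i j _ _ ij; rewrite -preimage_setI.
  by move/trivIsetP : tF => /(_ _ _ _ _ ij) ->//; rewrite preimage_set0.
- by rewrite -preimage_bigcup; exact: step_measurable.
Qed.

HB.instance Definition _ := isMeasure.Build _ _ _ lebesgue_step
  step0 step_ge0 step_sigma_additive.

Let uncons (v : n.+1.-tuple R) : measurableTypeR R * n.-tuple R :=
  (thead v, [tuple of behead v]).

Let measurable_uncons : measurable_fun setT uncons.
Proof.
apply/measurable_fun_pairP; split; last exact: measurable_behead.
exact: (@measurable_tnth _ R n.+1 ord0).
Qed.

Let unconsK : cancel (@consp n) uncons.
Proof.
move=> [t v]; rewrite /uncons /consp /=; congr pair.
by apply: val_inj.
Qed.

Let step_sigma_finite : sigma_finite setT lebesgue_step.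
Proof.
have /sigma_finiteP[F [TF ndF Foo]] := sigma_finiteT (@lebesgue_measure R).
have /sigma_finiteP[G [TG ndG Goo]] := sigma_finiteT mu.
exists (fun k => uncons @^-1` (F k `*` G k)) => [|k].
  apply/esym; rewrite -subTset => v _ /=.
  have [i _ Fi] : (\bigcup_k F k) (uncons v).1 by rewrite -TF.
  have [j _ Gj] : (\bigcup_k G k) (uncons v).2 by rewrite -TG.
  exists (maxn i j) => //; split => /=.
    by move: Fi; exact/subsetPset/ndF/leq_maxl.
  by move: Gj; exact/subsetPset/ndG/leq_maxr.
have [mF Fk] := Foo k; have [mG Gk] := Goo k; split.
  rewrite -[X in measurable X]setTI; apply: measurable_uncons => //.
  exact: measurableX.
rewrite /lebesgue_step /pushforward -comp_preimage.
rewrite (_ : uncons \o @consp n = id) ?preimage_id; last exact/funext.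
by rewrite product_measure1E// lte_mul_pinfty// ge0_fin_numE.
Qed.

HB.instance Definition _ := Measure_isSigmaFinite.Build _ _ _ lebesgue_step
  step_sigma_finite.

Lemma lebesgue_tuple_step :
  exists nu : {sigma_finite_measure set (n.+1.-tuple R) -> \bar R},
    pushforward (lebesgue_measure \x mu)%E (@consp n) = nu.
Proof. by exists lebesgue_step. Qed.

End step.

Let lebesgue_tuple_ex n :
  exists mu : {sigma_finite_measure set (n.-tuple R) -> \bar R},
    lebesgue_tuple (n := n) = mu.
Proof.
elim: n => [|n [mu muE]] /=; first by exists \d_([tuple] : 0.-tuple R).
by rewrite muE; exact: lebesgue_tuple_step.
Qed.

Section instances.
Variable n : nat.

Let lebesgue_tuple0 : @lebesgue_tuple n set0 = 0%E.
Proof. by have [mu ->] := lebesgue_tuple_ex n; exact: measure0. Qed.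

Let lebesgue_tuple_ge0 A : (0 <= @lebesgue_tuple n A)%E.
Proof. by have [mu ->] := lebesgue_tuple_ex n; exact: measure_ge0. Qed.

Let lebesgue_tuple_sigma_additive : semi_sigma_additive (@lebesgue_tuple n).
Proof.
by have [mu ->] := lebesgue_tuple_ex n; exact: measure_semi_sigma_additive.
Qed.

HB.instance Definition _ := isMeasure.Build _ _ _ (@lebesgue_tuple n)
  lebesgue_tuple0 lebesgue_tuple_ge0 lebesgue_tuple_sigma_additive.

Let lebesgue_tuple_sigma_finite : sigma_finite setT (@lebesgue_tuple n).
Proof. by have [mu ->] := lebesgue_tuple_ex n; exact: sigma_finiteT. Qed.

HB.instance Definition _ := Measure_isSigmaFinite.Build _ _ _
  (@lebesgue_tuple n) lebesgue_tuple_sigma_finite.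

End instances.

End lebesgue.

Arguments lebesgue_tuple {R n}.

Section surface.
Context {R : realType} {n : nat}.

(* The usual cone construction of the surface measure of S^{n-1}, viewed as a
   measure on R^n carried by the sphere: sigma(A) = n * vol { r u | u in A,
   0 < r <= 1 }. It is normalized so that dx = r^(n-1) dr dsigma(u), as for
   (n-1)-dimensional area. *)
Definition surface_measure (A : set (n.-tuple R)) : \bar R :=
  (n%:R%:E * lebesgue_tuple
    ([set x : n.-tuple R | (0 < enorm x <= 1)%R] `&` normalize @^-1` A))%E.

Let measurable_punctured_ball :
  measurable [set x : n.-tuple R | 0 < enorm x <= 1].
Proof.
rewrite (_ : [set _ | _] = enorm @^-1` `]0, 1]); last first.
  by apply/seteqP; split => x /=; rewrite in_itv.
by rewrite -[X in measurable X]setTI; exact: measurable_enorm.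
Qed.

Let measurable_cone (A : set (n.-tuple R)) : measurable A ->
  measurable ([set x | 0 < enorm x <= 1] `&` normalize @^-1` A).
Proof.
move=> mA; apply: measurableI => //.
by rewrite -[X in measurable X]setTI; exact: measurable_normalize.
Qed.

Let surface_measure0 : surface_measure set0 = 0%E.
Proof. by rewrite /surface_measure preimage_set0 setI0 measure0 mule0. Qed.

Let surface_measure_ge0 A : (0 <= surface_measure A)%E.
Proof. by rewrite mule_ge0// lee_fin. Qed.

Let surface_measure_sigma_additive : semi_sigma_additive surface_measure.
Proof.
move=> F mF tF mUF; rewrite /surface_measure.
under eq_fun do rewrite -ge0_sume_distrr//.
rewrite preimage_bigcup setI_bigcupr; apply: cvgeZl => //.
apply: measure_semi_sigma_additive => [k||].
- exact: measurable_cone.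
- apply/trivIset_setIl/trivIsetP => i j _ _ ij; rewrite -preimage_setI.
  by move/trivIsetP : tF => /(_ _ _ _ _ ij) ->//; rewrite preimage_set0.
- by rewrite -setI_bigcupr -preimage_bigcup; exact: measurable_cone.
Qed.

HB.instance Definition _ := isMeasure.Build _ _ _ surface_measure
  surface_measure0 surface_measure_ge0 surface_measure_sigma_additive.

End surface.

Section complex_integral.
Context {R : realType} {d : measure_display} {T : measurableType d}.
Variables (mu : {measure set T -> \bar R}) (D : set T) (g : T -> R[i]).

Definition cintegrable : Prop :=
  mu.-integrable D (fun x => (complex.Re (g x))%:E) /\
  mu.-integrable D (fun x => (complex.Im (g x))%:E).

Definition cint : R[i] :=
  ((\int[mu]_(x in D) complex.Re (g x)) +i*
   (\int[mu]_(x in D) complex.Im (g x)))%C.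

End complex_integral.

Section stockwell.
Context {R : realType}.

Local Notation lambda := (@lebesgue_measure R).

Definition expi (t : R) : R[i] := (cos t +i* sin t)%C.

Definition schwartz (g : R -> R[i]) : Prop :=
  let g1 (t : R) : R := complex.Re (g t) in
  let g2 (t : R) : R := complex.Im (g t) in
  (forall m t, derivable (derive1n m g1) t 1 /\ derivable (derive1n m g2) t 1) /\
  (forall k m, exists M : R, forall t,
    `|t| ^+ k * Normc.normc (derive1n m g1 t +i* derive1n m g2 t)%C <= M).

Definition fourier1 (g : R -> R[i]) (xi : R) : R[i] :=
  cint lambda setT (fun t => g t * expi (- (t * xi))).

Definition Rpunctured : set R := [set a | a != 0].

(* With 0^-1 = 0 the integrand vanishes at xi = 0, a null set. *)
Definition window_density (n : nat) (psi eta : R -> R[i]) (xi : R) : R[i] :=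
  (fourier1 psi (xi - 1))^* * fourier1 eta (xi - 1) * ((`|xi| ^+ n)^-1)%:C%C.

Definition window_constant (n : nat) (psi eta : R -> R[i]) : R[i] :=
  (pi^-1)%:C%C * cint lambda setT (window_density n psi eta).

Definition reconstruction_window (n : nat) (psi eta : R -> R[i]) : Prop :=
  [/\ schwartz eta,
      cintegrable lambda setT (window_density n psi eta) &
      window_constant n psi eta != 0].

Context {n : nat}.
Implicit Types (f : n.-tuple R -> R[i]) (u x : n.-tuple R).

Definition fourier f (xi : n.-tuple R) : R[i] :=
  cint lebesgue_tuple setT (fun x => f x * expi (- dotp x xi)).

Definition atom (psi : R -> R[i]) u (b a : R) x : R[i] :=
  (`|a| / (2 * pi) `^ (n%:R / 2))%:C%C
  * psi (a * (dotp x u - b)) * expi (a * dotp x u).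

Definition stockwell (psi : R -> R[i]) f u (b a : R) : R[i] :=
  cint lebesgue_tuple setT (fun x => f x * (atom psi u b a x)^*).

(* Existence of the iterated Lebesgue integral of F, b innermost: the inner
   integrals may fail to exist on null sets of the outer variables. *)
Definition iterated_integrable (F : n.-tuple R -> R -> R -> R[i]) : Prop :=
  [/\ \forall u \ae @surface_measure R n, unit_sphere n u ->
        \forall a \ae lambda, Rpunctured a -> cintegrable lambda setT (F u a),
      \forall u \ae @surface_measure R n, unit_sphere n u ->
        cintegrable lambda Rpunctured (fun a => cint lambda setT (F u a)) &
      cintegrable surface_measure (unit_sphere n) (fun u =>
        cint lambda Rpunctured (fun a => cint lambda setT (F u a)))].

Definition iterated_cint (F : n.-tuple R -> R -> R -> R[i]) : R[i] :=
  cint surface_measure (unit_sphere n) (fun u =>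
    cint lambda Rpunctured (fun a => cint lambda setT (fun b => F u a b))).

End stockwell.

(* Main.v *)
(* The Fourier inversion formula for [psi] and Fubini's theorem give, for all [u]
   and all [a != 0], the innermost integral
     (2 pi)^-(n+1) |a|^(n-1) int H(xi - 1) k(a xi u) dxi,
   where [H] is the product of the conjugate of the Fourier transform of [psi]
   and the one of [eta], and [k z] is the Fourier transform of [f] at [z] times
   exp(i x.z). Integrating over [a] and [u] first, polar coordinates turn
   |a|^(n-1) k(a xi u) into 2 |xi|^-n int k; the remaining integral in [xi] is
   pi times the window constant, and int k = (2 pi)^n f(x) for almost every [x].
   The polar coordinates formula is obtained from the cone construction of the
   surface measure by a scaling and Tonelli argument. The inversion formula on
   R^n is tested against products of one-dimensional bumps [1 - (1 - p^2)^k],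
   which have an integrable Fourier transform and tend to indicators of boxes. *)
Require Import Defs.
From HB Require Import structures.
From mathcomp Require Import all_boot all_order all_algebra.
From mathcomp Require Import all_classical all_reals all_analysis.
From mathcomp Require Import measurable_realfun.
From mathcomp Require Import ring lra.
From mathcomp Require Import complex.
Import Order.TTheory GRing.Theory Num.Theory.
Import numFieldNormedType.Exports.
Set Implicit Arguments.
Unset Strict Implicit.
Unset Printing Implicit Defensive.
Local Open Scope classical_set_scope.
Local Open Scope ring_scope.

(** * Complex-valued integrals *)

(** The integrand is never integrated as one function of (u, a, b). In b, absolute convergence is
    obtained for each fixed u and a != 0 from the boundedness of the transform of f alone; this
    matters because an integrable function on R^n may fail to be integrable along a given line. The
    b-integral is then kept as an integral over a frequency xi, and Fubini applies in (u, a, xi)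
    jointly: the computation done on moduli costs exactly the integrability of the window density
    times that of k. Constants: in (2 pi)^(n+1), the exponent n comes from the normalizations of the
    two atoms and the extra 1 from inverting psi. As a runs over both signs, each nonzero point of
    R^n is reached twice, as a u and as (-a)(-u), which gives the 2. The exceptional null set of x
    comes only from the inversion formula on R^n. There f is merely integrable and has no preferred
    pointwise values, so it is identified through its integrals over boxes. On the line the formula
    is applied to psi and to bumps, which are continuous, so it can be proved pointwise. *)

Notation normc := Normc.normc.

Section complex_norm.
Context {R : realType}.
Implicit Types z w : R[i].

Lemma normc_ge0 z : 0 <= normc z.
Proof. by case: z => a b; rewrite sqrtr_ge0. Qed.

Lemma normcD z w : normc (z + w) <= normc z + normc w.
Proof. exact: le_normcD. Qed.

Lemma normc_conj z : normc z^* = normc z.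
Proof. by case: z => a b /=; rewrite sqrrN. Qed.

Lemma normc_real (r : R) : normc r%:C%C = `|r|.
Proof. by rewrite /= expr0n/= addr0 sqrtr_sqr. Qed.

Lemma normc_expi (t : R) : normc (expi t) = 1.
Proof. by rewrite /= cos2Dsin2 sqrtr1. Qed.

Lemma Re_le_normc z : `|complex.Re z| <= normc z.
Proof.
case: z => a b /=; rewrite -(sqrtr_sqr a) ler_wsqrtr// lerDl; exact: sqr_ge0.
Qed.

Lemma Im_le_normc z : `|complex.Im z| <= normc z.
Proof.
case: z => a b /=; rewrite -(sqrtr_sqr b) ler_wsqrtr// lerDr; exact: sqr_ge0.
Qed.

Lemma normc_le z : normc z <= `|complex.Re z| + `|complex.Im z|.
Proof.
case: z => a b /=; rewrite -[leRHS]ger0_norm ?addr_ge0// -sqrtr_sqr ler_wsqrtr//.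
by rewrite sqrrD !real_normK ?num_real// lerD2r lerDl mulrn_wge0// mulr_ge0.
Qed.

Lemma expiD (s t : R) : expi (s + t) = expi s * expi t.
Proof. by apply/eqP; rewrite eq_complex/= cosD sinD eqxx/= addrC. Qed.

Lemma expiN (t : R) : expi (- t) = (expi t)^*.
Proof. by rewrite /expi cosN sinN. Qed.

Lemma expi0 : expi 0 = 1 :> R[i].
Proof. by rewrite /expi cos0 sin0. Qed.

Lemma expiNM (t : R) : expi (- t) * expi t = 1.
Proof. by rewrite -expiD addNr expi0. Qed.

End complex_norm.

Section complex_measurable.
Context {R : realType} {d : measure_display} {T : measurableType d}.
Implicit Types g h : T -> R[i].

Definition cmeasurable g : Prop :=
  measurable_fun setT (fun x => complex.Re (g x)) /\
  measurable_fun setT (fun x => complex.Im (g x)).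

Lemma cmeasurable_cst (z : R[i]) : cmeasurable (fun=> z).
Proof. by split; exact: measurable_cst. Qed.

Lemma cmeasurable_real (f : T -> R) :
  measurable_fun setT f -> cmeasurable (fun x => (f x)%:C%C).
Proof. by split => //=; exact: measurable_cst. Qed.

Lemma cmeasurableM g h :
  cmeasurable g -> cmeasurable h -> cmeasurable (fun x => g x * h x).
Proof.
move=> [g1 g2] [h1 h2]; split.
  rewrite (_ : (fun _ => _) = (fun x => complex.Re (g x) * complex.Re (h x) -
     complex.Im (g x) * complex.Im (h x))); last first.
    by apply/funext => x; case: (g x) => ? ?; case: (h x).
  by apply: measurable_funB; exact: measurable_funM.
rewrite (_ : (fun _ => _) = (fun x => complex.Re (g x) * complex.Im (h x) +
     complex.Im (g x) * complex.Re (h x))); last first.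
  by apply/funext => x; case: (g x) => ? ?; case: (h x).
by apply: measurable_funD; exact: measurable_funM.
Qed.

Lemma cmeasurableD g h :
  cmeasurable g -> cmeasurable h -> cmeasurable (fun x => g x + h x).
Proof.
move=> [g1 g2] [h1 h2]; split.
  rewrite (_ : (fun _ => _) = (fun x => complex.Re (g x) + complex.Re (h x))).
    exact: measurable_funD.
  by apply/funext => x; case: (g x) => ? ?; case: (h x).
rewrite (_ : (fun _ => _) = (fun x => complex.Im (g x) + complex.Im (h x))).
  exact: measurable_funD.
by apply/funext => x; case: (g x) => ? ?; case: (h x).
Qed.

Lemma cmeasurable_conj g : cmeasurable g -> cmeasurable (fun x => (g x)^*).
Proof.
move=> [g1 g2]; split.
  by rewrite (_ : (fun _ => _) = (fun x => complex.Re (g x)))//;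
     apply/funext => x; case: (g x).
rewrite (_ : (fun _ => _) = (fun x => - complex.Im (g x)))//.
  exact: measurableT_comp.
by apply/funext => x; case: (g x).
Qed.

Lemma cmeasurableB g h :
  cmeasurable g -> cmeasurable h -> cmeasurable (fun x => g x - h x).
Proof.
move=> mg mh; under [X in cmeasurable X]funext do rewrite -[X in _ + X]mulN1r.
by apply: cmeasurableD => //; apply: cmeasurableM => //; exact: cmeasurable_cst.
Qed.

Lemma cmeasurable_expi (f : T -> R) :
  measurable_fun setT f -> cmeasurable (fun x => expi (f x)).
Proof.
move=> mf; split => /=; apply: measurableT_comp => //;
  apply: continuous_measurable_fun; [exact: continuous_cos|exact: continuous_sin].
Qed.

Lemma measurable_normc g :
  cmeasurable g -> measurable_fun setT (fun x => normc (g x)).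
Proof.
move=> [g1 g2].
rewrite (_ : (fun _ => _) = (@powR R ^~ 2^-1) \o (fun x =>
   complex.Re (g x) ^+ 2 + complex.Im (g x) ^+ 2)).
  apply: (measurableT_comp (measurable_powR _)).
  by apply: measurable_funD; exact: measurable_funX.
apply/funext => x /=; rewrite powR12_sqrt ?addr_ge0 ?sqr_ge0//.
by case: (g x).
Qed.

End complex_measurable.

Lemma cmeasurable_comp {R : realType} d1 d2 (T1 : measurableType d1)
    (T2 : measurableType d2) (g : T2 -> R[i]) (phi : T1 -> T2) :
  cmeasurable g -> measurable_fun setT phi -> cmeasurable (fun x => g (phi x)).
Proof.
by move=> [g1 g2] mphi; split;
   [apply: (measurableT_comp g1)|apply: (measurableT_comp g2)].
Qed.

Section complex_integral_theory.
Context {R : realType} {d : measure_display} {T : measurableType d}.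
Variable mu : {measure set T -> \bar R}.
Implicit Types g h : T -> R[i].

Lemma cintegrable_cmeasurable g : cintegrable mu setT g -> cmeasurable g.
Proof.
by move=> [/measurable_int/measurable_EFinP ? /measurable_int/measurable_EFinP].
Qed.

Lemma cintegrable_dom g (h : T -> R) : cmeasurable g ->
  mu.-integrable setT (EFin \o h) -> (forall x, normc (g x) <= h x) ->
  cintegrable mu setT g.
Proof.
move=> [g1 g2] ih gh; split; apply: le_integrable ih => //;
  [exact/measurable_EFinP| |exact/measurable_EFinP|] => x _ /=;
  rewrite lee_fin; apply: le_trans (le_trans (gh x) (ler_norm _)).
  exact: Re_le_normc.
exact: Im_le_normc.
Qed.

Lemma cintegrable_normc g : cintegrable mu setT g ->
  mu.-integrable setT (EFin \o (fun x => normc (g x))).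
Proof.
move=> ig; have mg := cintegrable_cmeasurable ig; have [i1 i2] := ig.
have := integrableD measurableT (integrable_norm i1) (integrable_norm i2).
apply: le_integrable => //; first exact/measurable_EFinP/measurable_normc.
move=> x _ /=; rewrite lee_fin (ger0_norm (normc_ge0 _)).
exact: le_trans (normc_le _) (ler_norm _).
Qed.

Lemma cintegrable_normcP g : cmeasurable g ->
  (\int[mu]_x (normc (g x))%:E < +oo)%E -> cintegrable mu setT g.
Proof.
move=> mg goo; apply: (cintegrable_dom mg (h := fun x => normc (g x))) => //.
apply/integrableP; split; first exact/measurable_EFinP/measurable_normc.
rewrite (le_lt_trans _ goo)//; apply: ge0_le_integral => //=.
- by do 2 apply: measurableT_comp => //; exact: measurable_normc.
- exact/measurable_EFinP/measurable_normc.
- by move=> x _; rewrite lee_fin ger0_norm// normc_ge0.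
Qed.

Lemma cintegrable_lty g : cintegrable mu setT g ->
  (\int[mu]_x (normc (g x))%:E < +oo)%E.
Proof.
move=> /cintegrable_normc /integrableP[_]; apply: le_lt_trans.
rewrite le_eqVlt; apply/orP; left; apply/eqP; apply: eq_integral => x _ /=.
by rewrite ger0_norm// normc_ge0.
Qed.

Lemma cintegrableM_bounded g h (M : R) : cintegrable mu setT g ->
  cmeasurable h -> (forall x, normc (h x) <= M) ->
  cintegrable mu setT (fun x => g x * h x).
Proof.
move=> ig mh hM.
have mg := cintegrable_cmeasurable ig.
apply: (@cintegrable_dom _ (fun x => M * normc (g x))).
- exact: cmeasurableM.
- by have := integrableZl measurableT M (cintegrable_normc ig).
- by move=> x; rewrite Normc.normcM mulrC ler_wpM2r// normc_ge0.
Qed.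

Lemma cintegrableZl g (c : R[i]) : cintegrable mu setT g ->
  cintegrable mu setT (fun x => c * g x).
Proof.
move=> ig; under [X in cintegrable _ _ X]funext do rewrite mulrC.
exact: (cintegrableM_bounded (M := normc c) ig (cmeasurable_cst c)).
Qed.

Lemma cintegrable_conj g : cintegrable mu setT g ->
  cintegrable mu setT (fun x => (g x)^*).
Proof.
move=> ig; apply: (cintegrable_dom _ (cintegrable_normc ig)).
  exact/cmeasurable_conj/cintegrable_cmeasurable.
by move=> x; rewrite normc_conj.
Qed.

Lemma cintegrableD g h : cintegrable mu setT g -> cintegrable mu setT h ->
  cintegrable mu setT (fun x => g x + h x).
Proof.
move=> ig ih.
apply: (@cintegrable_dom _ (fun x => normc (g x) + normc (h x))).
- by apply: cmeasurableD; exact: cintegrable_cmeasurable.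
- have := integrableD measurableT (cintegrable_normc ig) (cintegrable_normc ih).
  by [].
- by move=> x; exact: normcD.
Qed.

Lemma cintZl g (c : R[i]) : cintegrable mu setT g ->
  cint mu setT (fun x => c * g x) = c * cint mu setT g.
Proof.
move=> [i1 i2]; case: c => a b; apply/eqP; rewrite /cint eq_complex/=.
have iZ (r : R) (f : T -> R) : mu.-integrable setT (EFin \o f) ->
    mu.-integrable setT (EFin \o (fun x => r * f x)).
  by move=> i; have := integrableZl measurableT r i.
rewrite -!RintegralZl//; apply/andP; split; apply/eqP.
  rewrite -RintegralB//; [|exact: iZ..].
  by apply: eq_Rintegral => x _; case: (g x).
rewrite -RintegralD//; [|exact: iZ..].
by apply: eq_Rintegral => x _; case: (g x).
Qed.

Lemma cintZr g (c : R[i]) : cintegrable mu setT g ->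
  cint mu setT (fun x => g x * c) = cint mu setT g * c.
Proof.
move=> ig; rewrite mulrC -cintZl//; congr (cint _ _ _).
by apply/funext => x; rewrite mulrC.
Qed.

Lemma cintD g h : cintegrable mu setT g -> cintegrable mu setT h ->
  cint mu setT (fun x => g x + h x) = cint mu setT g + cint mu setT h.
Proof.
move=> [g1 g2] [h1 h2]; apply/eqP; rewrite /cint eq_complex/=.
rewrite -!RintegralD//; apply/andP; split; apply/eqP.
  by apply: eq_Rintegral => x _; case: (g x) => ? ?; case: (h x).
by apply: eq_Rintegral => x _; case: (g x) => ? ?; case: (h x).
Qed.

Lemma cint_conj g : cintegrable mu setT g ->
  cint mu setT (fun x => (g x)^*) = (cint mu setT g)^*.
Proof.
move=> [g1 g2]; apply/eqP; rewrite /cint eq_complex/=; apply/andP; split; apply/eqP.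
  by apply: eq_Rintegral => x _; case: (g x).
rewrite -mulN1r -RintegralZl//.
by apply: eq_Rintegral => x _; rewrite mulN1r; case: (g x).
Qed.

Lemma cint_real (f : T -> R) :
  cint mu setT (fun x => (f x)%:C%C) = (\int[mu]_x f x)%:C%C.
Proof.
apply/eqP; rewrite eq_complex/= eqxx/=; apply/eqP.
by rewrite /Rintegral integral0.
Qed.

(** The 2 comes from bounding the real and imaginary parts separately by the modulus. The lemma
    serves to show that transforms are bounded. *)
Lemma normc_cint g : cintegrable mu setT g ->
  normc (cint mu setT g) <= 2 * \int[mu]_x normc (g x).
Proof.
move=> ig; have [i1 i2] := ig.
rewrite mulr_natl mulr2n; apply: le_trans (normc_le _) _.
have ng := cintegrable_normc ig.
have nn (f : T -> R) : mu.-integrable setT (EFin \o f) ->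
    mu.-integrable setT (EFin \o (fun x => `|f x|)) by exact: integrable_norm.
by apply: lerD; (apply: le_trans; first exact: le_normr_Rintegral);
  apply: le_Rintegral => //; try exact: nn; move=> x _;
  [exact: Re_le_normc|exact: Im_le_normc].
Qed.

Lemma ae_eq_cint g h : cmeasurable g -> cmeasurable h ->
  (\forall x \ae mu, g x = h x) -> cint mu setT g = cint mu setT h.
Proof.
move=> [g1 g2] [h1 h2] gh; rewrite /cint /Rintegral; congr Complex; congr fine;
 apply: ae_eq_integral => //; do ?exact/measurable_EFinP;
 by apply: filterS gh => x gh _; rewrite gh.
Qed.

Lemma cintegrableS g (D : set T) : measurable D ->
  cintegrable mu setT g -> cintegrable mu D g.
Proof. by move=> mD [g1 g2]; split; apply: integrableS g1 || apply: integrableS g2. Qed.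

(** Convergence in [R[i]] is expressed here and below by a real sequence of moduli tending to 0, so
    that only the topology of R is involved. *)
Lemma cdominated_cvg (g_ : nat -> T -> R[i]) g (h : T -> R) :
  (forall n, cmeasurable (g_ n)) -> cmeasurable g ->
  mu.-integrable setT (EFin \o h) ->
  (forall n x, normc (g_ n x) <= h x) ->
  (\forall x \ae mu, (normc (g_ n x - g x) @[n --> \oo] --> (0 : R))) ->
  normc (cint mu setT (g_ n) - cint mu setT g) @[n --> \oo] --> (0 : R).
Proof.
move=> mg_ mg ih gh gg.
have mRe (f : T -> R[i]) : cmeasurable f -> measurable_fun setT (EFin \o (@complex.Re R \o f)).
  by move=> [? _]; exact/measurable_EFinP.
have mIm (f : T -> R[i]) : cmeasurable f -> measurable_fun setT (EFin \o (@complex.Im R \o f)).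
  by move=> [_ ?]; exact/measurable_EFinP.
(* [p] stands for either the real or the imaginary part: both are additive and bounded by the
   modulus. *)
have cvgp (p : R[i] -> R) : (forall z, `|p z| <= normc z) ->
    (forall z w, p (z - w) = p z - p w) ->
    (forall f : T -> R[i], cmeasurable f -> measurable_fun setT (EFin \o (p \o f))) ->
    (\int[mu]_x p (g_ n x)) @[n --> \oo] --> (\int[mu]_x p (g x)).
  move=> ple pB mp.
  have [|||||ig _ cvg] := @dominated_convergence _ _ _ mu _ measurableT
    (fun n => EFin \o (p \o g_ n)) (EFin \o (p \o g)) (EFin \o h) => //.
  - by move=> n; exact: mp.
  - exact: mp.
  - apply: filterS gg => x gx _; apply/cvg_EFin; first exact: nearW.
    apply/cvgrPdist_le => e e0; near=> n => /=.
    rewrite distrC -pB; apply: le_trans (ple _) _.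
    by near: n; have /cvgr0Pnorm_le/(_ _ e0) := gx;
      apply: filterS => n; rewrite ger0_norm// normc_ge0.
  - by apply: nearW => x n _ /=; rewrite lee_fin (le_trans (ple _)).
  rewrite /Rintegral; apply: fine_cvg; rewrite fineK//.
  exact: (integrable_fin_num _ ig).
have cRe := cvgp _ Re_le_normc.
have cIm := cvgp _ Im_le_normc.
have {}cRe : (\int[mu]_x complex.Re (g_ n x)) @[n --> \oo] --> (\int[mu]_x complex.Re (g x)).
  by apply: cRe => // -[? ?] [].
have {}cIm : (\int[mu]_x complex.Im (g_ n x)) @[n --> \oo] --> (\int[mu]_x complex.Im (g x)).
  by apply: cIm => // -[? ?] [].
apply/cvgr0Pnorm_le => e e0; have e2 : 0 < e / 2 by rewrite divr_gt0.
near=> n; rewrite ger0_norm ?normc_ge0//; apply: le_trans (normc_le _) _ => /=.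
rewrite [leRHS](splitr e); apply: lerD; near: n.
  have /cvgrPdist_le/(_ _ e2) := cRe.
  by apply: filterS => n; rewrite distrC.
have /cvgrPdist_le/(_ _ e2) := cIm.
by apply: filterS => n; rewrite distrC.
Unshelve. all: by end_near. Qed.

End complex_integral_theory.

(** * Fubini and Tonelli theorems for complex integrands *)

Section complex_fubini.
Context {R : realType} {d1 d2 : measure_display}.
Context {T1 : measurableType d1} {T2 : measurableType d2}.
Variables (m1 : {sigma_finite_measure set T1 -> \bar R}).
Variables (m2 : {sigma_finite_measure set T2 -> \bar R}).
Implicit Types (f : T1 * T2 -> R) (g : T1 * T2 -> R[i]).

(** A real integral is [fine] of an extended one, so it carries the right value only at those x
    whose section is integrable. This is almost every x, hence [fubini_F] and its finite version
    differ on a null set and share integrability and integral. *)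
Let real_fubini f : (m1 \x m2)%E.-integrable setT (EFin \o f) ->
  m1.-integrable setT (EFin \o (fun x => \int[m2]_y f (x, y))) /\
  \int[m1]_x (\int[m2]_y f (x, y)) = \int[(m1 \x m2)%E]_z f z.
Proof.
move=> fi.
have mF : measurable_fun setT (EFin \o (fun x => \int[m2]_y f (x, y))).
  apply/measurable_EFinP; rewrite /Rintegral.
  by apply: measurableT_comp => //; exact: (measurable_fubini_F fi).
have FE : ae_eq m1 setT (fubini_F m2 (EFin \o f))
    (EFin \o (fun x => \int[m2]_y f (x, y))).
  apply: filterS (ae_integrable1 fi) => x fx _.
  by rewrite /= /Rintegral fineK//; exact: (integrable_fin_num _ fx).
have Fi := integrable_fubini_F fi.
have {}Fi : m1.-integrable setT (EFin \o (fun x => \int[m2]_y f (x, y))).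
  apply/integrableP; split => //; have /integrableP[mF' ] := Fi.
  rewrite (ae_eq_integral (fun x => `|(\int[m2]_y f (x, y))%R%:E|)%E)//.
  - exact: measurableT_comp.
  - exact: measurableT_comp.
  - by apply: filterS FE => x /[apply] ->.
split => //; rewrite [RHS]/Rintegral -integral12_prod_meas1//.
congr fine; apply: ae_eq_integral => //; first exact: (measurable_fubini_F fi).
exact: ae_eq_sym.
Qed.

Let real_fubini2 f : (m1 \x m2)%E.-integrable setT (EFin \o f) ->
  m2.-integrable setT (EFin \o (fun y => \int[m1]_x f (x, y))) /\
  \int[m2]_y (\int[m1]_x f (x, y)) = \int[(m1 \x m2)%E]_z f z.
Proof.
move=> fi.
have mF : measurable_fun setT (EFin \o (fun y => \int[m1]_x f (x, y))).
  apply/measurable_EFinP; rewrite /Rintegral.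
  by apply: measurableT_comp => //; exact: (measurable_fubini_G fi).
have FE : ae_eq m2 setT (fubini_G m1 (EFin \o f))
    (EFin \o (fun y => \int[m1]_x f (x, y))).
  apply: filterS (ae_integrable2 fi) => x fx _.
  by rewrite /= /Rintegral fineK//; exact: (integrable_fin_num _ fx).
have Fi : m2.-integrable setT (fubini_G m1 (EFin \o f)).
  apply/integrableP; split; first exact: (measurable_fubini_G fi).
  have mf := measurable_int _ fi.
  have := (integrable21ltyP m1 m2 mf).1 fi; apply: le_lt_trans.
  apply: ge0_le_integral => //.
  - by apply: measurableT_comp => //; exact: (measurable_fubini_G fi).
  - apply: (measurable_fun_fubini_tonelli_G (abse \o (EFin \o f))) => //.
    exact: measurableT_comp.
  - by move=> z; exact: abse_ge0.
  - by move=> y _; apply: le_abse_integral => //; exact: measurableT_comp.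
have {}Fi : m2.-integrable setT (EFin \o (fun x => \int[m1]_y f (y, x))).
  apply/integrableP; split => //; have /integrableP[mF' ] := Fi.
  rewrite (ae_eq_integral (fun x => `|(\int[m1]_y f (y, x))%R%:E|)%E)//.
  - exact: measurableT_comp.
  - exact: measurableT_comp.
  - by apply: filterS FE => x /[apply] ->.
split => //; rewrite [RHS]/Rintegral -integral21_prod_meas1//.
congr fine; apply: ae_eq_integral => //; first exact: (measurable_fubini_G fi).
exact: ae_eq_sym.
Qed.

Lemma cintegrable_prodP g : cmeasurable g ->
  (\int[m1]_x \int[m2]_y (normc (g (x, y)))%:E < +oo)%E ->
  cintegrable (m1 \x m2)%E setT g.
Proof.
move=> mg goo; apply: cintegrable_normcP => //.
rewrite (@fubini_tonelli1 _ _ _ _ _ m1 m2 (fun z => (normc (g z))%:E))//.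
  exact/measurable_EFinP/measurable_normc.
by move=> z; rewrite lee_fin normc_ge0.
Qed.

Lemma cintegrable_prodP2 g : cmeasurable g ->
  (\int[m2]_y \int[m1]_x (normc (g (x, y)))%:E < +oo)%E ->
  cintegrable (m1 \x m2)%E setT g.
Proof.
move=> mg goo; apply: cintegrable_normcP => //.
rewrite (@fubini_tonelli2 _ _ _ _ _ m1 m2 (fun z => (normc (g z))%:E))//.
  exact/measurable_EFinP/measurable_normc.
by move=> z; rewrite lee_fin normc_ge0.
Qed.

Lemma cintegrable_tensor (g : T1 -> R[i]) (h : T2 -> R[i]) :
  cintegrable m1 setT g -> cintegrable m2 setT h ->
  cintegrable (m1 \x m2)%E setT (fun z => g z.1 * h z.2).
Proof.
move=> ig ih; apply: cintegrable_prodP.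
  apply: cmeasurableM.
    by apply: cmeasurable_comp measurable_fst; exact: cintegrable_cmeasurable ig.
  by apply: cmeasurable_comp measurable_snd; exact: cintegrable_cmeasurable ih.
rewrite (eq_integral (fun x => (normc (g x))%:E * \int[m2]_y (normc (h y))%:E)%E).
  rewrite ge0_integralZr//.
  - apply: lte_mul_pinfty => //.
    + by apply: integral_ge0 => ? _; rewrite lee_fin normc_ge0.
    + rewrite ge0_fin_numE; first exact: cintegrable_lty ig.
      by apply: integral_ge0 => ? _; rewrite lee_fin normc_ge0.
    + exact: cintegrable_lty.
  - exact/measurable_EFinP/measurable_normc/(cintegrable_cmeasurable ig).
  - by move=> x _; rewrite lee_fin normc_ge0.
  - by apply: integral_ge0 => ? _; rewrite lee_fin normc_ge0.
move=> x _; rewrite -ge0_integralZl//.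
- by apply: eq_integral => y _; rewrite Normc.normcM EFinM.
- exact/measurable_EFinP/measurable_normc/(cintegrable_cmeasurable ih).
- by move=> y _; rewrite lee_fin normc_ge0.
- by rewrite lee_fin normc_ge0.
Qed.

Section fubini.
Variable g : T1 * T2 -> R[i].
Hypothesis ig : cintegrable (m1 \x m2)%E setT g.

Lemma ae_cintegrable1 : {ae m1, forall x, cintegrable m2 setT (fun y => g (x, y))}.
Proof.
have [g1 g2] := ig.
by apply: filterS2 (ae_integrable1 g1) (ae_integrable1 g2) => x ? ?; split.
Qed.

Lemma cintegrable_fubini1 : cintegrable m1 setT (fun x => cint m2 setT (fun y => g (x, y))).
Proof. by have [g1 g2] := ig; split; [apply: (real_fubini g1).1|apply: (real_fubini g2).1]. Qed.

Lemma cintegrable_fubini2 : cintegrable m2 setT (fun y => cint m1 setT (fun x => g (x, y))).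
Proof. by have [g1 g2] := ig; split; [apply: (real_fubini2 g1).1|apply: (real_fubini2 g2).1]. Qed.

Lemma cint_fubini1 :
  cint m1 setT (fun x => cint m2 setT (fun y => g (x, y))) = cint (m1 \x m2)%E setT g.
Proof.
have [g1 g2] := ig; rewrite /cint/=.
by congr Complex; [apply: (real_fubini g1).2|apply: (real_fubini g2).2].
Qed.

Lemma cint_fubini2 :
  cint m2 setT (fun y => cint m1 setT (fun x => g (x, y))) = cint (m1 \x m2)%E setT g.
Proof.
have [g1 g2] := ig; rewrite /cint/=.
by congr Complex; [apply: (real_fubini2 g1).2|apply: (real_fubini2 g2).2].
Qed.

Lemma cint_fubini :
  cint m1 setT (fun x => cint m2 setT (fun y => g (x, y))) =
  cint m2 setT (fun y => cint m1 setT (fun x => g (x, y))).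
Proof. by rewrite cint_fubini1 cint_fubini2. Qed.

End fubini.
End complex_fubini.

Lemma cintegrableM_expi {R : realType} {d : measure_display} {T : measurableType d}
    (mu : {measure set T -> \bar R}) (g : T -> R[i]) (h : T -> R) :
  cintegrable mu setT g -> measurable_fun setT h ->
  cintegrable mu setT (fun x => g x * expi (h x)).
Proof.
move=> ig mh; apply: (cintegrableM_bounded (M := 1) ig (cmeasurable_expi mh)) => x.
by rewrite normc_expi.
Qed.

Section kernel_fubini.
Context {R : realType} {d1 d2 : measure_display}.
Context {T1 : measurableType d1} {T2 : measurableType d2}.
Variables (m1 : {sigma_finite_measure set T1 -> \bar R}).
Variables (m2 : {sigma_finite_measure set T2 -> \bar R}).

(** No integrability is assumed: Tonelli gives the measurability of the integrals of the positive
    and negative parts, their difference is a measurable extended function, and [fine] is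
    measurable. *)
Lemma cmeasurable_cint1 (g : T1 * T2 -> R[i]) : cmeasurable g ->
  cmeasurable (fun x => cint m2 setT (fun y => g (x, y))).
Proof.
have mI (h : T1 * T2 -> R) : measurable_fun setT h ->
    measurable_fun setT (fun x => \int[m2]_y h (x, y)).
  move=> /measurable_EFinP mh.
  rewrite /Rintegral; apply: measurableT_comp => //=.
  rewrite (_ : (fun x => (\int[m2]_y (h (x, y))%:E)%E) = (fun x =>
      (\int[m2]_y (EFin \o h)^\+ (x, y) - \int[m2]_y (EFin \o h)^\- (x, y))%E)).
    apply: emeasurable_funB.
      exact: (measurable_fun_fubini_tonelli_F _ (measurable_funepos mh) (funepos_ge0 _)).
    exact: (measurable_fun_fubini_tonelli_F _ (measurable_funeneg mh) (funeneg_ge0 _)).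
  apply/funext => x; rewrite integralE; congr (_ - _)%E; apply: eq_integral => y _.
    exact: (congr1 (@^~ y) (funepos_comp (EFin \o h) (pair x))).
  exact: (congr1 (@^~ y) (funeneg_comp (EFin \o h) (pair x))).
by move=> [g1 g2]; split; [exact: (mI _ g1)|exact: (mI _ g2)].
Qed.

Section kernel.
Variables (f : T1 -> R[i]) (g : T2 -> R[i]) (K : T1 * T2 -> R[i]) (M : R).
Hypotheses (fi : cintegrable m1 setT f) (gi : cintegrable m2 setT g).
Hypotheses (mK : cmeasurable K) (KM : forall z, normc (K z) <= M).

Lemma cintegrable_kernel :
  cintegrable (m1 \x m2)%E setT (fun z => f z.1 * g z.2 * K z).
Proof. exact: (cintegrableM_bounded (cintegrable_tensor fi gi) mK KM). Qed.

Lemma cintegrable_kernel1 x : cintegrable m2 setT (fun y => g y * K (x, y)).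
Proof.
apply: (cintegrableM_bounded (M := M) gi) => //.
exact: (cmeasurable_comp mK (pair1_measurable x)).
Qed.

Lemma cintegrable_kernel2 y : cintegrable m1 setT (fun x => f x * K (x, y)).
Proof.
apply: (cintegrableM_bounded (M := M) fi) => //.
exact: (cmeasurable_comp mK (pair2_measurable y)).
Qed.

Let kernelZ x : cint m2 setT (fun y => f x * g y * K (x, y)) =
  f x * cint m2 setT (fun y => g y * K (x, y)).
Proof.
rewrite -cintZl; last exact: cintegrable_kernel1.
by congr (cint _ _ _); apply/funext => y; rewrite mulrA.
Qed.

Lemma cintegrable_kernel_cint :
  cintegrable m1 setT (fun x => f x * cint m2 setT (fun y => g y * K (x, y))).
Proof.
under [X in cintegrable _ _ X]funext do rewrite -kernelZ.
exact: (cintegrable_fubini1 cintegrable_kernel).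
Qed.

(** The multiplication formula: a bounded kernel against a tensor of two integrable functions is
    integrable on the product. With [K] of the form exp(i times a phase), it justifies moving a
    Fourier transform from one factor to the other. *)
Lemma cint_kernel_swap :
  cint m1 setT (fun x => f x * cint m2 setT (fun y => g y * K (x, y))) =
  cint m2 setT (fun y => g y * cint m1 setT (fun x => f x * K (x, y))).
Proof.
under [X in cint _ _ X = _]funext do rewrite -kernelZ.
rewrite (cint_fubini cintegrable_kernel); congr (cint _ _ _); apply/funext => y.
rewrite -cintZl; last exact: cintegrable_kernel2.
by congr (cint _ _ _); apply/funext => x /=; rewrite [f x * _]mulrC mulrA.
Qed.

End kernel.
End kernel_fubini.

(** * Affine changes of variables and products of one-variable functions *)

Section scaled_transfer.
Context {R : realType} {d1 d2 : measure_display}.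
Context {T1 : measurableType d1} {T2 : measurableType d2}.
Variables (m1 : {measure set T1 -> \bar R}) (m2 : {measure set T2 -> \bar R}).
Variables (phi : T1 -> T2) (k : R).
Hypotheses (mphi : measurable_fun setT phi) (k0 : 0 <= k).
Hypothesis phiE : forall A, measurable A -> m1 (phi @^-1` A) = (k%:E * m2 A)%E.

(** The hypothesis [phiE] says that the image of [m1] under [phi] is [k] times [m2]. It covers
    affine maps of R, dilations of R^n, and, with k = 1, the identification of R * R^n with
    R^(n+1). *)
Lemma ge0_integral_transfer (g : T2 -> \bar R) : measurable_fun setT g ->
  (forall x, (0 <= g x)%E) ->
  (\int[m1]_x g (phi x) = k%:E * \int[m2]_x g x)%E.
Proof.
move=> mg g0.
have mf := isMeasurableFun.Build _ _ _ _ _ mphi.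
pose phim : {mfun T1 >-> T2} := MeasurableFun.Pack (MeasurableFun.Class mf).
pose kn : {nonneg R} := NngNum k0.
rewrite -[RHS](@ge0_integral_mscale _ _ R m2 setT measurableT kn)//.
transitivity (\int[pushforward m1 phim]_x g x)%E.
  by rewrite ge0_integral_pushforward.
apply: (@eq_measure_integral _ _ _ _ (mscale kn m2)) => A mA _.
exact: phiE.
Qed.

Lemma cintegrable_transfer (g : T2 -> R[i]) : cintegrable m2 setT g ->
  cintegrable m1 setT (fun x => g (phi x)).
Proof.
move=> ig; have mg := cintegrable_cmeasurable ig.
apply: cintegrable_normcP; first exact: cmeasurable_comp mphi.
rewrite (ge0_integral_transfer (g := fun x => (normc (g x))%:E)).
- rewrite lte_mul_pinfty//; exact: cintegrable_lty.
- exact/measurable_EFinP/measurable_normc.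
- by move=> x; rewrite lee_fin normc_ge0.
Qed.

Lemma cintegrable_transferP (g : T2 -> R[i]) : k != 0 -> cmeasurable g ->
  cintegrable m1 setT (fun x => g (phi x)) -> cintegrable m2 setT g.
Proof.
move=> kN0 mg /cintegrable_lty.
rewrite (ge0_integral_transfer (g := fun x => (normc (g x))%:E)); last 2 first.
- exact/measurable_EFinP/measurable_normc.
- by move=> x; rewrite lee_fin normc_ge0.
move=> goo; apply: cintegrable_normcP => //.
move: goo; rewrite ltey; apply: contraTT; rewrite -leNgt leye_eq => /eqP ->.
by rewrite gt0_muley// lte_fin lt0r kN0.
Qed.

Let real_transfer (f : T2 -> R) : m2.-integrable setT (EFin \o f) ->
  \int[m1]_x f (phi x) = k * \int[m2]_x f x.
Proof.
move=> fi; have mf := measurable_int _ fi.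
rewrite /Rintegral -[X in X * _](_ : fine k%:E = k)// -fineM//; last first.
  exact: (integrable_fin_num _ fi).
congr fine; rewrite integralE [in RHS]integralE muleBr//; last first.
  apply: fin_num_adde_defl; rewrite fin_numN.
  exact: integrable_neg_fin_num.
congr (_ - _)%E.
- have <- := ge0_integral_transfer (measurable_funepos mf) (funepos_ge0 _).
  by rewrite (_ : (fun x => _%:E) = (EFin \o f) \o phi)// funepos_comp.
- have <- := ge0_integral_transfer (measurable_funeneg mf) (funeneg_ge0 _).
  by rewrite (_ : (fun x => _%:E) = (EFin \o f) \o phi)// funeneg_comp.
Qed.

Lemma cint_transfer (g : T2 -> R[i]) : cintegrable m2 setT g ->
  cint m1 setT (fun x => g (phi x)) = k%:C%C * cint m2 setT g.
Proof.
move=> [i1 i2]; apply/eqP; rewrite eq_complex/= !mul0r subr0 addr0.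
by rewrite (real_transfer i1) (real_transfer i2) !eqxx.
Qed.

End scaled_transfer.

Section lebesgue_affine.
Context {R : realType}.
Local Notation lambda := (@lebesgue_measure R).

Lemma measurable_affine (a c : R) : measurable_fun setT (fun x : R => a * x + c).
Proof. by apply: measurable_funD => //; exact: measurable_funM. Qed.

(** By uniqueness of Lebesgue measure, it is enough that [|a|] times the image measure gives each
    interval ]p, q] its length. *)
Lemma lebesgue_measure_affine (a c : R) (A : set R) : a != 0 -> measurable A ->
  lambda ((fun x => a * x + c) @^-1` A) = (`|a|^-1%:E * lambda A)%E.
Proof.
move=> a0 mA.
pose phi (x : measurableTypeR R) : measurableTypeR R := a * x + c.
have mphi : measurable_fun [set: measurableTypeR R] phi by exact: measurable_affine.
pose kn : {nonneg R} := NngNum (normr_ge0 a).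
have a1 : 0 < `|a| by rewrite normr_gt0.
have E : forall B : set (measurableTypeR R), measurable B ->
    lambda B = mscale kn (pushforward lambda phi) B; last first.
  rewrite (E mphi A mA).
  by rewrite /mscale/= muleA -EFinM mulVf ?mul1e// gt_eqF.
move=> m; apply: lebesgue_measure_unique => _ [[p q] _ <-].
transitivity (`|a|%:E * lambda (phi @^-1` [set` `]p, q]]))%E; last by [].
have pre (x : R) : phi x = a * x + c by [].
(* A negative slope turns ]p, q] into an interval closed on the left and open on the right, of the
   same length as the half-open one of the other kind. *)
have [an|ap] := ltP a 0.
  have -> : phi @^-1` [set` `]p, q]] = [set` `[(q - c) / a, (p - c) / a[].
    apply/seteqP; split => x /=; rewrite !in_itv/= pre.
      by move=> /andP[px xq]; rewrite ler_ndivrMr// ltr_ndivlMr// mulrC; lra.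
    by rewrite ler_ndivrMr// ltr_ndivlMr// mulrC => /andP[? ?]; lra.
  rewrite !lebesgue_measure_itv/= !lte_fin ltr_ndivrMr// mulfVK// ltrD2r.
  case: ifPn => pq; last by rewrite mule0.
  rewrite -EFinB -EFinM; congr (_%:E); rewrite ltr0_norm//; field.
  by rewrite lt_eqF.
have {}ap : 0 < a by rewrite lt0r a0.
have -> : phi @^-1` [set` `]p, q]] = [set` `](p - c) / a, (q - c) / a]].
  apply/seteqP; split => x /=; rewrite !in_itv/= pre.
    by move=> /andP[px xq]; rewrite ltr_pdivrMr// ler_pdivlMr// mulrC; lra.
  by rewrite ltr_pdivrMr// ler_pdivlMr// mulrC => /andP[? ?]; lra.
rewrite !lebesgue_measure_itv/= !lte_fin ltr_pdivrMr// mulfVK// ltrD2r.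
case: ifPn => pq; last by rewrite mule0.
rewrite -EFinB -EFinM; congr (_%:E); rewrite gtr0_norm//; field.
by rewrite gt_eqF.
Qed.

Lemma ge0_integral_affine (a c : R) (g : R -> \bar R) : a != 0 ->
  measurable_fun setT g -> (forall x, (0 <= g x)%E) ->
  (\int[lambda]_x g (a * x + c)%R = `|a|^-1%:E * \int[lambda]_x g x)%E.
Proof.
move=> a0 mg g0.
apply: (@ge0_integral_transfer _ _ _ _ _ lambda lambda (fun x => a * x + c)) => //.
  exact: measurable_affine.
by move=> A mA; exact: (lebesgue_measure_affine c a0 mA).
Qed.

Lemma cintegrable_affine (a c : R) (g : R -> R[i]) : a != 0 ->
  cintegrable lambda setT g -> cintegrable lambda setT (fun x => g (a * x + c)).
Proof.
move=> a0 ig.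
apply: (@cintegrable_transfer _ _ _ _ _ lambda lambda _ `|a|^-1) ig => //.
  exact: measurable_affine.
by move=> A mA; exact: (lebesgue_measure_affine c a0 mA).
Qed.

Lemma cint_affine (a c : R) (g : R -> R[i]) : a != 0 ->
  cintegrable lambda setT g ->
  cint lambda setT (fun x => g (a * x + c)) = (`|a|^-1)%:C%C * cint lambda setT g.
Proof.
move=> a0 ig.
apply: (@cint_transfer _ _ _ _ _ lambda lambda) => //.
  exact: measurable_affine.
by move=> A mA; exact: (lebesgue_measure_affine c a0 mA).
Qed.

End lebesgue_affine.

(** * Lebesgue measure on tuples: tensor products and dilations *)

Section lebesgue_tuple_theory.
Context {R : realType}.
Local Notation lambda := (@lebesgue_measure R).
Local Notation lebn n := (@lebesgue_tuple R n).

Definition tcons {n} (p : measurableTypeR R * n.-tuple R) : n.+1.-tuple R :=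
  [tuple of p.1 :: p.2].

Lemma measurable_tcons n : measurable_fun setT (@tcons n).
Proof.
apply: (@measurable_cons _ _ (measurableTypeR R * n.-tuple R)%type R fst n snd).
  exact: measurable_fst.
exact: measurable_snd.
Qed.

Let tconsE n (A : set (n.+1.-tuple R)) :
  (lambda \x lebn n)%E (tcons @^-1` A) = (1%:E * lebn n.+1 A)%E.
Proof. by rewrite mul1e. Qed.

Lemma ge0_integral_tcons n (g : n.+1.-tuple R -> \bar R) : measurable_fun setT g ->
  (forall x, (0 <= g x)%E) ->
  (\int[lebn n.+1]_x g x = \int[lambda]_t \int[lebn n]_v g (tcons (t, v)))%E.
Proof.
move=> mg g0; rewrite -[LHS]mul1e.
have mgt : measurable_fun setT (fun z => g (tcons z)).
  exact: (measurableT_comp mg (@measurable_tcons n)).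
rewrite -(@ge0_integral_transfer _ _ _ _ _ (lambda \x lebn n)%E (lebn n.+1) tcons)//.
- by rewrite (fubini_tonelli1 (fun x => g (tcons x))).
- exact: measurable_tcons.
- by move=> A _; exact: tconsE.
Qed.

Lemma cintegrable_tcons n (g : n.+1.-tuple R -> R[i]) : cmeasurable g ->
  cintegrable (lambda \x lebn n)%E setT (fun z => g (tcons z)) <->
  cintegrable (lebn n.+1) setT g.
Proof.
move=> mg; split => ig.
  apply: (@cintegrable_transferP _ _ _ _ _ (lambda \x lebn n)%E (lebn n.+1) tcons 1) => //.
    exact: measurable_tcons.
  by move=> A _; exact: tconsE.
apply: (@cintegrable_transfer _ _ _ _ _ (lambda \x lebn n)%E (lebn n.+1) tcons 1) => //.
  exact: measurable_tcons.
by move=> A _; exact: tconsE.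
Qed.

Lemma cint_tcons n (g : n.+1.-tuple R -> R[i]) : cintegrable (lebn n.+1) setT g ->
  cint (lebn n.+1) setT g = cint (lambda \x lebn n)%E setT (fun z => g (tcons z)).
Proof.
move=> ig.
rewrite (@cint_transfer _ _ _ _ _ (lambda \x lebn n)%E (lebn n.+1) tcons 1 _ _ _ g)//.
- by rewrite mul1r.
- exact: measurable_tcons.
- by move=> A _; exact: tconsE.
Qed.

Lemma measurable_tprod n (F : 'I_n -> R -> R[i]) :
  (forall i, cmeasurable (F i)) ->
  cmeasurable (fun x : n.-tuple R => \prod_(i < n) F i (tnth x i)).
Proof.
move=> mF; rewrite /index_enum; elim: (Finite.enum _) => [|i s IH].
  by under [X in cmeasurable X]funext do rewrite big_nil; exact: cmeasurable_cst.
under [X in cmeasurable X]funext do rewrite big_cons.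
apply: cmeasurableM => //.
exact: (cmeasurable_comp (mF i) (measurable_tnth _)).
Qed.

Lemma tprod_tcons n (F : 'I_n.+1 -> R -> R[i]) (z : R * n.-tuple R) :
  \prod_(i < n.+1) F i (tnth (tcons z) i) =
  F ord0 z.1 * \prod_(i < n) F (lift ord0 i) (tnth z.2 i).
Proof.
rewrite big_ord_recl; congr (_ * _); apply: eq_bigr => i _.
by rewrite tnthS.
Qed.

Lemma cint_tprod n (F : 'I_n -> R -> R[i]) :
  (forall i, cintegrable lambda setT (F i)) ->
  cintegrable (lebn n) setT (fun x => \prod_(i < n) F i (tnth x i)) /\
  cint (lebn n) setT (fun x => \prod_(i < n) F i (tnth x i)) =
  \prod_(i < n) cint lambda setT (F i).
Proof.
elim: n F => [|n IH] F iF.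
  under [X in cintegrable _ _ X /\ _]funext do rewrite big_ord0.
  under [X in _ /\ cint _ _ X = _]funext do rewrite big_ord0.
  rewrite big_ord0; split.
    apply: cintegrable_normcP; first exact: cmeasurable_cst.
    by rewrite integral_cst//= diracT mule1 ltry.
  have l0 : lebn 0 setT = 1%E by rewrite /= diracT.
  rewrite (cint_real _ (cst 1)) Rintegral_cst// mul1r; congr (_%:C%C).
  exact: (congr1 fine l0).
have [i1 e1] := IH (fun i => F (lift ord0 i)) (fun i => iF _).
have mF i : cmeasurable (F i) by exact: cintegrable_cmeasurable (iF i).
have ip : cintegrable (lambda \x lebn n)%E setT
    (fun z => \prod_(i < n.+1) F i (tnth (tcons z) i)).
  under [X in cintegrable _ _ X]funext do rewrite tprod_tcons.
  exact: (cintegrable_tensor (iF ord0) i1).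
have is' : cintegrable (lebn n.+1) setT (fun x => \prod_(i < n.+1) F i (tnth x i)).
  by apply/cintegrable_tcons => //; exact: measurable_tprod.
split => //; rewrite cint_tcons// -cint_fubini1// big_ord_recl -e1.
rewrite -cintZr; last exact: iF.
congr (cint _ _ _); apply/funext => t; rewrite -cintZl//.
by congr (cint _ _ _); apply/funext => v; rewrite tprod_tcons.
Qed.

Definition tscale {n} (a : R) (x : n.-tuple R) : n.-tuple R :=
  [tuple a * tnth x i | i < n].

Lemma tnth_tscale n a (x : n.-tuple R) i : tnth (tscale a x) i = a * tnth x i.
Proof. by rewrite tnth_mktuple. Qed.

Lemma tscale_tcons n a (t : R) (v : n.-tuple R) :
  tscale a (tcons (t, v)) = tcons (a * t, tscale a v).
Proof.
apply: eq_from_tnth => i; rewrite tnth_tscale.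
by case: (unliftP ord0 i) => [j|] ->; rewrite ?tnthS ?tnth0 ?tnth_tscale.
Qed.

Lemma measurable_tscale2 n :
  measurable_fun setT (fun z : R * n.-tuple R => tscale z.1 z.2).
Proof.
apply/measurable_fun_tnthP => i.
rewrite (_ : _ \o _ = (fun z : R * n.-tuple R => z.1 * tnth z.2 i)).
  apply: measurable_funM => //.
  exact: (measurableT_comp (measurable_tnth i) measurable_snd).
by apply/funext => z /=; rewrite tnth_tscale.
Qed.

Lemma measurable_tscale n a : measurable_fun setT (@tscale n a).
Proof.
apply/measurable_fun_tnthP => i.
rewrite (_ : _ \o _ = (fun z : n.-tuple R => a * tnth z i)).
  by apply: measurable_funM => //; exact: measurable_tnth.
by apply/funext => z /=; rewrite tnth_tscale.
Qed.

(** Induction on the dimension: each coordinate contributes one factor [|a|^-1] by the affine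
    substitution on R. *)
Lemma ge0_integral_tscale n (a : R) (g : n.-tuple R -> \bar R) : a != 0 ->
  measurable_fun setT g -> (forall x, (0 <= g x)%E) ->
  (\int[lebn n]_x g (tscale a x) = (`|a| ^- n)%:E * \int[lebn n]_x g x)%E.
Proof.
move=> a0; elim: n g => [|n IH] g mg g0.
  rewrite expr0 invr1 mul1e; apply: eq_integral => x _; congr (g _).
  by apply: eq_from_tnth => -[].
have mga : measurable_fun setT (fun x => g (tscale a x)).
  exact: (measurableT_comp mg (measurable_tscale a)).
have mgt : measurable_fun setT (fun z => g (tcons z)).
  exact: (measurableT_comp mg (@measurable_tcons n)).
rewrite !ge0_integral_tcons//.
transitivity (\int[lambda]_t ((`|a| ^- n)%:E * \int[lebn n]_v g (tcons ((a * t)%R, v))))%E.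
  apply: eq_integral => t _.
  rewrite -(IH (fun v => g (tcons ((a * t)%R, v))))//.
    by apply: eq_integral => v _; rewrite tscale_tcons.
  exact: (measurableT_comp mgt (measurable_pair1 _)).
have mG : measurable_fun setT (fun t : R => \int[lebn n]_v g (tcons (t, v)))%E.
  by have := @measurable_fun_fubini_tonelli_F _ _ _ _ _ (lebn n) _ mgt (fun z => g0 _).
have G0 t : (0 <= \int[lebn n]_v g (tcons (t, v)))%E by exact: integral_ge0.
have := @ge0_integral_affine R a 0 _ a0 mG G0.
under eq_integral do rewrite addr0.
move=> E; have ma : measurable_fun [set: R] (fun t : R => a * t) by exact: measurable_funM.
rewrite ge0_integralZl; [|exact: measurableT|exact: (measurableT_comp mG ma)| |]; last 2 first.
- by move=> x _; exact: G0.
- by rewrite lee_fin invr_ge0 exprn_ge0.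
by rewrite E muleA -EFinM exprS invfM mulrC.
Qed.

Lemma lebesgue_tuple_tscale n (a : R) (A : set (n.-tuple R)) : a != 0 ->
  measurable A -> lebn n (tscale a @^-1` A) = ((`|a| ^- n)%:E * lebn n A)%E.
Proof.
move=> a0 mA.
have mA' : measurable (tscale a @^-1` A).
  by rewrite -[X in measurable X]setTI; exact: measurable_tscale.
have m1 : measurable_fun setT (fun x : n.-tuple R => (\1_A x : R)%:E).
  exact/measurable_EFinP.
have g0 (x : n.-tuple R) : (0 <= (\1_A x : R)%:E)%E by rewrite lee_fin.
have := ge0_integral_tscale a0 m1 g0.
rewrite [X in _ = (_ * X)%E]integral_indic// setIT => E.
transitivity (\int[lebn n]_x (\1_(tscale a @^-1` A) x)%:E)%E; last exact: E.
by rewrite integral_indic// setIT.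
Qed.

Lemma cintegrable_tscale n (a : R) (g : n.-tuple R -> R[i]) : a != 0 ->
  cintegrable (lebn n) setT g ->
  cintegrable (lebn n) setT (fun x => g (tscale a x)).
Proof.
move=> a0 ig; apply: (@cintegrable_transfer _ _ _ _ _ (lebn n) (lebn n)
  (tscale a) (`|a| ^- n)) => //.
- exact: measurable_tscale.
- by move=> A mA; exact: (lebesgue_tuple_tscale a0 mA).
Qed.

Lemma cint_tscale n (a : R) (g : n.-tuple R -> R[i]) : a != 0 ->
  cintegrable (lebn n) setT g ->
  cint (lebn n) setT (fun x => g (tscale a x)) =
  (`|a| ^- n)%:C%C * cint (lebn n) setT g.
Proof.
move=> a0 ig; apply: (@cint_transfer _ _ _ _ _ (lebn n) (lebn n) (tscale a)) => //.
- exact: measurable_tscale.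
- by move=> A mA; exact: (lebesgue_tuple_tscale a0 mA).
Qed.

End lebesgue_tuple_theory.

(** * Polar coordinates *)

Section tail_integral.
Context {R : realType}.
Local Notation lambda := (@lebesgue_measure R).

Lemma measurable_inv : measurable_fun setT (fun x : R => x^-1).
Proof.
(* The power -1 is the inverse on nonnegative bases, whence the square. At 0 both sides vanish since
   0^-1 = 0. *)
rewrite (_ : (fun _ => _) = (fun x : R => x * (x ^+ 2) `^ (-1))).
  apply: measurable_funM => //.
  by apply: (measurableT_comp (measurable_powR _)); exact: measurable_funX.
apply/funext => x; rewrite powR_inv1 ?sqr_ge0//.
by have [->|x0] := eqVneq x 0; [rewrite invr0 mul0r|field].
Qed.


Lemma integral_tail_powV n (r : R) : 0 < r ->
  (\int[lambda]_(s in `[r, +oo[) ((s^-1) ^+ n.+2)%:E =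
   (n.+1%:R^-1 * r^-1 ^+ n.+1)%:E)%E.
Proof.
move=> r0; pose F (s : R) := - n.+1%:R^-1 * s^-1 ^+ n.+1.
have dF (x : R) : 0 < x -> is_derive x 1 F (x^-1 ^+ n.+2).
  move=> x0; have xN0 : x != 0 by rewrite gt_eqF.
  have dV : is_derive x 1 (fun y : R => y^-1) (- x ^- 2 *: 1).
    exact: is_deriveV.
  have dX := is_deriveX n.+1 dV.
  have dZ := is_deriveZ (- n.+1%:R^-1 : R) dX.
  rewrite (_ : F = (- n.+1%:R^-1 : R) \*: ((fun y : R => y^-1) ^+ n.+1)); last first.
    by apply/funext => y /=; rewrite exprfctE.
  apply: (is_derive_eq dZ); rewrite /GRing.scale/= -[in RHS]addn2 exprD.
  have n0 : (n.+1%:R : R) != 0 by rewrite pnatr_eq0.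
  rewrite -!exprVn mulr1.
  set k := n.+1%:R in n0 *; set w := x^-1.
  by field.
rewrite (@ge0_continuous_FTC2y R _ F r 0).
- by rewrite sub0e -EFinN /F mulNr opprK.
- by move=> x rx; rewrite exprn_ge0// invr_ge0 (le_trans (ltW r0)).
- apply: continuous_in_subspaceT => x /set_mem/=; rewrite in_itv/= andbT => rx.
  have xN0 : x != 0 by rewrite gt_eqF// (lt_le_trans r0).
  apply: (@continuous_comp _ _ _ (fun x : R => x^-1) (fun x => x ^+ n.+2)).
    exact: cvgV.
  exact: exprn_continuous.
- rewrite -[X in _ --> X](mulr0 (- n.+1%:R^-1)); apply: cvgMr.
  rewrite [X in _ --> X](_ : 0 = 0 ^+ n.+1); last by rewrite expr0n.
  apply: (@cvg_comp _ _ _ (fun x : R => x^-1) (fun x => x ^+ n.+1) _ (nbhs 0)).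
    apply/gtr0_cvgV0; last exact: cvg_id.
    exact: nbhs_pinfty_gt.
  exact: exprn_continuous.
- by move=> x rx; have [] := dF x (lt_trans r0 rx).
- apply: cvg_at_right_filter.
  have [dr _] := dF r r0.
  by apply: differentiable_continuous; apply/derivable1_diffP.
- move=> x; rewrite in_itv/= andbT => rx.
  by have d := dF x (lt_trans r0 rx); rewrite derive1E derive_val.
Qed.

(** The radial integral left at the end of the polar coordinates formula. The 2 counts the tails at
    both infinities, one for each sign of the scale. *)
Lemma integral_powV n (r : R) : 0 < r ->
  (\int[lambda]_s (if (r <= `|s|)%R then `|s|^-1 ^+ n.+2 else 0)%:E =
   (2 / n.+1%:R * r^-1 ^+ n.+1)%:E)%E.
Proof.
move=> r0; pose h (s : R) := if r <= s then s^-1 ^+ n.+2 else 0.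
have mh : measurable_fun setT h.
  apply: measurable_fun_ifT => //; first exact: measurable_fun_ler.
  by apply: measurable_funX; exact: measurable_inv.
have h0 s : 0 <= h s.
  rewrite /h; case: ifPn => // rs.
  by rewrite exprn_ge0// invr_ge0 (le_trans (ltW r0)).
have mhN : measurable_fun setT (fun s : R => h (- s)).
  by apply: (measurableT_comp mh); exact: oppr_measurable.
transitivity (\int[lambda]_s ((h s)%:E + (h (- s)%R)%:E))%E.
  apply: eq_integral => s _; rewrite -EFinD; congr (_%:E); rewrite /h.
  have [s0|s0] := leP 0 s.
    rewrite ger0_norm// [X in _ + X]ifF ?addr0//.
    by apply/negbTE; rewrite -ltNge (le_lt_trans _ r0)// oppr_le0.
  rewrite ltr0_norm// [X in X + _]ifF ?add0r//.
  by apply/negbTE; rewrite -ltNge (lt_trans s0).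
rewrite ge0_integralD//=; last 4 first.
- by move=> s _; rewrite lee_fin.
- exact/measurable_EFinP.
- by move=> s _; rewrite lee_fin.
- exact/measurable_EFinP.
have := @ge0_integral_affine R (-1) 0 (EFin \o h).
rewrite oppr_eq0 oner_eq0 => /(_ isT).
have mEh : measurable_fun setT (EFin \o h) by exact/measurable_EFinP.
move=> /(_ mEh (fun s => h0 s)).
under eq_integral do rewrite /= addr0 mulN1r.
rewrite normrN1 invr1 mul1e => ->.
have -> : (\int[lambda]_s (EFin \o h) s = (n.+1%:R^-1 * r^-1 ^+ n.+1)%:E)%E.
  rewrite -integral_tail_powV// [RHS]integral_mkcond.
  apply: eq_integral => s _; rewrite /patch mem_setE in_itv/= andbT /h.
  by case: ifP.
by rewrite -EFinD; congr (_%:E); rewrite -mulr2n -[LHS]mulr_natl mulrA.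
Qed.

End tail_integral.

Section real_tonelli.
Context {R : realType} {d1 d2 : measure_display}.
Context {T1 : measurableType d1} {T2 : measurableType d2}.
Variables (m1 : {sigma_finite_measure set T1 -> \bar R}).
Variables (m2 : {sigma_finite_measure set T2 -> \bar R}).
Variable h : T1 * T2 -> R.
Hypotheses (mh : measurable_fun setT h) (h0 : forall z, 0 <= h z).

Let mEh : measurable_fun setT (EFin \o h).
Proof. exact/measurable_EFinP. Qed.

Let Eh0 z : (0 <= (EFin \o h) z)%E.
Proof. by rewrite lee_fin. Qed.

Lemma measurable_integral1 : measurable_fun setT (fun x => \int[m2]_y (h (x, y))%:E)%E.
Proof. exact: (measurable_fun_fubini_tonelli_F _ mEh Eh0). Qed.

Lemma measurable_integral2 : measurable_fun setT (fun y => \int[m1]_x (h (x, y))%:E)%E.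
Proof. exact: (measurable_fun_fubini_tonelli_G _ mEh Eh0). Qed.

Lemma ge0_integral_swap :
  (\int[m1]_x \int[m2]_y (h (x, y))%:E = \int[m2]_y \int[m1]_x (h (x, y))%:E)%E.
Proof. exact: (fubini_tonelli _ mEh Eh0). Qed.

End real_tonelli.

Section polar.
Context {R : realType}.
Local Notation lambda := (@lebesgue_measure R).
Local Notation lebn n := (@lebesgue_tuple R n).
Local Notation sigma n := (@surface_measure R n).

Lemma enorm_ge0 n (x : n.-tuple R) : 0 <= enorm x.
Proof. exact: sqrtr_ge0. Qed.

Lemma enorm_tscale n a (x : n.-tuple R) : enorm (tscale a x) = `|a| * enorm x.
Proof.
rewrite /enorm -sqrtr_sqr -sqrtrM ?sqr_ge0//; congr (Num.sqrt _).
by rewrite mulr_sumr; apply: eq_bigr => i _; rewrite !tnth_tscale; ring.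
Qed.

Lemma enorm_eq0 n (x : n.-tuple R) i : enorm x = 0 -> tnth x i = 0.
Proof.
move=> /eqP; rewrite sqrtr_eq0 => h.
have h2 : \sum_(i < n) tnth x i * tnth x i == 0.
  by rewrite eq_le h sumr_ge0// => j _; exact: sqr_ge0.
move: h2; rewrite psumr_eq0; last by move=> j _; exact: sqr_ge0.
by move=> /allP/(_ i (mem_index_enum _))/=; rewrite mulf_eq0 orbb => /eqP.
Qed.

Lemma tscaleA n a b (x : n.-tuple R) : tscale a (tscale b x) = tscale (a * b) x.
Proof. by apply: eq_from_tnth => i; rewrite !tnth_tscale mulrA. Qed.

Lemma normalizeE n (x : n.-tuple R) : normalize x = tscale (enorm x)^-1 x.
Proof. by []. Qed.

Lemma enorm_normalize n (x : n.-tuple R) : enorm x != 0 -> enorm (normalize x) = 1.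
Proof.
move=> x0; rewrite normalizeE enorm_tscale ger0_norm ?invr_ge0 ?enorm_ge0//.
by rewrite mulVf.
Qed.

Lemma measurable_unit_sphere n : measurable (@unit_sphere R n).
Proof.
rewrite /unit_sphere (_ : [set _ | _] = enorm @^-1` [set 1])//.
by rewrite -[X in measurable X]setTI; apply: measurable_enorm.
Qed.

(** The origin lies in the hyperplane where the first coordinate is 0. In dimension 0 the measure is
    a unit mass at the only point, whose norm is 0, hence the condition on n. *)
Lemma lebesgue_tuple_enorm0 n : (0 < n)%N -> lebn n [set x | enorm x = 0] = 0%E.
Proof.
case: n => // n _.
have m0 : measurable [set x : n.+1.-tuple R | enorm x = 0].
  rewrite (_ : [set _ | _] = enorm @^-1` [set 0])//.
  by rewrite -[X in measurable X]setTI; apply: measurable_enorm.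
have mX : measurable ([set 0] `*` [set: n.-tuple R] : set (measurableTypeR R * _)).
  by apply: measurableX.
have mB : measurable ((fun x : n.+1.-tuple R => tnth x ord0) @^-1` [set 0]).
  by rewrite -[X in measurable X]setTI; apply: (@measurable_tnth _ R n.+1 ord0).
apply: (@subset_measure0 _ _ _ (lebn n.+1) _ _ m0 mB).
  by move=> x /= /enorm_eq0; exact.
transitivity ((lambda \x lebn n)%E ([set 0] `*` [set: n.-tuple R])).
  rewrite /= /pushforward; congr (_ _); apply/seteqP.
  by split => -[t v]/=; rewrite tnth0//= => -[].
by rewrite product_measure1E// [X in (X * _)%E]lebesgue_measure_set1 mul0e.
Qed.

Lemma measurable_cube n :
  measurable [set x : n.-tuple R | forall i, (`|tnth x i| <= 1)%R].
Proof.
rewrite (_ : [set _ | _] =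
  \bigcap_(i in [set: 'I_n]) ((fun x : n.-tuple R => tnth x i) @^-1` `[-1, 1])).
  apply: fin_bigcap_measurable => [|i _]; first exact: finite_finset.
  by rewrite -[X in measurable X]setTI; apply: (@measurable_tnth _ R n i).
apply/seteqP; split => x /= h i.
  by move=> _ /=; rewrite in_itv/= -ler_norml.
by have := h i I; rewrite /= in_itv/= ler_norml.
Qed.

Lemma lebesgue_tuple_cube n :
  (lebn n [set x | forall i, (`|tnth x i| <= 1)%R] < +oo)%E.
Proof.
elim: n => [|n IH].
  by rewrite /= diracE; case: (_ \in _); rewrite ltry.
have mI : measurable (`[-1, 1]%classic : set (measurableTypeR R)) by [].
have mC := @measurable_cube n.
rewrite (_ : lebn n.+1 _ = ((lambda \x lebn n)%E (`[-1, 1]%classic `*`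
    [set x : n.-tuple R | forall i, (`|tnth x i| <= 1)%R]))); last first.
  rewrite /= /pushforward; congr (_ _); apply/seteqP; split => -[t v]/=.
    move=> h; split; first by have := h ord0; rewrite tnth0 in_itv/= ler_norml.
    by move=> i; have := h (lift ord0 i); rewrite tnthS.
  rewrite in_itv/= -ler_norml => -[t1 v1] i.
  by case: (unliftP ord0 i) => [j|] ->; rewrite ?tnthS ?tnth0.
rewrite product_measure1E// lte_mul_pinfty//.
- have : (lambda `[(-1)%R, 1%R]%classic < +oo)%E.
    by rewrite lebesgue_measure_itv/=; case: ifP; rewrite ltry.
  by rewrite ge0_fin_numE.
Qed.

Definition punctured_ball n : set (n.-tuple R) := [set x | 0 < enorm x <= 1].

Lemma measurable_punctured_ball n : measurable (@punctured_ball n).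
Proof.
rewrite /punctured_ball (_ : [set _ | _] = enorm @^-1` `]0, 1]); last first.
  by apply/seteqP; split => x /=; rewrite in_itv.
by rewrite -[X in measurable X]setTI; exact: measurable_enorm.
Qed.

Lemma surface_measure_fin n : (sigma n setT < +oo)%E.
Proof.
rewrite /surface_measure preimage_setT setIT lte_mul_pinfty//.
apply: (le_lt_trans _ (lebesgue_tuple_cube n)); apply: le_measure.
- rewrite inE; exact: measurable_punctured_ball.
- by rewrite inE; exact: measurable_cube.
- move=> x /= /andP[_ x1] i; rewrite -sqrtr_sqr; apply: le_trans x1.
  rewrite ler_wsqrtr// /dotp (bigD1 i)//= expr2 lerDl sumr_ge0// => j _.
  exact: sqr_ge0.
Qed.

Lemma surface_measureC n : sigma n (~` unit_sphere n) = 0%E.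
Proof.
rewrite /surface_measure (_ : _ `&` _ = set0) ?measure0 ?mule0//.
apply/seteqP; split => // x [/= /andP[x0 _]]; apply.
by apply: enorm_normalize; rewrite gt_eqF.
Qed.

Lemma ge0_integral_surface n (G : n.-tuple R -> \bar R) :
  measurable_fun setT G -> (forall u, (0 <= G u)%E) ->
  (\int[sigma n]_(u in unit_sphere n) G u =
   n%:R%:E * \int[lebn n]_(y in @punctured_ball n) G (normalize y))%E.
Proof.
move=> mG G0.
pose o : n.-tuple R := [tuple 0 | i < n].
(* Points outside the punctured ball are sent to the origin, which is off the sphere. On subsets of
   the sphere, the cone construction is then n times the image of Lebesgue measure under one total
   map. *)
pose phi (y : n.-tuple R) := if 0 < enorm y <= 1 then normalize y else o.
have mphi : measurable_fun setT phi.
  apply: measurable_fun_ifT => //; last exact: measurable_normalize.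
  by apply: measurable_and; [apply: measurable_fun_ltr|apply: measurable_fun_ler];
    rewrite //; exact: measurable_enorm.
have mS := @measurable_unit_sphere n.
have o0 : enorm o = 0.
  by rewrite /enorm /dotp big1 ?sqrtr0// => i _; rewrite tnth_mktuple mul0r.
have phiS (A : set (n.-tuple R)) : A `<=` unit_sphere n ->
    phi @^-1` A = @punctured_ball n `&` normalize @^-1` A.
  move=> AS; apply/seteqP; split => y /=.
    rewrite /phi; case: ifPn => [//|_ /AS/=].
    by rewrite /unit_sphere/= o0 => /eqP; rewrite eq_sym oner_eq0.
  by move=> [y1]; rewrite /phi; case: ifPn => //; rewrite y1.
pose kn : {nonneg R} := NngNum (ler0n R n).
have E : (\int[sigma n]_(u in unit_sphere n) G u =
    \int[mscale kn (pushforward (lebn n) phi)]_(u in unit_sphere n) G u)%E.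
  move=> m; apply: eq_measure_integral => // A mA AS.
  transitivity (n%:R%:E * lebn n (phi @^-1` A))%E; last by [].
  by rewrite phiS.
rewrite (E mphi) ge0_integral_mscale//=; last exact: measurable_funS mG.
congr (_ * _)%E; rewrite ge0_integral_pushforward//; last exact: measurable_funS mG.
have -> : phi @^-1` unit_sphere n = @punctured_ball n.
  rewrite phiS//; apply/seteqP; split => [y []//|y yb]; split => //.
  by apply: enorm_normalize; move: yb => /andP[y0 _]; rewrite gt_eqF.
by apply: eq_integral => y /set_mem yb; rewrite /= /phi ifT.
Qed.

(** The cone construction makes the left side n times an integral over y in the ball and a in R.
    Substituting a = |y| s gives the integrand |y|^n |s|^m g(s y). For fixed s, substituting z = s y
    gives |z|^n g(z) |s|^-(n+1) on |z| <= |s|. Integrating in s first, the two tails give (2 / n)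
    |z|^-n, and everything cancels except 2 g(z). *)
Lemma ge0_polar n m (g : n.-tuple R -> R) : n = m.+1 -> measurable_fun setT g ->
  (forall x, 0 <= g x) ->
  (\int[sigma n]_(u in unit_sphere n)
     \int[lambda]_a (`|a| ^+ m * g (tscale a u))%R%:E =
   2%:E * \int[lebn n]_x (g x)%:E)%E.
Proof.
move=> nm mg g0.
(* Since the type of g depends on n, the equation n = m + 1 is used only inside exponents and
   scalars. *)
have xn (x : R) : x ^+ n = x ^+ m.+1 by rewrite nm.
have xnS (x : R) : x ^+ n.+1 = x ^+ m.+2 by rewrite nm.
have nR : n%:R = m.+1%:R :> R by rewrite nm.
have msc : measurable_fun setT (fun z : n.-tuple R * measurableTypeR R => tscale z.2 z.1).
  have msw : measurable_fun setT (fun z : n.-tuple R * measurableTypeR R => (z.2, z.1)).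
    by apply/measurable_fun_pairP; split; [exact: measurable_snd|exact: measurable_fst].
  exact: (measurableT_comp (@measurable_tscale2 R n) msw).
have mga : measurable_fun setT
   (fun z : n.-tuple R * measurableTypeR R => `|z.2| ^+ m * g (tscale z.2 z.1)).
  apply: measurable_funM; last exact: (measurableT_comp mg msc).
  apply: measurable_funX; apply: measurableT_comp => //; exact: measurable_snd.
rewrite ge0_integral_surface; last 2 first.
- by apply: (measurable_integral1 lambda mga) => z; rewrite mulr_ge0// exprn_ge0.
- by move=> u; apply: integral_ge0 => a _; rewrite lee_fin mulr_ge0// exprn_ge0.
pose B (y : n.-tuple R) : bool := (0 < enorm y <= 1)%R.
pose H (z : n.-tuple R * measurableTypeR R) : R :=
  if B z.1 then enorm z.1 ^+ n * (`|z.2| ^+ m * g (tscale z.2 z.1)) else 0.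
have mBall : measurable_fun setT (fun y : n.-tuple R => B y).
  by apply: measurable_and; [apply: measurable_fun_ltr|apply: measurable_fun_ler];
    rewrite //; exact: measurable_enorm.
have men1 : measurable_fun setT (fun z : n.-tuple R * measurableTypeR R => enorm z.1).
  exact: (measurableT_comp measurable_enorm measurable_fst).
have mH : measurable_fun setT H.
  apply: measurable_fun_ifT => //.
    exact: (measurableT_comp mBall measurable_fst).
  by apply: measurable_funM => //; exact: measurable_funX.
have H0 z : 0 <= H z.
  by rewrite /H; case: ifP => // _; rewrite !mulr_ge0// ?exprn_ge0// enorm_ge0.
transitivity (n%:R%:E * \int[lebn n]_y \int[lambda]_s (H (y, s))%:E)%E.
  congr (_ * _)%E; rewrite integral_mkcond; apply: eq_integral => y _.
  rewrite /patch; have [By|nBy] := boolP (B y); last first.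
    rewrite memNset; last exact/negP.
    by rewrite integral0_eq// => s _; rewrite /H/= (negbTE nBy).
  have y0 : 0 < enorm y by case/andP: By.
  rewrite mem_set//.
  pose h (a : R) := (`|a| ^+ m * g (tscale a (normalize y)))%:E.
  have mh : measurable_fun setT h.
    apply/measurable_EFinP; apply: measurable_funM.
      by apply: measurable_funX; exact: normr_measurable.
    apply: (measurableT_comp mg).
    exact: (measurableT_comp msc (measurable_pair1 (normalize y))).
  have h0 a : (0 <= h a)%E by rewrite lee_fin mulr_ge0// exprn_ge0.
  have E := ge0_integral_affine 0 (lt0r_neq0 y0) mh h0.
  (* The substitution a = |y| s, whose Jacobian |y| joins |y|^m to make |y|^n. *)
  transitivity ((enorm y)%:E * \int[lambda]_x h (enorm y * x + 0)%R)%E.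
    rewrite E muleA -EFinM gtr0_norm// mulfV ?mul1e//; exact: lt0r_neq0.
  rewrite -ge0_integralZl//.
  - apply: eq_integral => s _; rewrite -EFinM; congr (_%:E); rewrite /H/= By addr0.
    have -> : tscale (enorm y * s) (normalize y) = tscale s y.
      by rewrite normalizeE tscaleA mulrAC mulfV ?mul1r// gt_eqF.
    by rewrite normrM (gtr0_norm y0) exprMn xn exprS; ring.
  - have me : measurable_fun setT (fun x : R => enorm y * x + 0).
      exact: measurable_affine.
    exact: (measurableT_comp mh me).
  - by rewrite lee_fin ltW.
rewrite (ge0_integral_swap (lebn n) lambda mH H0).
(* The integrand after the substitution z = s y; the ball |y| <= 1 has become the condition |z| <=
   |s|. *)
pose L (z : n.-tuple R * measurableTypeR R) : R :=
  if (0 < enorm z.1) && (enorm z.1 <= `|z.2|) then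
    (enorm z.1 ^+ n * g z.1) * `|z.2|^-1 ^+ n.+1 else 0.
have mL : measurable_fun setT L.
  have m2 : measurable_fun setT (fun z : n.-tuple R * measurableTypeR R => `|z.2|).
    by apply: measurableT_comp => //; exact: measurable_snd.
  apply: measurable_fun_ifT => //.
    by apply: measurable_and; [exact: measurable_fun_ltr|exact: measurable_fun_ler].
  apply: measurable_funM.
    apply: measurable_funM; first exact: measurable_funX.
    exact: (measurableT_comp mg measurable_fst).
  apply: measurable_funX; exact: (measurableT_comp measurable_inv m2).
have L0 z : 0 <= L z.
  rewrite /L; case: ifP => // _.
  by apply: mulr_ge0; [apply: mulr_ge0 => //; rewrite exprn_ge0 ?enorm_ge0|
    rewrite exprn_ge0 ?invr_ge0].
transitivity (n%:R%:E * \int[lambda]_s \int[lebn n]_y (L (y, s))%:E)%E.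
  congr (_ * _)%E; apply: (@ge0_ae_eq_integral _ _ _ lambda setT
    (fun s => \int[lebn n]_x (H (x, s))%:E)%E
    (fun s => \int[lebn n]_x (L (x, s))%:E)%E).
  - exact: measurableT.
  - exact: (measurable_integral2 (lebn n) mH H0).
  - exact: (measurable_integral2 (lebn n) mL L0).
  - by move=> s _; apply: integral_ge0 => y _; rewrite lee_fin; exact: H0.
  - by move=> s _; apply: integral_ge0 => y _; rewrite lee_fin; exact: L0.
  exists [set 0]; split => //; first exact: lebesgue_measure_set1.
  move=> s /=; apply: contra_notP => /eqP s0 _.
  (* The factor |s|^n compensates the Jacobian of y |-> s y. The identity [HK] below is (|z| /
     |s|)^n |s|^m = |s|^n |z|^n |s|^-(n+1), that is m = n - 1. *)
  pose K (z : n.-tuple R) : R := `|s| ^+ n * L (z, s).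
  have mK : measurable_fun setT K.
    apply: measurable_funM => //.
    exact: (measurableT_comp mL (measurable_pair2 s)).
  have HK y : H (y, s) = K (tscale s y).
    rewrite /K /H /L /B.
    have as0 : 0 < `|s| by rewrite normr_gt0.
    rewrite enorm_tscale pmulr_rgt0// ger_pMr//.
    case: ifP => _; last by rewrite mulr0.
    rewrite exprMn exprVn xnS !xn !exprS.
    have sm : `|s| ^+ m != 0 by rewrite expf_neq0// gt_eqF.
    by field; rewrite sm gt_eqF.
  have K0 z : (0 <= (K z)%:E)%E by rewrite lee_fin mulr_ge0// exprn_ge0.
  have mEK : measurable_fun setT (EFin \o K) by exact/measurable_EFinP.
  have E := ge0_integral_tscale s0 mEK K0.
  transitivity (\int[lebn n]_x (EFin \o K) (tscale s x))%E.
    by apply: eq_integral => y _; rewrite HK.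
  rewrite E -ge0_integralZl//; last by move=> x _; exact: K0.
  apply: eq_integral => z _; rewrite /= -EFinM /K mulrA mulVf ?mul1r//.
  by rewrite expf_neq0// normr_eq0.
rewrite -(ge0_integral_swap (lebn n) lambda mL L0).
rewrite -ge0_integralZl//; last 2 first.
- exact: (measurable_integral1 lambda mL L0).
- by move=> y _; apply: integral_ge0 => s _; rewrite lee_fin; exact: L0.
rewrite -ge0_integralZl//; last 2 first.
- exact/measurable_EFinP.
- by move=> y _; rewrite lee_fin.
apply: ge0_ae_eq_integral.
- exact: measurableT.
- apply: measurable_funeM.
  exact: (measurable_integral1 lambda mL L0).
- by apply/measurable_EFinP; exact: measurable_funM.
- move=> y _; rewrite mule_ge0// ?lee_fin//; apply: integral_ge0 => s _.
  by rewrite lee_fin; exact: L0.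
- by move=> y _; rewrite mule_ge0// lee_fin.
exists [set x | enorm x = 0]; split; last 2 first.
- by apply: lebesgue_tuple_enorm0; rewrite nm.
- move=> y /=; apply: contra_notP => /eqP yN0 _.
  have y0 : 0 < enorm y by rewrite lt0r yN0 enorm_ge0.
  rewrite (eq_integral (fun s : measurableTypeR R => ((enorm y ^+ n * g y)%:E *
    (if (enorm y <= `|s|)%R then `|s|^-1 ^+ m.+2 else 0)%:E)%E)); last first.
    move=> s _; rewrite /L/= xnS y0/= -EFinM; congr (_%:E).
    by case: ifP => _; rewrite ?mulr0.
  rewrite ge0_integralZl//; last 3 first.
  + apply/measurable_EFinP; apply: measurable_fun_ifT => //.
      by apply: measurable_fun_ler => //; exact: measurableT_comp.
    apply: measurable_funX; apply: (measurableT_comp measurable_inv).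
    exact: normr_measurable.
  + by move=> s _; rewrite lee_fin; case: ifP => // _; rewrite exprn_ge0.
  + by rewrite lee_fin mulr_ge0// exprn_ge0// enorm_ge0.
  rewrite integral_powV// -!EFinM; congr (_%:E); rewrite exprVn xn nR.
  have nn : (m.+1%:R : R) != 0 by rewrite pnatr_eq0.
  have en : enorm y ^+ m.+1 != 0 by rewrite expf_neq0.
  have aux (k w c : R) : k != 0 -> w != 0 -> k * (w * c * (2 / k / w)) = 2 * c.
    by move=> k0 w0; field; rewrite ?k0 ?w0.
  exact: aux.
- rewrite (_ : [set _ | _] = enorm @^-1` [set 0])//.
  by rewrite -[X in measurable X]setTI; apply: measurable_enorm.
Qed.

End polar.

(** * Fourier inversion on the real line *)

Section real_line.
Context {R : realType}.
Local Notation lambda := (@lebesgue_measure R).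
Implicit Types f g : R -> R.

Lemma cvgn_addE (u v : nat -> R) (a b c : R) : a + b = c ->
  u n @[n --> \oo] --> a -> v n @[n --> \oo] --> b -> u n + v n @[n --> \oo] --> c.
Proof. by move=> <-; exact: cvgD. Qed.

Lemma cvgn_mulE (u v : nat -> R) (a b c : R) : a * b = c ->
  u n @[n --> \oo] --> a -> v n @[n --> \oo] --> b -> u n * v n @[n --> \oo] --> c.
Proof. by move=> <-; exact: cvgM. Qed.

Lemma cvg_Rintegral_sets (D_ : nat -> set R) (D : set R) f :
  (forall n, measurable (D_ n)) -> measurable D ->
  lambda.-integrable setT (EFin \o f) ->
  (forall x, \forall n \near \oo, (x \in D_ n) = (x \in D)) ->
  \int[lambda]_(x in D_ n) f x @[n --> \oo] --> \int[lambda]_(x in D) f x.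
Proof.
move=> mD_ mD fi DD.
have mf : measurable_fun setT f by have /measurable_int/measurable_EFinP := fi.
have mp (E : set R) : measurable E -> measurable_fun setT (EFin \o (f \_ E)).
  move=> mE; apply/measurable_EFinP; apply/(measurable_restrictT _ _).1 => //.
  exact: measurable_funS mf.
have nf : lambda.-integrable setT (EFin \o (fun x => `|f x|)) by exact: integrable_norm.
have [|||||iD _ cvg] := @dominated_convergence _ _ _ lambda _ measurableT
    (fun n => EFin \o (f \_ (D_ n))) (EFin \o (f \_ D))
    (EFin \o (fun x => `|f x|)) => //.
- by move=> n; exact: mp.
- exact: mp.
- apply: nearW => x _; apply: cvg_near_cst; apply: filterS (DD x) => n nD.
  by rewrite /= /patch nD.
- apply: nearW => x n _ /=; rewrite lee_fin /patch.
  by case: ifP => // _; rewrite normr0.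
under eq_fun do rewrite Rintegral_mkcond.
rewrite Rintegral_mkcond /Rintegral; apply: fine_cvg; rewrite fineK//.
exact: (integrable_fin_num _ iD).
Qed.

Lemma is_derive_continuous (f f' : R -> R) :
  (forall x : R, is_derive x 1 f (f' x)) -> continuous f.
Proof.
move=> df x; have [dx _] := df x.
by apply: differentiable_continuous; apply/derivable1_diffP.
Qed.

Lemma Rintegral_is_derive (f F : R -> R) (a b : R) : a <= b -> continuous f ->
  (forall x : R, is_derive x 1 F (f x)) ->
  \int[lambda]_(x in `[a, b]) f x = F b - F a.
Proof.
rewrite le_eqVlt => /predU1P[-> _ _|ab cf dF].
  by rewrite set_itv1 Rintegral_set1 subrr.
have cF := is_derive_continuous dF.
rewrite /Rintegral (@continuous_FTC2 _ f F)//.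
- exact: continuous_subspaceT.
- split => [x _| |]; first by have [] := dF x.
  + by apply: cvg_at_right_filter; exact: cF.
  + by apply: cvg_at_left_filter; exact: cF.
- by move=> x _; have d := dF x; rewrite derive1E derive_val.
Qed.

Lemma cvg_Rintegral_itv f : lambda.-integrable setT (EFin \o f) ->
  \int[lambda]_(x in `[- n%:R, n%:R]) f x @[n --> \oo] --> \int[lambda]_x f x.
Proof.
move=> fi; apply: cvg_Rintegral_sets => // x.
near=> n; rewrite in_setT mem_setE in_itv/= -ler_norml.
by near: n; exact: nbhs_infty_ger.
Unshelve. all: by end_near. Qed.

Lemma integrable_expN : lambda.-integrable setT (EFin \o (fun w : R => expR (- `|w|))).
Proof.
have ce : continuous (fun w : R => expR (- `|w|)).
  move=> w; apply: (@continuous_comp _ _ _ (fun w : R => - `|w|) expR).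
    by apply: continuousN; exact: norm_continuous.
  exact: continuous_expR.
apply/integrableP; split.
  by apply/measurable_EFinP; exact: continuous_measurable_fun.
under eq_integral do rewrite /= gtr0_norm ?expR_gt0//.
rewrite ge0_symfun_integralT//; last by move=> x /=; rewrite normrN.
have -> : (\int[lambda]_(x in [set x : R | (0 <= x)%R]) (expR (- `|x|))%:E =
    \int[lambda]_(x in `[0%R, +oo[) (expR (- x))%:E)%E.
  rewrite set_itvcy; apply: eq_integral => x; rewrite inE/= => x0.
  by rewrite ger0_norm.
rewrite (@ge0_continuous_FTC2y R _ (fun x => - expR (- x)) 0 0).
- by rewrite oppr0 expR0 -EFinB -EFinM ltry.
- by move=> x _; exact: expR_ge0.
- apply: continuous_subspaceT => x.
  apply: (@continuous_comp _ _ _ (fun w : R => - w) expR).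
    by apply: continuousN.
  exact: continuous_expR.
- by rewrite -oppr0; apply: cvgN; exact: cvgr_expR.
- by move=> x _.
- apply: cvg_at_right_filter; apply: cvgN.
  apply: (@continuous_comp _ _ _ (fun w : R => - w) expR).
    by apply: continuousN.
  exact: continuous_expR.
- move=> x _; rewrite derive1E derive_val.
  by rewrite /GRing.scale/= mulrN1 opprK.
Qed.

Let coneDsqrV : continuous (fun t : R => 2 / (1 + t ^+ 2)).
Proof.
move=> t; apply: cvgM; first exact: cvg_cst.
exact: (@continuous_oneDsqrV R t).
Qed.

Lemma cauchy_kernel_ge0 (t : R) : 0 <= 2 / (1 + t ^+ 2).
Proof. by rewrite divr_ge0// addr_ge0// sqr_ge0. Qed.

Let int_cauchy : (\int[lambda]_t (2 / (1 + t ^+ 2))%:E = (2 * pi)%:E)%E.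
Proof.
rewrite ge0_symfun_integralT//; last 2 first.
- exact: cauchy_kernel_ge0.
- by move=> x /=; rewrite sqrrN.
rewrite -set_itvcy; under eq_integral do rewrite EFinM.
rewrite ge0_integralZl//.
- have := @integral0y_oneDsqr R; rewrite /oneDsqr => ->.
  by rewrite -!EFinM; congr (_%:E); field.
- apply/measurable_EFinP; apply: measurable_funTS.
  by apply: continuous_measurable_fun; exact: continuous_oneDsqrV.
- by move=> x _; rewrite lee_fin invr_ge0 addr_ge0// sqr_ge0.
Qed.

Lemma integrable_cauchy :
  lambda.-integrable setT (EFin \o (fun t : R => 2 / (1 + t ^+ 2))).
Proof.
apply/integrableP; split.
  by apply/measurable_EFinP; exact: continuous_measurable_fun.
under eq_integral do rewrite /= ger0_norm ?cauchy_kernel_ge0//.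
by rewrite int_cauchy ltry.
Qed.

Lemma Rintegral_cauchy : \int[lambda]_t (2 / (1 + t ^+ 2)) = 2 * pi :> R.
Proof. by rewrite /Rintegral int_cauchy. Qed.

Lemma integral_expN_cos (t : R) :
  \int[lambda]_(w in `[0, +oo[) (expR (- `|w|) * cos (w * t)) = (1 + t ^+ 2)^-1.
Proof.
pose f (w : R) := expR (- `|w|) * cos (w * t).
have mf : measurable_fun setT f.
  apply: measurable_funM.
    by have /measurable_int/measurable_EFinP := integrable_expN.
  apply: (@measurableT_comp _ _ _ _ _ _ (@cos R) _ (fun w : R => w * t)).
    by apply: continuous_measurable_fun; exact: continuous_cos.
  exact: measurable_funM.
have fi : lambda.-integrable setT (EFin \o f).
  apply: (le_integrable _ _ _ integrable_expN) => //; first exact/measurable_EFinP.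
  move=> w _ /=; rewrite lee_fin normrM ler_piMr// ler_norml.
  by rewrite cos_geN1 cos_le1.
have t1 : 1 + t ^+ 2 != 0 :> R by rewrite gt_eqF// ltr_pwDl// sqr_ge0.
have lim1 := @cvg_Rintegral_sets (fun n => `[0, n%:R]%classic) `[0, +oo[%classic f.
have {}lim1 : \int[lambda]_(w in `[0, n%:R]) f w @[n --> \oo] -->
    \int[lambda]_(w in `[0, +oo[) f w.
  apply: lim1 => // x; near=> n; rewrite !mem_setE !in_itv/= andbT.
  case: (leP 0 x) => //= x0.
  by near: n; exact: nbhs_infty_ger.
(* The primitive obtained by integrating by parts twice; its value at 0 is -1 / (1 + t^2). *)
pose F (w : R) := expR (- w) * (t * sin (w * t) - cos (w * t)) / (1 + t ^+ 2).
have dF (w : R) : is_derive w 1 F (expR (- w) * cos (w * t)).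
  rewrite /F; apply: is_derive_eq; rewrite /GRing.scale/=.
  by field.
have E (n : nat) : \int[lambda]_(w in `[0, n%:R]) f w = F n%:R + (1 + t ^+ 2)^-1.
  transitivity (\int[lambda]_(w in `[0, n%:R]) (expR (- w) * cos (w * t))); last first.
    rewrite (@Rintegral_is_derive _ F)//.
      by rewrite {2}/F oppr0 expR0 mul0r sin0 cos0 mulr0 sub0r mulrN mulr1 mulNr mul1r opprK.
    move=> w; apply: cvgM.
      apply: (@continuous_comp _ _ _ (fun w : R => - w) expR).
        by apply: continuousN.
      exact: continuous_expR.
    apply: (@continuous_comp _ _ _ (fun w : R => w * t) cos).
      by apply: cvgM => //; exact: cvg_cst.
    exact: continuous_cos.
  apply: eq_Rintegral => w; rewrite inE/= in_itv/= => /andP[w0 _].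
  by rewrite /f ger0_norm.
have F0 : F n%:R @[n --> \oo] --> (0 : R).
  apply/cvgr0Pnorm_le => e e0.
  have c0 : 0 < `|t| + 1 :> R by rewrite ltr_pwDr.
  near=> n; rewrite /F !normrM (gtr0_norm (expR_gt0 _)).
  rewrite (@le_trans _ _ (expR (- n%:R) * (`|t| + 1)))//.
    rewrite -mulrA ler_wpM2l ?expR_ge0// -[leRHS]mulr1; apply: ler_pM => //.
    - rewrite (le_trans (ler_normB _ _))// lerD//.
        by rewrite normrM ler_piMr// ler_norml sin_geN1 sin_le1.
      by rewrite ler_norml cos_geN1 cos_le1.
    - rewrite normfV invf_le1 ?normr_gt0//.
      by rewrite ger0_norm ?lerDl ?addr_ge0 ?sqr_ge0.
  rewrite -ler_pdivlMr//; near: n.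
  have ec : 0 < e / (`|t| + 1) by rewrite divr_gt0.
  have /cvgr0Pnorm_le/(_ _ ec) := @cvgn_expR R.
  by apply: filterS => n; rewrite gtr0_norm ?expR_gt0.
have lim2 : \int[lambda]_(w in `[0, n%:R]) f w @[n --> \oo] --> (1 + t ^+ 2)^-1.
  under eq_fun do rewrite E.
  by apply: cvgn_addE (add0r _) F0 _; exact: cvg_cst.
exact: (cvg_unique _ lim1 lim2).
Unshelve. all: by end_near. Qed.

End real_line.

Section fourier_inversion_line.
Context {R : realType}.
Local Notation lambda := (@lebesgue_measure R).

Lemma normc_cvg_unique (u : nat -> R[i]) (a b : R[i]) :
  normc (u n - a) @[n --> \oo] --> (0 : R) ->
  normc (u n - b) @[n --> \oo] --> (0 : R) -> a = b.
Proof.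
move=> ua ub; apply/eqP; rewrite -subr_eq0; apply/eqP; apply: Normc.eq0_normc.
apply/eqP; rewrite eq_le normc_ge0 andbT.
have uab : normc (u n - a) + normc (u n - b) @[n --> \oo] --> (0 : R).
  exact: cvgn_addE (addr0 _) ua ub.
apply: (cvgr_to_ge uab); apply: nearW => n; rewrite -[X in normc X](_ : (u n - b) - (u n - a) = _); last by ring.
by rewrite addrC (le_trans (normcD _ _))// normcN.
Qed.

Lemma measurable_expNM (e : R) : measurable_fun setT (fun w : R => expR (- (e * `|w|))).
Proof.
apply: (@measurableT_comp _ _ _ _ _ _ (@expR R)); first exact: measurable_expR.
by apply: measurableT_comp => //; exact: measurable_funM.
Qed.

Lemma cintegrable_expN (t : R) :
  cintegrable lambda setT (fun w => (expR (- `|w|))%:C%C * expi (w * t)).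
Proof.
apply: (cintegrable_dom _ integrable_expN).
  apply: cmeasurableM.
    by apply: cmeasurable_real; have /measurable_int/measurable_EFinP := @integrable_expN R.
  by apply: cmeasurable_expi; exact: measurable_funM.
by move=> w; rewrite Normc.normcM normc_expi normc_real mulr1 gtr0_norm ?expR_gt0.
Qed.

Lemma cint_expN (t : R) :
  cint lambda setT (fun w => (expR (- `|w|))%:C%C * expi (w * t)) =
  (2 / (1 + t ^+ 2))%:C%C.
Proof.
set g := (X in cint _ _ X).
pose D : set R := `[0, +oo[%classic.
pose h (w : R) : R[i] := (\1_D w)%:C%C * g w.
have ig : cintegrable lambda setT g := cintegrable_expN t.
have mg := cintegrable_cmeasurable ig.
have mD : measurable D by exact: measurable_itv.
have m1 : cmeasurable (fun w : R => (\1_D w : R)%:C%C) by exact: cmeasurable_real.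
have ih : cintegrable lambda setT h.
  under [X in cintegrable _ _ X]funext do rewrite /h mulrC.
  apply: (cintegrableM_bounded (M := 1) ig m1) => w.
  by rewrite normc_real indicE; case: (_ \in _); rewrite ?normr1 ?normr0.
have ihN : cintegrable lambda setT (fun w => h (-1 * w + 0)).
  by apply: cintegrable_affine => //; rewrite oppr_eq0 oner_eq0.
(* The integrand at -w is the conjugate of the one at w, so the integral is twice the real part of
   its half-line version. The two sides differ only at w = 0, where the endpoint is counted
   twice. *)
have -> : cint lambda setT g = cint lambda setT (fun w => h w + (h (-1 * w + 0))^*).
  apply: ae_eq_cint => //.
    apply: cmeasurableD; first exact: cintegrable_cmeasurable ih.
    exact: cmeasurable_conj (cintegrable_cmeasurable ihN).
  exists [set 0]; split => //; first exact: lebesgue_measure_set1.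
  move=> w /=; apply: contra_notP => /eqP w0.
  rewrite addr0 mulN1r /h !indicE !mem_setE !in_itv/= !andbT oppr_ge0.
  have [w1|w1|w1] := ltgtP w 0.
  - rewrite mul0r add0r mul1r /g normrN rmorphM/= -[in LHS](opprK w) normrN.
    by rewrite opprK normrN mulNr expiN conjCK; congr (_ * _); apply/esym/conjc_real.
  - by rewrite mul1r mul0r rmorph0 addr0.
  - by rewrite w1 eqxx in w0.
rewrite cintD//; last exact: cintegrable_conj.
rewrite cint_conj// cint_affine// ?oppr_eq0 ?oner_eq0//.
rewrite normrN1 invr1 mul1r.
have : complex.Re (cint lambda setT h) = (1 + t ^+ 2)^-1.
  rewrite -integral_expN_cos Rintegral_mkcond/=; apply: eq_Rintegral => w _.
  rewrite /h /patch indicE -/D; case: (w \in D) => /=; rewrite /g/=.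
    by rewrite !mul0r !subr0 mul1r.
  by rewrite !mul0r subrr.
by case: (cint _ _ _) => a b /= ->; apply/eqP; rewrite eq_complex/= subrr -mulr2n mulr_natl !eqxx.
Qed.

Lemma cintegrable_expNM (e t : R) : 0 < e ->
  cintegrable lambda setT (fun w => (expR (- (e * `|w|)))%:C%C * expi (w * t)).
Proof.
move=> e0; have eN0 : e != 0 by rewrite gt_eqF.
have := cintegrable_affine 0 eN0 (cintegrable_expN (t / e)).
congr (cintegrable _ _ _); apply/funext => w.
rewrite addr0 normrM gtr0_norm//; congr (_ * expi _).
by field.
Qed.

Lemma cint_expNM (e t : R) : 0 < e ->
  cint lambda setT (fun w => (expR (- (e * `|w|)))%:C%C * expi (w * t)) =
  (e^-1 * (2 / (1 + (t / e) ^+ 2)))%:C%C.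
Proof.
move=> e0; have eN0 : e != 0 by rewrite gt_eqF.
have := cint_affine 0 eN0 (cintegrable_expN (t / e)).
rewrite cint_expN -rmorphM/= gtr0_norm// => <-.
congr (cint _ _ _); apply/funext => w.
rewrite addr0 normrM gtr0_norm//; congr (_ * expi _).
by field.
Qed.

(* The regularization by [expR (- e * |w|)] turns the inverse transform into the
   convolution of [phi] with a Cauchy kernel of width [e], which concentrates
   at [s] when [e] tends to 0. *)
Lemma fourier1_inversion (phi : R -> R[i]) (M s : R) :
  cintegrable lambda setT phi -> (forall x, normc (phi x) <= M) ->
  normc (phi x - phi s) @[x --> s] --> (0 : R) ->
  cintegrable lambda setT (fourier1 phi) ->
  cint lambda setT (fun w => fourier1 phi w * expi (w * s)) = (2 * pi)%:C%C * phi s.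
Proof.
move=> iphi phiM cphi ihat.
have mphi := cintegrable_cmeasurable iphi.
have mhat := cintegrable_cmeasurable ihat.
have mexs : cmeasurable (fun w : R => expi (w * s)).
  by apply: cmeasurable_expi; exact: measurable_funM.
pose e (k : nat) : R := k.+1%:R^-1.
have e0 k : 0 < e k by rewrite invr_gt0.
have ecvg : e k @[k --> \oo] --> (0 : R) by exact: cvg_harmonic.
pose E k (w : R) : R[i] := (expR (- (e k * `|w|)))%:C%C.
have mE k : cmeasurable (E k).
  by apply: cmeasurable_real; exact: measurable_expNM.
pose A k := cint lambda setT (fun w => fourier1 phi w * expi (w * s) * E k w).
have lim1 : normc (A k - cint lambda setT (fun w => fourier1 phi w * expi (w * s)))
    @[k --> \oo] --> (0 : R).
  apply: (@cdominated_cvg _ _ _ _ _ _ _ _ _ (cintegrable_normc ihat)).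
  - by move=> k; exact: (cmeasurableM (cmeasurableM mhat mexs) (mE k)).
  - exact: (cmeasurableM mhat mexs).
  - move=> k w; rewrite !Normc.normcM normc_expi mulr1 /E normc_real.
    rewrite ler_piMr ?normc_ge0// gtr0_norm ?expR_gt0// expR_le1 oppr_le0.
    by rewrite mulr_ge0// ltW.
  - apply: nearW => w.
    have e1 : expR (- (e k * `|w|)) @[k --> \oo] --> (1 : R).
      have e3 : - (e k * `|w|) @[k --> \oo] --> (0 : R).
        rewrite -oppr0; apply: cvgN.
        by apply: cvgn_mulE (mul0r `|w|) ecvg _; exact: cvg_cst.
      rewrite -expR0; apply: (@cvg_comp _ _ _ (fun k => - (e k * `|w|)) expR _ (nbhs 0)).
        exact: e3.
      exact: continuous_expR.
    have e2 : `|expR (- (e k * `|w|)) - 1| @[k --> \oo] --> (0 : R).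
      rewrite -(normr0 R); apply: cvg_norm.
      by apply: cvgn_addE (subrr 1) e1 _; exact: cvg_cst.
    rewrite (_ : (fun k => normc _) = (fun k =>
        normc (fourier1 phi w * expi (w * s)) * `|expR (- (e k * `|w|)) - 1|)).
      by apply: cvgn_mulE (mulr0 _) _ e2; exact: cvg_cst.
    apply/funext => k.
    by rewrite -[X in _ - X]mulr1 -mulrBr -rmorphB (Normc.normcM _ _%:C%C) normc_real.
(* The substitution y = s - e z makes the Cauchy kernel independent of k, so that a multiple of it
   dominates all the integrands. *)
pose B k := cint lambda setT (fun z => phi (- e k * z + s) * (2 / (1 + z ^+ 2))%:C%C).
have AE k : A k = B k.
  pose G (p : measurableTypeR R * measurableTypeR R) : R[i] :=
    (E k p.1 * expi (p.1 * s) * phi p.2) * expi (- (p.2 * p.1)).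
  have iG : cintegrable (lambda \x lambda)%E setT G.
    apply: (cintegrableM_bounded (M := 1)).
    - exact: (cintegrable_tensor (cintegrable_expNM s (e0 k)) iphi).
    - apply: cmeasurable_expi; apply: measurableT_comp => //.
      by apply: measurable_funM; [exact: measurable_snd|exact: measurable_fst].
    - by move=> p; rewrite normc_expi.
  have iphix w : cintegrable lambda setT (fun y => phi y * expi (- (y * w))).
    apply: (cintegrableM_bounded (M := 1)) => //.
      apply: cmeasurable_expi; apply: measurableT_comp => //.
      exact: measurable_funM.
    by move=> y; rewrite normc_expi.
  transitivity (cint lambda setT (fun w => cint lambda setT (fun y => G (w, y)))).
    congr (cint _ _ _); apply/funext => w.
    rewrite /fourier1 -mulrA mulrC -cintZl//.
    by congr (cint _ _ _); apply/funext => y; rewrite /G/=; ring.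
  rewrite cint_fubini//.
  pose psi (y : R) : R[i] := phi y * (2 / (1 + ((s - y) / e k) ^+ 2))%:C%C.
  have mpsi : cmeasurable psi.
    apply: cmeasurableM => //; apply: cmeasurable_real; apply: measurable_funM => //.
    apply: (measurableT_comp measurable_inv); apply: measurable_funD => //.
    by apply: measurable_funX; apply: measurable_funM => //; exact: measurable_funB.
  have ipsi : cintegrable lambda setT psi.
    apply: (cintegrableM_bounded (M := 2) iphi).
      apply: cmeasurable_real; apply: measurable_funM => //.
      apply: (measurableT_comp measurable_inv); apply: measurable_funD => //.
      by apply: measurable_funX; apply: measurable_funM => //; exact: measurable_funB.
    move=> y; rewrite normc_real ger0_norm ?cauchy_kernel_ge0//.
    rewrite ler_piMr// invf_le1 ?lerDl ?sqr_ge0//.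
    by rewrite ltr_pwDl// sqr_ge0.
  transitivity ((e k)^-1%:C%C * cint lambda setT psi).
    rewrite -cintZl//; congr (cint _ _ _); apply/funext => y.
    rewrite /psi mulrCA -rmorphM/= -cint_expNM// -cintZl//; last exact: cintegrable_expNM.
    congr (cint _ _ _); apply/funext => w; rewrite /G/= /E.
    rewrite mulrBr expiD -[expi (- (w * y))](_ : expi (- (y * w)) = _); first by ring.
    by rewrite mulrC.
  have eN0 : - e k != 0 by rewrite oppr_eq0 gt_eqF.
  have := cint_affine s eN0 ipsi; rewrite normrN (gtr0_norm (e0 k)) => <-.
  congr (cint _ _ _); apply/funext => z; rewrite /psi; congr (_ * (2 / (1 + _ ^+ 2))%:C%C).
  by field; rewrite gt_eqF.
have icau : cintegrable lambda setT (fun z : R => (2 / (1 + z ^+ 2))%:C%C).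
  apply: (cintegrable_dom _ integrable_cauchy).
    by apply: cmeasurable_real; have /measurable_int/measurable_EFinP := @integrable_cauchy R.
  by move=> z; rewrite normc_real ger0_norm ?cauchy_kernel_ge0.
have lim2 : normc (B k - cint lambda setT (fun z => phi s * (2 / (1 + z ^+ 2))%:C%C))
    @[k --> \oo] --> (0 : R).
  apply: (@cdominated_cvg _ _ _ lambda
    (fun k z => phi (- e k * z + s) * (2 / (1 + z ^+ 2))%:C%C)
    (fun z => phi s * (2 / (1 + z ^+ 2))%:C%C) (fun z : R => M * (2 / (1 + z ^+ 2)))).
  - move=> k; apply: cmeasurableM; last exact: cintegrable_cmeasurable icau.
    by apply: (cmeasurable_comp mphi); exact: measurable_affine.
  - exact: cintegrable_cmeasurable (cintegrableZl _ icau).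
  - by have := integrableZl measurableT M integrable_cauchy.
  - move=> k z; rewrite Normc.normcM normc_real ger0_norm ?cauchy_kernel_ge0//.
    by rewrite ler_wpM2r ?cauchy_kernel_ge0.
  - apply: nearW => z.
    have ez : - e k * z + s @[k --> \oo] --> s.
      apply: cvgn_addE (add0r s) _ (cvg_cst s).
      apply: cvgn_mulE (mul0r z) _ (cvg_cst z).
      by rewrite -oppr0; exact: cvgN.
    have pz : normc (phi (- e k * z + s) - phi s) @[k --> \oo] --> (0 : R).
      exact: (@cvg_comp _ _ _ (fun k => - e k * z + s : R)
        (fun x : R => normc (phi x - phi s)) _ (nbhs (s : R)) _ ez cphi).
    rewrite (_ : (fun k => normc _) = (fun k =>
        normc (phi (- e k * z + s) - phi s) * normc (2 / (1 + z ^+ 2))%:C%C)).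
      by apply: cvgn_mulE (mul0r _) pz _; exact: cvg_cst.
    by apply/funext => k; rewrite -Normc.normcM mulrBl.
have {}lim1 : normc (B k - cint lambda setT (fun w => fourier1 phi w * expi (w * s)))
    @[k --> \oo] --> (0 : R).
  rewrite (_ : (fun k => normc _) = (fun k =>
    normc (A k - cint lambda setT (fun w => fourier1 phi w * expi (w * s)))))//.
  by apply/funext => k; rewrite AE.
rewrite (normc_cvg_unique lim1 lim2) cintZl// cint_real Rintegral_cauchy.
by rewrite mulrC.
Qed.

End fourier_inversion_line.

(** * Decay of Fourier transforms *)

Section fourier_decay.
Context {R : realType}.
Local Notation lambda := (@lebesgue_measure R).
Implicit Types g : R -> R.

Lemma normc_fourier1 (phi : R -> R[i]) (w : R) : cintegrable lambda setT phi ->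
  normc (fourier1 phi w) <= 2 * \int[lambda]_t normc (phi t).
Proof.
move=> iphi; apply: le_trans (normc_cint _) _.
  apply: (cintegrableM_bounded (M := 1)) => // [|t]; last by rewrite normc_expi.
  by apply: cmeasurable_expi; apply: measurableT_comp => //; exact: measurable_funM.
rewrite ler_wpM2l// le_eqVlt; apply/orP; left; apply/eqP.
by apply: eq_Rintegral => t _; rewrite Normc.normcM normc_expi mulr1.
Qed.

Lemma cmeasurable_fourier1 (phi : R -> R[i]) :
  cintegrable lambda setT phi -> cmeasurable (fourier1 phi).
Proof.
move=> iphi; apply: (@cmeasurable_cint1 _ _ _ _ _ lambda
  (fun z : measurableTypeR R * measurableTypeR R => phi z.2 * expi (- (z.2 * z.1)))).
apply: cmeasurableM.
  exact: (cmeasurable_comp (cintegrable_cmeasurable iphi) measurable_snd).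
apply: cmeasurable_expi; apply: measurableT_comp => //.
by apply: measurable_funM; [exact: measurable_snd|exact: measurable_fst].
Qed.

(** The two bounds add up to 2 C for the weight 1 + w^2, which is the 2 in the numerator of the
    Cauchy kernel. *)
Lemma cintegrable_decay (G : R -> R[i]) (C : R) : cmeasurable G ->
  (forall w, normc (G w) <= C) -> (forall w, w ^+ 2 * normc (G w) <= C) ->
  cintegrable lambda setT G.
Proof.
move=> mG G0 G2; apply: (@cintegrable_dom _ _ _ lambda G (fun w : R => C * (2 / (1 + w ^+ 2)))) => //.
  by have := integrableZl measurableT C (@integrable_cauchy R).
move=> w; have w1 : 0 < 1 + w ^+ 2 by rewrite ltr_pwDl// sqr_ge0.
rewrite mulrA ler_pdivlMr//.
by have := G0 w; have := G2 w; lra.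
Qed.

(** The assumed identity is the outcome of two integrations by parts, with [g2] as second
    derivative. It is stated as a hypothesis so that it also applies to truncated polynomials, whose
    second derivative may jump. The phase [th] covers cosine and sine, hence the real and imaginary
    parts, at once. *)
Lemma cintegrable_fourier1_by_parts (g g2 : R -> R) :
  lambda.-integrable setT (EFin \o g) -> lambda.-integrable setT (EFin \o g2) ->
  (forall w th, w ^+ 2 * \int[lambda]_t (g t * cos (t * w + th)) =
    - \int[lambda]_t (g2 t * cos (t * w + th))) ->
  cintegrable lambda setT (fourier1 (fun t => (g t)%:C%C)).
Proof.
move=> ig ig2 gg2.
have creal (h : R -> R) : lambda.-integrable setT (EFin \o h) ->
    cintegrable lambda setT (fun t => (h t)%:C%C).
  move=> ih; split => //=; exact: integrable0.
have fE (h : R -> R) w : fourier1 (fun t => (h t)%:C%C) w =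
    ((\int[lambda]_t (h t * cos (t * - w + 0))) +i*
     (\int[lambda]_t (h t * cos (t * - w + - (pi / 2)))))%C.
  rewrite /fourier1 /cint; congr Complex; apply: eq_Rintegral => t _ /=.
    by rewrite mul0r subr0 addr0 mulrN.
  by rewrite mul0r addr0 mulrN cosBpihalf.
pose C1 := 2 * \int[lambda]_t normc (g t)%:C%C.
pose C2 := 2 * \int[lambda]_t normc (g2 t)%:C%C.
apply: (@cintegrable_decay _ (Num.max C1 C2)).
- exact: cmeasurable_fourier1 (creal _ ig).
- by move=> w; rewrite le_max normc_fourier1//; exact: creal.
- move=> w; rewrite le_max; apply/orP; right.
  rewrite (_ : _ * _ = normc (fourier1 (fun t => (g2 t)%:C%C) w)).
    exact/normc_fourier1/creal.
  rewrite -{1}(ger0_norm (sqr_ge0 w)) -normc_real -Normc.normcM -[RHS]normcN.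
  congr normc; rewrite !fE; apply/eqP; rewrite eq_complex/=.
  by rewrite !mul0r subr0 addr0 -sqrrN !gg2 !eqxx.
Qed.

(** Both integrations by parts come from the single primitive [F], in whose derivative the two terms
    containing g1 and the sine cancel. *)
Lemma integral_by_parts_cos (g g1 g2 : R -> R) (a b w th : R) : a <= b ->
  (forall t : R, is_derive t 1 g (g1 t)) -> (forall t : R, is_derive t 1 g1 (g2 t)) ->
  continuous g2 ->
  w ^+ 2 * \int[lambda]_(t in `[a, b]) (g t * cos (t * w + th)) +
  \int[lambda]_(t in `[a, b]) (g2 t * cos (t * w + th)) =
  (g1 b * cos (b * w + th) + w * (g b * sin (b * w + th))) -
  (g1 a * cos (a * w + th) + w * (g a * sin (a * w + th))).
Proof.
move=> ab dg dg1 cg2.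
pose F (t : R) := g1 t * cos (t * w + th) + w * (g t * sin (t * w + th)).
have dF (t : R) : is_derive t 1 F ((w ^+ 2 * g t + g2 t) * cos (t * w + th)).
  have := dg t; have := dg1 t => ? ?.
  rewrite /F; apply: is_derive_eq; rewrite /GRing.scale/=; ring.
have ccos : continuous (fun t : R => cos (t * w + th)).
  move=> t; apply: (@continuous_comp _ _ _ (fun t : R => t * w + th) cos).
    apply: cvgD; last exact: cvg_cst.
    by apply: cvgM => //; exact: cvg_cst.
  exact: continuous_cos.
have cg := is_derive_continuous dg.
have ci (f : R -> R) : continuous f -> lambda.-integrable `[a, b] (EFin \o f).
  move=> cf; apply: continuous_compact_integrable; first exact: segment_compact.
  exact: continuous_subspaceT.
have i1 : lambda.-integrable `[a, b] (EFin \o (fun t => g t * cos (t * w + th))).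
  by apply: ci => t; apply: cvgM; [exact: cg|exact: ccos].
have i2 : lambda.-integrable `[a, b] (EFin \o (fun t => g2 t * cos (t * w + th))).
  by apply: ci => t; apply: cvgM; [exact: cg2|exact: ccos].
rewrite -(@Rintegral_is_derive _ _ F a b ab _ dF); last first.
  move=> t; apply: cvgM; last exact: ccos.
  apply: cvgD; last exact: cg2.
  by apply: cvgM; [exact: cvg_cst|exact: cg].
rewrite -RintegralZl// -RintegralD//; last first.
  by apply: ci => t; apply: cvgM; [exact: cvg_cst|apply: cvgM; [exact: cg|exact: ccos]].
by apply: eq_Rintegral => t _; ring.
Qed.

Definition smooth_decay (g : R -> R) : Prop := exists g1 g2 : R -> R, exists C : R,
  [/\ forall t : R, is_derive t 1 g (g1 t), forall t : R, is_derive t 1 g1 (g2 t),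
      continuous g2 & forall t, [/\ (1 + t ^+ 2) * `|g t| <= C,
        (1 + t ^+ 2) * `|g1 t| <= C & (1 + t ^+ 2) * `|g2 t| <= C]].

Lemma integrable_quadratic_decay (g : R -> R) (C : R) : continuous g ->
  (forall t, (1 + t ^+ 2) * `|g t| <= C) -> lambda.-integrable setT (EFin \o g).
Proof.
move=> cg gC; have ic := integrableZl measurableT C (@integrable_cauchy R).
apply: (le_integrable _ _ _ ic) => //.
  by apply/measurable_EFinP; exact: continuous_measurable_fun.
move=> t _ /=; rewrite lee_fin (le_trans _ (ler_norm _))//.
have t1 : 0 < 1 + t ^+ 2 by rewrite ltr_pwDl// sqr_ge0.
rewrite mulrA ler_pdivlMr// mulrC (le_trans (gC t))// ler_peMr ?ler1n//.
by apply: le_trans (gC t); rewrite mulr_ge0// ltW.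
Qed.

Lemma cintegrable_fourier1_smooth (g : R -> R) : smooth_decay g ->
  cintegrable lambda setT (fourier1 (fun t => (g t)%:C%C)).
Proof.
move=> [g1 [g2 [C [dg dg1 cg2 gC]]]].
have cg := is_derive_continuous dg.
have ig : lambda.-integrable setT (EFin \o g).
  by apply: (@integrable_quadratic_decay _ C) => // t; have [] := gC t.
have ig2 : lambda.-integrable setT (EFin \o g2).
  by apply: (@integrable_quadratic_decay _ C) => // t; have [] := gC t.
apply: (cintegrable_fourier1_by_parts ig ig2) => w th.
have icos (h : R -> R) : lambda.-integrable setT (EFin \o h) ->
    lambda.-integrable setT (EFin \o (fun t => h t * cos (t * w + th))).
  move=> ih; apply: (le_integrable _ _ _ ih) => //.
    apply/measurable_EFinP; apply: measurable_funM.
      by have /measurable_int/measurable_EFinP := ih.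
    apply: (@measurableT_comp _ _ _ _ _ _ (@cos R)).
      by apply: continuous_measurable_fun; exact: continuous_cos.
    by apply: measurable_funD => //; exact: measurable_funM.
  move=> t _ /=; rewrite lee_fin normrM ler_piMr// ler_norml.
  by rewrite cos_geN1 cos_le1.
have l1 := cvg_Rintegral_itv (icos _ ig).
have l2 := cvg_Rintegral_itv (icos _ ig2).
pose F (t : R) := g1 t * cos (t * w + th) + w * (g t * sin (t * w + th)).
have FC (t : R) : (1 + t ^+ 2) * `|F t| <= C * (1 + `|w|).
  have t0 : 0 <= 1 + t ^+ 2 by rewrite addr_ge0// sqr_ge0.
  have [gt gt1 _] := gC t; rewrite mulrDr mulr1.
  apply: (@le_trans _ _ ((1 + t ^+ 2) * `|g1 t| + (1 + t ^+ 2) * `|g t| * `|w|)).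
    rewrite -mulrA -mulrDr ler_wpM2l// (le_trans (ler_normD _ _))// lerD//.
      by rewrite normrM ler_piMr// ler_norml cos_geN1 cos_le1.
    rewrite normrM mulrC ler_wpM2r// normrM ler_piMr// ler_norml.
    by rewrite sin_geN1 sin_le1.
  by rewrite lerD// ler_wpM2r.
(* After multiplication by 1 + n^2 the boundary terms stay below a constant, which n e exceeds for
   large n; and n <= 1 + n^2. *)
have Fn : F n%:R - F (- n%:R) @[n --> \oo] --> (0 : R).
  apply/cvgr0Pnorm_le => e e0; near=> n.
  have Cw : 0 <= C * (1 + `|w|).
    by apply: le_trans (FC 0); rewrite mulr_ge0// addr_ge0// sqr_ge0.
  have n2 : 0 < 1 + n%:R ^+ 2 :> R by rewrite ltr_pwDl// sqr_ge0.
  rewrite (le_trans (ler_normB _ _))// -(ler_pM2l n2) mulrDr.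
  have := lerD (FC n%:R) (FC (- n%:R)); rewrite sqrrN => /le_trans; apply.
  apply: (@le_trans _ _ (n%:R * e)).
    rewrite -ler_pdivrMr//; near: n; exact: nbhs_infty_ger.
  apply: ler_wpM2r; first exact: ltW.
  by have := sqr_ge0 (n%:R - 2^-1 : R); nra.
have l3 : w ^+ 2 * \int[lambda]_(t in `[- n%:R, n%:R]) (g t * cos (t * w + th)) +
    \int[lambda]_(t in `[- n%:R, n%:R]) (g2 t * cos (t * w + th)) @[n --> \oo] -->
    w ^+ 2 * \int[lambda]_t (g t * cos (t * w + th)) +
    \int[lambda]_t (g2 t * cos (t * w + th)).
  by apply: cvgD => //; apply: cvgM => //; exact: cvg_cst.
have l4 : w ^+ 2 * \int[lambda]_(t in `[- n%:R, n%:R]) (g t * cos (t * w + th)) +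
    \int[lambda]_(t in `[- n%:R, n%:R]) (g2 t * cos (t * w + th)) @[n --> \oo] --> (0 : R).
  rewrite (_ : (fun n : nat => _ + _) = (fun n => F n%:R - F (- n%:R)))//.
  apply/funext => n; apply: (integral_by_parts_cos _ _ _ dg dg1 cg2).
  by rewrite lerNl (le_trans _ (ler0n _ n))// oppr_le0.
apply/eqP; rewrite -addr_eq0; apply/eqP; exact: (cvg_unique _ l3 l4).
Unshelve. all: by end_near. Qed.

Lemma schwartz_smooth_decay (psi : R -> R[i]) : schwartz psi ->
  smooth_decay (fun t => complex.Re (psi t)) /\ smooth_decay (fun t => complex.Im (psi t)).
Proof.
move=> [dpsi bpsi].
have dec m : exists C, forall t,
    (1 + t ^+ 2) * `|derive1n m (fun t => complex.Re (psi t)) t| <= C /\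
    (1 + t ^+ 2) * `|derive1n m (fun t => complex.Im (psi t)) t| <= C.
  (* The seminorms with the weights 1 and |t|^2 add up to the weight 1 + t^2. *)
  have [M0 h0] := bpsi 0%N m; have [M2 h2] := bpsi 2%N m.
  exists (M0 + M2) => t; have := h0 t; have := h2 t.
  set z := Complex _ _ => z2; rewrite expr0 mul1r => z0.
  have t0 : 0 <= 1 + t ^+ 2 by rewrite addr_ge0// sqr_ge0.
  have zz : (1 + t ^+ 2) * normc z <= M0 + M2.
    by rewrite mulrDl mul1r lerD// -(real_normK (num_real t)).
  split; apply: le_trans zz; rewrite ler_wpM2l//.
    exact: (Re_le_normc z).
  exact: (Im_le_normc z).
have [C0 h0] := dec 0%N; have [C1 h1] := dec 1%N; have [C2 h2] := dec 2%N.
have dd (f : R -> R) : (forall m t, derivable (derive1n m f) t 1) -> forall m (t : R),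
    is_derive t 1 (derive1n m f) (derive1n m.+1 f t).
  by move=> df m t; rewrite derive1nS derive1E; exact/derivableP.
have mk (f : R -> R) : (forall m t, derivable (derive1n m f) t 1) ->
    (forall t, (1 + t ^+ 2) * `|derive1n 0 f t| <= C0) ->
    (forall t, (1 + t ^+ 2) * `|derive1n 1 f t| <= C1) ->
    (forall t, (1 + t ^+ 2) * `|derive1n 2 f t| <= C2) -> smooth_decay f.
  move=> df f0 f1 f2; exists (derive1n 1 f), (derive1n 2 f), (Num.max C0 (Num.max C1 C2)).
  split; [exact: (dd f df 0%N)|exact: (dd f df 1%N)| |].
    exact: (is_derive_continuous (dd f df 2%N)).
  move=> t; split; rewrite !le_max.
  - by rewrite f0.
  - by rewrite f1 !orbT.
  - by rewrite f2 !orbT.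
split; apply: mk.
- by move=> m t; exact: (dpsi m t).1.
- by move=> t; exact: (h0 t).1.
- by move=> t; exact: (h1 t).1.
- by move=> t; exact: (h2 t).1.
- by move=> m t; exact: (dpsi m t).2.
- by move=> t; exact: (h0 t).2.
- by move=> t; exact: (h1 t).2.
- by move=> t; exact: (h2 t).2.
Qed.

Lemma complex_ReIm (z : R[i]) : z = (complex.Re z)%:C%C + 'i%C * (complex.Im z)%:C%C.
Proof. exact: complexE. Qed.

Section schwartz.
Variable psi : R -> R[i].
Hypothesis psiS : schwartz psi.

Let cReIm : continuous (fun t => complex.Re (psi t)) /\
  continuous (fun t => complex.Im (psi t)).
Proof.
have [[? [? [? [dr _ _ _]]]] [? [? [? [di _ _ _]]]]] := schwartz_smooth_decay psiS.
by split; [exact: is_derive_continuous dr|exact: is_derive_continuous di].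
Qed.

Lemma schwartz_cintegrable : cintegrable lambda setT psi.
Proof.
have [c1 c2] := cReIm.
have [[? [? [C [_ _ _ dr]]]] [? [? [D [_ _ _ di]]]]] := schwartz_smooth_decay psiS.
split.
- by apply: (integrable_quadratic_decay (C := C)) => // t; have [] := dr t.
- by apply: (integrable_quadratic_decay (C := D)) => // t; have [] := di t.
Qed.

Lemma schwartz_bounded : exists M, forall t, normc (psi t) <= M.
Proof.
have [[? [? [C [_ _ _ dr]]]] [? [? [D [_ _ _ di]]]]] := schwartz_smooth_decay psiS.
exists (C + D) => t; apply: le_trans (normc_le _) _.
have [h1 _ _] := dr t; have [h2 _ _] := di t.
by apply: lerD; [apply: le_trans h1|apply: le_trans h2];
  rewrite ler_peMl// lerDl sqr_ge0.
Qed.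

Lemma schwartz_continuous (s : R) : normc (psi t - psi s) @[t --> s] --> (0 : R).
Proof.
have [c1 c2] := cReIm.
apply/cvgr0Pnorm_le => e e0; have e2 : 0 < e / 2 by rewrite divr_gt0.
near=> t; rewrite ger0_norm ?normc_ge0//; apply: le_trans (normc_le _) _.
rewrite [leRHS](splitr e); apply: lerD; near: t.
  have /cvgrPdist_le/(_ _ e2) := c1 s.
  by apply: filterS => t; rewrite distrC; case: (psi t) => ? ?; case: (psi s).
have /cvgrPdist_le/(_ _ e2) := c2 s.
by apply: filterS => t; rewrite distrC; case: (psi t) => ? ?; case: (psi s).
Unshelve. all: by end_near. Qed.

Lemma schwartz_cintegrable_fourier1 : cintegrable lambda setT (fourier1 psi).
Proof.
have [dr di] := schwartz_smooth_decay psiS.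
have := cintegrableD (cintegrable_fourier1_smooth dr)
  (cintegrableZl 'i%C (cintegrable_fourier1_smooth di)).
congr (cintegrable _ _ _); apply/funext => w.
have [i1 i2] := schwartz_cintegrable.
have ie (h : R -> R) : lambda.-integrable setT (EFin \o h) ->
    cintegrable lambda setT (fun t => (h t)%:C%C * expi (- (t * w))).
  move=> ih; apply: (cintegrableM_bounded (M := 1)) => [||t].
  - by split => //=; exact: integrable0.
  - by apply: cmeasurable_expi; apply: measurableT_comp => //; exact: measurable_funM.
  - by rewrite normc_expi.
rewrite /fourier1 -cintZl; last exact: ie.
rewrite -cintD; [|exact: ie|by apply: cintegrableZl; exact: ie].
congr (cint _ _ _); apply/funext => t.
by rewrite [in RHS](complex_ReIm (psi t)) mulrDl mulrA.
Qed.

Lemma schwartz_inversion (s : R) :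
  cint lambda setT (fun w => fourier1 psi w * expi (w * s)) = (2 * pi)%:C%C * psi s.
Proof.
have [M psiM] := schwartz_bounded.
apply: (fourier1_inversion schwartz_cintegrable psiM).
  exact: schwartz_continuous.
exact: schwartz_cintegrable_fourier1.
Qed.

End schwartz.
End fourier_decay.

(** * Bump functions *)

Section polynomial_bump.
Context {R : realType}.
Local Notation lambda := (@lebesgue_measure R).

Section bump.
Variables (P : {poly R}) (a b : R).
Hypotheses (ab : a < b) (Pa : P.[a] = 0) (Pb : P.[b] = 0).
Hypotheses (P'a : P^`().[a] = 0) (P'b : P^`().[b] = 0).

Let g (x : R) : R := if a <= x <= b then P.[x] else 0.

Let itvP (x : R) : (x \in `[a, b]%classic) = (a <= x <= b).
Proof. by rewrite mem_setE in_itv. Qed.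

Let restrictE (h : R -> R) : (fun x => if a <= x <= b then h x else 0) = h \_ `[a, b].
Proof. by apply/funext => x; rewrite /patch itvP. Qed.

Let integrable_restrict (h : R -> R) : continuous h ->
  lambda.-integrable setT (EFin \o (fun x => if a <= x <= b then h x else 0)).
Proof.
move=> ch.
have := @continuous_compact_integrable R h `[a, b]%classic.
move=> /(_ (@segment_compact _ a b) (continuous_subspaceT ch)).
by rewrite integrable_mkcond ?restrict_EFin ?restrictE//.
Qed.

Let Rint_restrict (h k : R -> R) :
  \int[lambda]_x ((if a <= x <= b then h x else 0) * k x) =
  \int[lambda]_(x in `[a, b]) (h x * k x).
Proof.
rewrite [RHS]Rintegral_mkcond; apply: eq_Rintegral => x _.
by rewrite /patch itvP; case: ifP => // _; rewrite mul0r.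
Qed.

Lemma integrable_bump : cintegrable lambda setT (fun x => (g x)%:C%C).
Proof.
split => //=; last exact: integrable0.
by apply: integrable_restrict; exact: continuous_horner.
Qed.

(** Since P and its derivative vanish at both ends, integrating by parts twice over the interval
    leaves no boundary term. *)
Lemma cintegrable_fourier1_bump : cintegrable lambda setT (fourier1 (fun x => (g x)%:C%C)).
Proof.
apply: (@cintegrable_fourier1_by_parts _ g
   (fun x => if a <= x <= b then (P^`()^`()).[x] else 0)).
- by apply: integrable_restrict; exact: continuous_horner.
- by apply: integrable_restrict; exact: continuous_horner.
move=> w th; rewrite !Rint_restrict; apply/eqP; rewrite -addr_eq0; apply/eqP.
rewrite (@integral_by_parts_cos _ _ (horner P^`())) ?(ltW ab)//.
- by rewrite Pa Pb P'a P'b !mul0r !mulr0 addr0 subrr.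
- exact: continuous_horner.
Qed.

(** The projection of x onto [a, b], written so that its continuity is evident. As P vanishes at a
    and b, the truncated polynomial is P composed with it. *)
Let clamp (x : R) : R := (`|x - a| - `|x - b| + (a + b)) / 2.

Let gE : g = horner P \o clamp.
Proof.
apply/funext => x; rewrite /g /clamp/=.
have [xa|ax] := ltP x a.
  rewrite /= ltr0_norm ?subr_lt0// ltr0_norm ?subr_lt0 ?(lt_trans xa)//.
  by rewrite (_ : _ / 2 = a) ?Pa//; field.
rewrite /=; have [xb|bx] := leP x b.
  rewrite ger0_norm ?subr_ge0// ler0_norm ?subr_le0//.
  by congr (P.[_]); field.
rewrite ger0_norm ?subr_ge0// gtr0_norm ?subr_gt0//.
by rewrite (_ : _ / 2 = b) ?Pb//; field.
Qed.

Lemma continuous_bump : continuous g.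
Proof.
rewrite gE => x; apply: continuous_comp; last exact: continuous_horner.
have cn (c : R) : continuous (fun x : R => `|x - c|).
  move=> y; apply: (@continuous_comp _ _ _ (fun x : R => x - c) Num.norm).
    by apply: cvgB => //; exact: cvg_cst.
  exact: norm_continuous.
apply: cvgM; last exact: cvg_cst.
apply: cvgD; last exact: cvg_cst.
by apply: cvgB; exact: cn.
Qed.

Lemma bump_inversion (s : R) : (exists M, forall x, `|g x| <= M) ->
  cint lambda setT (fun w => fourier1 (fun x => (g x)%:C%C) w * expi (w * s)) =
  (2 * pi)%:C%C * (g s)%:C%C.
Proof.
move=> [M gM]; apply: (@fourier1_inversion _ _ M).
- exact: integrable_bump.
- by move=> x; rewrite normc_real.
- have gs : g x - g s @[x --> s] --> g s - g s.
    by apply: cvgB; [exact: continuous_bump|exact: cvg_cst].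
  rewrite subrr in gs.
  have gn : `|g x - g s| @[x --> s] --> (0 : R).
    by rewrite -(normr0 R); exact: cvg_norm gs.
  rewrite (_ : (fun x => normc _) = (fun x => `|g x - g s|))//.
  by apply/funext => x; rewrite -rmorphB normc_real.
- exact: cintegrable_fourier1_bump.
Qed.

End bump.

(** The constant normalizes the parabola vanishing at a and b to have maximum 1, reached at the
    midpoint. *)
Definition bump_base (a b : R) : {poly R} :=
  (4 / (b - a) ^+ 2)%:P * (('X - a%:P) * (b%:P - 'X)).

(** The base is squared so that the zeros at a and b become double. Inside the interval 0 <= 1 - p^2
    < 1, so the power tends to 0 there. *)
Definition bump_poly (a b : R) (k : nat) : {poly R} := 1 - (1 - bump_base a b ^+ 2) ^+ k.

Definition bump (a b : R) (k : nat) (x : R) : R :=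
  if a <= x <= b then (bump_poly a b k).[x] else 0.

Section bump_family.
Variables (a b : R).
Hypothesis ab : a < b.

Let bumpE k x : (bump_poly a b k).[x] =
  1 - (1 - (4 / (b - a) ^+ 2 * ((x - a) * (b - x))) ^+ 2) ^+ k.
Proof. by rewrite /bump_poly /bump_base !hornerE. Qed.

Let base_ge0 x : a <= x <= b -> 0 <= 4 / (b - a) ^+ 2 * ((x - a) * (b - x)).
Proof.
move=> /andP[ax xb]; apply: mulr_ge0; first by rewrite divr_ge0// sqr_ge0.
by rewrite mulr_ge0// subr_ge0.
Qed.

Let base_le1 x : 4 / (b - a) ^+ 2 * ((x - a) * (b - x)) <= 1.
Proof.
rewrite mulrAC ler_pdivrMr ?exprn_gt0 ?subr_gt0// mul1r -subr_ge0.
rewrite (_ : _ - _ = (2 * x - (a + b)) ^+ 2); first exact: sqr_ge0.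
by ring.
Qed.

Let pow01 x : a <= x <= b ->
  0 <= 1 - (4 / (b - a) ^+ 2 * ((x - a) * (b - x))) ^+ 2 <= 1.
Proof.
move=> axb; rewrite subr_ge0 expr_le1// ?base_ge0// base_le1/=.
by rewrite gerBl sqr_ge0.
Qed.

Lemma bump_ge0 k x : 0 <= bump a b k x.
Proof.
rewrite /bump; case: ifP => // axb; rewrite bumpE subr_ge0.
by have /andP[? ?] := pow01 axb; rewrite exprn_ile1.
Qed.

Lemma bump_le1 k x : bump a b k x <= 1.
Proof.
rewrite /bump; case: ifP => // axb; rewrite bumpE gerBl.
by have /andP[? ?] := pow01 axb; rewrite exprn_ge0.
Qed.

Lemma bump_out k x : ~~ (a <= x <= b) -> bump a b k x = 0.
Proof. by rewrite /bump => /negbTE ->. Qed.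

Lemma cvg_bump x : bump a b k x @[k --> \oo] --> (if a < x < b then 1 else 0 : R).
Proof.
have [/andP[ax xb]|axb] := boolP (a < x < b).
  rewrite (_ : bump a b ^~ x = (fun k =>
      1 + - (1 - (4 / (b - a) ^+ 2 * ((x - a) * (b - x))) ^+ 2) ^+ k)); last first.
    by apply/funext => k; rewrite /bump !ltW//= bumpE.
  apply: cvgn_addE (addr0 1) _ _; first exact: cvg_cst.
  rewrite -oppr0; apply: cvgN.
  apply: cvg_expr; have axb : a <= x <= b by rewrite !ltW.
  have /andP[p0 p1] := pow01 axb; rewrite ger0_norm//.
  rewrite ltrBlDr ltrDl exprn_gt0// mulr_gt0// ?divr_gt0 ?exprn_gt0 ?subr_gt0//.
  by rewrite mulr_gt0// subr_gt0.
rewrite (_ : bump a b ^~ x = fun=> 0); first exact: cvg_cst.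
apply/funext => k; rewrite /bump; case: ifP => // /andP[ax xb].
have : x = a \/ x = b.
  move: axb; rewrite negb_and -!leNgt => /orP[xa|bx].
    by left; apply/eqP; rewrite eq_le xa ax.
  by right; apply/eqP; rewrite eq_le xb bx.
by rewrite bumpE => -[] ->; rewrite subrr ?mul0r ?mulr0 expr0n/= subr0 expr1n subrr.
Qed.

Lemma bump_fourier k : cintegrable lambda setT (fun x => (bump a b k x)%:C%C) /\
  cintegrable lambda setT (fourier1 (fun x => (bump a b k x)%:C%C)) /\
  forall s, cint lambda setT (fun w =>
    fourier1 (fun x => (bump a b k x)%:C%C) w * expi (w * s)) =
    (2 * pi)%:C%C * (bump a b k s)%:C%C.
Proof.
have Pa : (bump_poly a b k).[a] = 0.
  by rewrite bumpE subrr mul0r mulr0 expr0n/= subr0 expr1n subrr.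
have Pb : (bump_poly a b k).[b] = 0.
  by rewrite bumpE subrr !mulr0 expr0n/= subr0 expr1n subrr.
(* The derivative of p^2 contributes the factor p, so the whole derivative vanishes wherever p
   does. *)
have P' x : (bump_base a b).[x] = 0 -> (bump_poly a b k)^`().[x] = 0.
  rewrite /bump_poly; move: (bump_base a b) => Q Q0.
  rewrite -polyC1 derivB derivC deriv_exp derivB derivC deriv_exp.
  rewrite /= expr1 !sub0r hornerN hornerMn hornerM hornerN hornerMn hornerM Q0.
  by rewrite mulr0 mul0rn oppr0 mul0r mul0rn oppr0.
have P'a : (bump_poly a b k)^`().[a] = 0.
  by apply: P'; rewrite /bump_base !(hornerM, hornerC, hornerD, hornerN, hornerX) subrr ?mul0r ?mulr0.
have P'b : (bump_poly a b k)^`().[b] = 0.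
  by apply: P'; rewrite /bump_base !(hornerM, hornerC, hornerD, hornerN, hornerX) subrr ?mul0r ?mulr0.
split; first exact: integrable_bump.
split; first exact: cintegrable_fourier1_bump.
move=> s; apply: bump_inversion => //.
by exists 1 => x; rewrite ger0_norm ?bump_le1// bump_ge0.
Qed.

End bump_family.
End polynomial_bump.

(** * Vanishing almost everywhere, tested on a pi-system *)

Section pi_system_ae.
Context {R : realType} {d : measure_display} {T : measurableType d}.
Variable mu : {measure set T -> \bar R}.

Section density_measure.
Variable g : T -> \bar R.
Hypotheses (mg : measurable_fun setT g) (g0 : forall x, (0 <= g x)%E).

Definition density_measure (A : set T) : \bar R := (\int[mu]_(x in A) g x)%E.

Let density0 : density_measure set0 = 0%E.
Proof. exact: integral_set0. Qed.

Let density_ge0 A : (0 <= density_measure A)%E.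
Proof. exact: integral_ge0. Qed.

Let density_sigma_additive : semi_sigma_additive density_measure.
Proof. exact: semi_sigma_additive_nng_induced. Qed.

HB.instance Definition _ := isMeasure.Build _ _ _ density_measure
  density0 density_ge0 density_sigma_additive.

Lemma density_measure_ex : exists m : {measure set T -> \bar R},
  forall A, m A = (\int[mu]_(x in A) g x)%E.
Proof. by exists density_measure. Qed.

End density_measure.

(** The positive and negative parts of u are densities of two measures that agree on G and are
    finite on the sets [c k]. They agree on all measurable sets by uniqueness, so u has integral 0
    over each of them. *)
Lemma pi_system_ae_eq0 (G : set (set T)) (c : (set T)^nat) (u : T -> R) :
  measurable = <<s G >> -> setI_closed G -> (forall k, G (c k)) ->
  \bigcup_k c k = setT -> mu.-integrable setT (EFin \o u) ->
  (forall A, G A -> (\int[mu]_(x in A) (u x)%:E = 0)%E) ->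
  \forall x \ae mu, u x = 0.
Proof.
move=> mG GI Gc cT iu u0.
have mu_ := measurable_int _ iu.
have [m1 m1E] := density_measure_ex (measurable_funepos mu_) (funepos_ge0 _).
have [m2 m2E] := density_measure_ex (measurable_funeneg mu_) (funeneg_ge0 _).
have m12 : forall A, G A -> m1 A = m2 A.
  move=> A GA; have mA : measurable A by rewrite mG; exact: sub_sigma_algebra.
  have := u0 A GA; rewrite integralE m1E m2E => /eqP.
  rewrite sube_eq ?add0e; first by move=> /eqP.
    by apply: integrable_pos_fin_num => //; exact: integrableS iu.
  apply: fin_num_adde_defl.
  by apply: integrable_neg_fin_num => //; exact: integrableS iu.
have m1oo k : (m1 (c k) < +oo)%E.
  rewrite m1E; have mc : measurable (c k) by rewrite mG; exact: sub_sigma_algebra.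
  by apply: integral_funepos_lt_pinfty => //; exact: integrableS iu.
have m12T := @measure_unique _ _ _ G c mG GI Gc cT m1 m2 m12 m1oo.
have : ae_eq mu setT (EFin \o u) (cst 0%E).
  apply: integral_ae_eq => // E _ mE.
  rewrite integral0 integralE.
  have := m12T E mE; rewrite m1E m2E => ->.
  rewrite subee//.
  by apply: integrable_neg_fin_num => //; exact: integrableS iu.
by apply: filterS => x /(_ I)[].
Qed.

End pi_system_ae.

(** * Fourier inversion on R^n *)

Section boxes.
Context {R : realType} {n : nat}.
Implicit Types (a b : 'I_n -> R) (x : n.-tuple R).

Definition tbox a b : set (n.-tuple R) := [set x | forall i, a i < tnth x i < b i].

Definition boxes : set (set (n.-tuple R)) := [set A | exists a b, A = tbox a b].

Lemma measurable_tbox a b : measurable (tbox a b).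
Proof.
rewrite (_ : tbox a b =
  \bigcap_(i in [set: 'I_n]) ((fun x : n.-tuple R => tnth x i) @^-1` `]a i, b i[)).
  apply: fin_bigcap_measurable => [|i _]; first exact: finite_finset.
  by rewrite -[X in measurable X]setTI; apply: (@measurable_tnth _ R n i).
apply/seteqP; split => x /= h i.
  by move=> _ /=; rewrite in_itv/=; exact: h.
by have := h i I; rewrite /= in_itv.
Qed.

Lemma tboxI a b a' b' : tbox a b `&` tbox a' b' =
  tbox (fun i => Num.max (a i) (a' i)) (fun i => Num.min (b i) (b' i)).
Proof.
apply/seteqP; split => x /=.
  by move=> [h h'] i; rewrite gt_max lt_min; have /andP[-> ->] := h i; exact: h'.
by move=> h; split => i; have := h i; rewrite gt_max lt_min => /andP[/andP[? ?] /andP[? ?]];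
  apply/andP.
Qed.

Lemma setI_closed_boxes : setI_closed boxes.
Proof. by move=> A B [a [b ->]] [a' [b' ->]]; rewrite tboxI; do 2 eexists. Qed.

Definition cube (N : nat) : set (n.-tuple R) := tbox (fun=> - N%:R) (fun=> N%:R).

Lemma in_cube x : exists N0, forall N, (N0 <= N)%N -> cube N x.
Proof.
have [N0 hN] : exists N0 : nat, forall i, `|tnth x i| < N0%:R.
  exists (\max_i (Num.bound (tnth x i))%N) => i.
  have := archi_boundP (normr_ge0 (tnth x i)).
  have -> : Num.bound `|tnth x i| = Num.bound (tnth x i) by rewrite /Num.bound normr_id.
  move/lt_le_trans; apply; rewrite ler_nat.
  exact: (leq_bigmax (F := fun i => Num.bound (tnth x i))).
exists N0 => N NN i; rewrite -ltr_norml; apply: lt_le_trans (hN i) _.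
by rewrite ler_nat.
Qed.

Lemma bigcup_cube : \bigcup_N cube N = setT.
Proof.
rewrite -subTset => x _; have [N h] := in_cube x.
by exists N => //; exact: h.
Qed.

Lemma measurable_boxes : @measurable _ (n.-tuple R) = <<s boxes >>.
Proof.
apply/seteqP; split; last first.
  apply: smallest_sub; first exact: sigma_algebra_measurable.
  by move=> _ [a [b ->]]; exact: measurable_tbox.
apply: smallest_sub; first exact: smallest_sigma_algebra.
(* The product sigma-algebra is generated by the preimages under the coordinates, so it suffices
   that each coordinate be measurable for the sigma-algebra of boxes. Open half-spaces are countable
   unions of boxes. *)
elim/big_ind : _ => [//|B C hB hC A [/hB|/hC]//|i _ A [C mC <-]].
have : measurable_fun setT
    ((fun x => tnth x i) : g_sigma_algebraType boxes -> measurableTypeR R).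
  apply: (measurability (@RGenOInfty.G R)).
    exact: RGenOInfty.measurableE.
  move=> _ [_ [r ->] <-]; rewrite setTI.
  rewrite (_ : _ @^-1` _ = \bigcup_N (tbox (fun j => if j == i then r else - N%:R)
     (fun=> N%:R))).
    apply: bigcup_measurable => N _; apply: sub_sigma_algebra.
    by do 2 eexists.
  apply/seteqP; split => x /=.
    rewrite in_itv/= andbT => rx; have [N h] := in_cube x.
    exists N => // j; have := h N (leqnn N) j => /andP[h1 h2].
    by rewrite h2 andbT; case: eqP => [->|_].
  by move=> [N _ /(_ i)]; rewrite eqxx in_itv/= andbT => /andP[].
by move=> /(_ measurableT C mC).
Qed.

End boxes.

Section tuple_fourier.
Context {R : realType} {n : nat}.
Local Notation lambda := (@lebesgue_measure R).
Local Notation leb := (@lebesgue_tuple R n).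
Implicit Types (x y : n.-tuple R).

Lemma dotpC x y : dotp x y = dotp y x.
Proof. by apply: eq_bigr => i _; rewrite mulrC. Qed.

Lemma expi_dotp x y : expi (dotp x y) = \prod_(i < n) expi (tnth x i * tnth y i).
Proof. exact: (big_morph _ (@expiD R) (@expi0 R)). Qed.

Lemma measurable_dotp : measurable_fun setT
  (fun z : n.-tuple R * n.-tuple R => dotp z.1 z.2).
Proof.
apply: measurable_sum => i; apply: measurable_funM.
  exact: (measurableT_comp (measurable_tnth i) measurable_fst).
exact: (measurableT_comp (measurable_tnth i) measurable_snd).
Qed.

Lemma measurable_dotpr x : measurable_fun setT (fun y => dotp x y).
Proof. exact: (measurableT_comp measurable_dotp (pair1_measurable x)). Qed.

Lemma cmeasurable_fourier (f : n.-tuple R -> R[i]) :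
  cintegrable leb setT f -> cmeasurable (fourier f).
Proof.
move=> fi; apply: (@cmeasurable_cint1 _ _ _ _ _ leb
  (fun z => f z.2 * expi (- dotp z.2 z.1))).
apply: cmeasurableM.
  exact: (cmeasurable_comp (cintegrable_cmeasurable fi) measurable_snd).
apply: cmeasurable_expi; apply: measurableT_comp => //.
under [X in measurable_fun _ X]funext do rewrite dotpC.
exact: measurable_dotp.
Qed.

Section product.
Variable phi : 'I_n -> R -> R.
Local Notation cphi i := (fun t => (phi i t)%:C%C).
Hypothesis phi01 : forall i t, 0 <= phi i t <= 1.
Hypothesis phii : forall i, cintegrable lambda setT (cphi i).
Hypothesis Fphii : forall i, cintegrable lambda setT (fourier1 (cphi i)).
Hypothesis phi_inv : forall i s,
  cint lambda setT (fun w => fourier1 (cphi i) w * expi (w * s)) =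
  (2 * pi)%:C%C * (phi i s)%:C%C.

Let T y : R[i] := \prod_(i < n) (phi i (tnth y i))%:C%C.
Let Phi (w : n.-tuple R) : R[i] := \prod_(i < n) (fourier1 (cphi i) (tnth w i))^*.

Let mM (s : R) : measurable_fun setT (fun t : R => t * s).
Proof. exact: measurable_funM. Qed.

Let mMN (s : R) : measurable_fun setT (fun t : R => - (t * s)).
Proof. by apply: measurableT_comp => //; exact: mM. Qed.

Lemma normc_tprod_le1 y : normc (T y) <= 1.
Proof.
rewrite /T -rmorph_prod normc_real ger0_norm ?prodr_ile1//.
by apply: prodr_ge0 => i _; have /andP[] := phi01 i (tnth y i).
Qed.

Lemma cintegrable_tprod_real : cintegrable leb setT T.
Proof. exact: (cint_tprod phii).1. Qed.

Let Phii : cintegrable leb setT Phi.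
Proof. exact: (cint_tprod (fun i => cintegrable_conj (Fphii i))).1. Qed.

(** As T is real, conjugating its transform flips the sign of the exponential; [Phi] is the inverse
    transform of T up to a constant. *)
Let PhiE w : Phi w = cint leb setT (fun y => T y * expi (dotp y w)).
Proof.
pose F i t := (phi i t)%:C%C * expi (t * tnth w i).
have Fi i : cintegrable lambda setT (F i).
  exact: (cintegrableM_expi (phii i) (mM _)).
transitivity (\prod_(i < n) cint lambda setT (F i)).
  apply: eq_bigr => i _; rewrite -cint_conj; last exact: cintegrableM_expi (phii i) (mMN _).
  congr (cint _ _ _); apply/funext => t; rewrite rmorphM/= -expiN opprK.
  by rewrite /F; congr (_ * _); apply/eqP; rewrite eq_complex/= oppr0 !eqxx.
rewrite -(cint_tprod Fi).2; congr (cint _ _ _); apply/funext => y.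
by rewrite expi_dotp -big_split.
Qed.

Let Phi_inv y : cint leb setT (fun w => Phi w * expi (- dotp y w)) =
  ((2 * pi) ^+ n)%:C%C * T y.
Proof.
pose F i t := (fourier1 (cphi i) t)^* * expi (- (t * tnth y i)).
have Fi i : cintegrable lambda setT (F i).
  exact: (cintegrableM_expi (cintegrable_conj (Fphii i)) (mMN _)).
transitivity (\prod_(i < n) cint lambda setT (F i)).
  rewrite -(cint_tprod Fi).2; congr (cint _ _ _); apply/funext => w.
  rewrite big_split/=; congr (_ * _); rewrite -(big_morph _ (@expiD R) (@expi0 R)).
  by rewrite sumrN dotpC.
transitivity (\prod_(i < n) ((2 * pi)%:C%C * (phi i (tnth y i))%:C%C)); last first.
  by rewrite big_split/= prodr_const card_ord -rmorphXn.
apply: eq_bigr => i _; rewrite -[LHS]conjCK.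
rewrite -cint_conj//.
transitivity ((cint lambda setT
   (fun w => fourier1 (cphi i) w * expi (w * tnth y i)))^*).
  congr (_^*); congr (cint _ _ _); apply/funext => w.
  by rewrite /F rmorphM/= expiN !conjCK.
by rewrite phi_inv -rmorphM/=; apply/eqP; rewrite eq_complex/= oppr0 !eqxx.
Qed.

Variable f : n.-tuple R -> R[i].
Hypotheses (fi : cintegrable leb setT f) (Ff : cintegrable leb setT (fourier f)).

(** Both sides equal the integral of [Phi] times the transform of f. The left one is reached through
    inversion for the tensor T, whose factors are invertible on the line, and the right one through
    the definition of [Phi]; each costs one exchange with a kernel of modulus 1. *)
Lemma cint_tprod_fourier :
  ((2 * pi) ^+ n)%:C%C * cint leb setT (fun y => f y * T y) =
  cint leb setT (fun y => T y * cint leb setT (fun w => fourier f w * expi (dotp y w))).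
Proof.
have mK : cmeasurable (fun z : n.-tuple R * n.-tuple R => expi (dotp z.1 z.2)).
  by apply: cmeasurable_expi; exact: measurable_dotp.
have mKN : cmeasurable (fun z : n.-tuple R * n.-tuple R => expi (- dotp z.1 z.2)).
  by apply: cmeasurable_expi; apply: measurableT_comp => //; exact: measurable_dotp.
have K1 (t : R) : normc (expi t) <= 1 by rewrite normc_expi.
have Ti := cintegrable_tprod_real.
rewrite (cint_kernel_swap Ti Ff mK (fun z => K1 _)).
transitivity (cint leb setT (fun w => Phi w * fourier f w)).
  rewrite /fourier -(cint_kernel_swap fi Phii mKN (fun z => K1 _)).
  rewrite -cintZl; last first.
    exact: (cintegrableM_bounded fi (cintegrable_cmeasurable Ti) normc_tprod_le1).
  by congr (cint _ _ _); apply/funext => y; rewrite Phi_inv mulrCA.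
by congr (cint _ _ _); apply/funext => w; rewrite PhiE mulrC.
Qed.

End product.
End tuple_fourier.

Section tuple_inversion.
Context {R : realType} {n : nat}.
Local Notation lambda := (@lebesgue_measure R).
Local Notation leb := (@lebesgue_tuple R n).

Lemma indic_tbox (a b : 'I_n -> R) (y : n.-tuple R) :
  (\1_(tbox a b) y : R) = \prod_(i < n) (if a i < tnth y i < b i then 1 else 0).
Proof.
rewrite indicE; case: (boolP (y \in _)) => [|]; last first.
  move=> nab; apply/esym/eqP; rewrite prodf_seq_eq0.
  have [i hi] : exists i, ~~ (a i < tnth y i < b i).
    apply/existsP; rewrite -negb_forall; apply: contra nab => /forallP h.
    by rewrite inE.
  by apply/hasP; exists i; rewrite ?mem_index_enum//= (negbTE hi).
by rewrite inE => h; rewrite big1// => i _; rewrite h.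
Qed.

Lemma cvg_prod_ord (u : 'I_n -> nat -> R) (l : 'I_n -> R) :
  (forall i, u i k @[k --> \oo] --> l i) ->
  \prod_(i < n) u i k @[k --> \oo] --> \prod_(i < n) l i.
Proof.
move=> ul; apply: cvg_big => // -[x y]/=.
exact: (@mul_continuous R (x, y)).
Qed.

Section zero_on_boxes.
Variable F : n.-tuple R -> R[i].
Variables (f : n.-tuple R -> R[i]) (M : R).
Hypotheses (M0 : 0 <= M) (mF : cmeasurable F) (fi : cintegrable leb setT f).
Hypothesis FM : forall y, normc (F y) <= normc (f y) + M.
Hypothesis F0 : forall (a b : 'I_n -> R) k, (forall i, a i < b i) ->
  cint leb setT (fun y => F y * \prod_(i < n) (bump (a i) (b i) k (tnth y i))%:C%C) = 0.

(** [F] is bounded by an integrable function plus a constant, so it need be integrable only locally.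
    The constant is cut off by the indicator of the closed box. The number r stands for the value at
    y of a product of bumps or of an indicator, so one majorant serves both. *)
Let Fdom (a b : 'I_n -> R) : exists2 h : n.-tuple R -> R,
  leb.-integrable setT (EFin \o h) & forall y (r : R), 0 <= r <= 1 ->
   (r != 0 -> forall i, a i <= tnth y i <= b i) -> normc (F y * r%:C%C) <= h y.
Proof.
pose c i (t : R) : R[i] := (\1_`[a i, b i] t)%:C%C.
have ci i : cintegrable lambda setT (c i).
  split => /=; last exact: integrable0.
  exact: (@integrable_indic_itv R (a i) (b i) true false).
have [Ti _] := cint_tprod ci.
exists (fun y => normc (f y) + M * normc (\prod_(i < n) c i (tnth y i))).
  have := integrableD measurableT (cintegrable_normc fi)
    (integrableZl measurableT M (cintegrable_normc Ti)).
  by [].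
move=> y r /andP[r0 r1] ry; rewrite Normc.normcM normc_real ger0_norm//.
have [->|rn0] := eqVneq r 0.
  by rewrite mulr0 addr_ge0 ?mulr_ge0 ?normc_ge0.
rewrite big1 => [|i _]; last by rewrite /c indicE mem_set//= in_itv/= ry.
rewrite (_ : normc 1 = 1) ?mulr1; last by rewrite -(normr1 R) -(normc_real 1).
by apply: le_trans (FM y); rewrite ler_piMr// normc_ge0.
Qed.

Lemma cintegrable_indic_tbox (a b : 'I_n -> R) :
  cintegrable leb setT (fun y => F y * (\1_(tbox a b) y)%:C%C).
Proof.
have [h hi Fh] := Fdom a b.
apply: (cintegrable_dom _ hi).
  apply: cmeasurableM => //; apply: cmeasurable_real.
  by apply: measurable_indic; exact: measurable_tbox.
move=> y; apply: Fh; first by rewrite indicE; case: (_ \in _); rewrite ?lexx ?ler01.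
rewrite indicE; case: (boolP (y \in _)); last by rewrite eqxx.
by rewrite inE => hy _ i; have /andP[/ltW -> /ltW ->] := hy i.
Qed.

Lemma cint_indic_tbox (a b : 'I_n -> R) :
  cint leb setT (fun y => F y * (\1_(tbox a b) y)%:C%C) = 0.
Proof.
have [ab|/existsNP[i /negP]] := pselect (forall i, a i < b i); last first.
  rewrite -leNgt => ba; rewrite (_ : (fun y => _) = (fun=> (0 : R)%:C%C)).
    by rewrite (@cint_real _ _ _ leb (cst 0)) /Rintegral integral0.
  apply/funext => y; rewrite indicE memNset ?mulr0// => /(_ i) /andP[ay yb].
  by have := lt_trans ay yb; rewrite ltNge ba.
have [h hi Fh] := Fdom a b.
pose bk k (y : n.-tuple R) : R := \prod_(i < n) bump (a i) (b i) k (tnth y i).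
have bk01 k y : 0 <= bk k y <= 1.
  rewrite /bk prodr_ge0/=; last by move=> i _; exact: bump_ge0.
  by apply: prodr_ile1 => i _; rewrite bump_ge0// bump_le1.
have bkE k y : (bk k y)%:C%C = \prod_(i < n) (bump (a i) (b i) k (tnth y i))%:C%C.
  by rewrite rmorph_prod.
have bkcvg y : bk k y @[k --> \oo] --> (\1_(tbox a b) y : R).
  by rewrite indic_tbox; apply: cvg_prod_ord => i; exact: cvg_bump.
have mb k : cmeasurable (fun y => (bk k y)%:C%C).
  under [X in cmeasurable X]funext do rewrite bkE.
  exact: (measurable_tprod (fun i => cintegrable_cmeasurable (bump_fourier (ab i) k).1)).
have := @cdominated_cvg _ _ _ leb (fun k y => F y * (bk k y)%:C%C)
   (fun y => F y * (\1_(tbox a b) y)%:C%C) h.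
have F0' k : cint leb setT (fun y => F y * (bk k y)%:C%C) = 0.
  by rewrite -[RHS](F0 k ab); congr (cint _ _ _); apply/funext => y; rewrite bkE.
move=> cv; apply/esym; apply: (@normc_cvg_unique _ (fun=> 0)).
  rewrite subrr (_ : (fun _ => _) = fun=> 0); first exact: cvg_cst.
  by apply/funext => _; rewrite Normc.normc0.
rewrite (_ : (fun _ => _) = (fun k => normc (cint leb setT (fun y => F y * (bk k y)%:C%C) -
    cint leb setT (fun y => F y * (\1_(tbox a b) y)%:C%C)))); last first.
  by apply/funext => k; rewrite F0'.
apply: cv => //.
- by move=> k; exact: cmeasurableM.
- exact: cintegrable_cmeasurable (cintegrable_indic_tbox a b).
- move=> k y; apply: Fh => // bn0 i; apply: contraT => nab.
  by move: bn0; rewrite /bk (bigD1 i)//= bump_out// mul0r eqxx.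
apply: aeW => y.
rewrite (_ : (fun _ => _) = (fun k => normc (F y) * `|bk k y - (\1_(tbox a b) y : R)|)).
  apply: cvgn_mulE (mulr0 _) _ _; first exact: cvg_cst.
  have : bk k y - (\1_(tbox a b) y : R) @[k --> \oo] --> (0 : R).
    by rewrite -(subrr (\1_(tbox a b) y : R)); apply: cvgB => //; exact: cvg_cst.
  by move=> cv0; rewrite -(normr0 R); exact: cvg_norm cv0.
by apply/funext => k; rewrite -mulrBr Normc.normcM -rmorphB normc_real.
Qed.

(** Cutting F by a cube makes it integrable, and the intersection of that cube with a box is again a
    box, so the cut function also has zero integral over every box. Countably many cubes exhaust the
    space. *)
Lemma ae_eq0_boxes : \forall y \ae leb, F y = 0.
Proof.
suff : \forall y \ae leb, forall N, F y * (\1_(cube N) y)%:C%C = 0.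
  apply: filterS => y h; have [N /(_ _ (leqnn N)) yN] := in_cube y.
  by have := h N; rewrite indicE mem_set// mulr1.
apply: ae_foralln => N.
have Ii := @cintegrable_indic_tbox (fun=> - N%:R) (fun=> N%:R).
have key (u : n.-tuple R -> R) : leb.-integrable setT (EFin \o u) ->
  (forall a b, \int[leb]_y (u y * \1_(tbox a b) y) = 0) -> \forall y \ae leb, u y = 0.
  move=> ui u0; apply: (@pi_system_ae_eq0 _ _ _ leb boxes (@cube R n)) => //.
  - exact: measurable_boxes.
  - exact: setI_closed_boxes.
  - by move=> k; do 2 eexists.
  - exact: bigcup_cube.
  move=> _ [a [b ->]].
  have mT := @measurable_tbox R n a b.
  have iT : leb.-integrable (tbox a b) (EFin \o u) by exact: integrableS ui.
  rewrite -[LHS]fineK; last exact: integrable_fin_num iT.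
  congr (_%:E); rewrite -[RHS](u0 a b) /Rintegral; congr fine.
  rewrite integral_mkcond; apply: eq_integral => y _.
  by rewrite patchE indicE; case: (_ \in _); rewrite ?mulr1 ?mulr0.
have cubeI a b y : F y * (\1_(tbox (fun i => Num.max (- N%:R) (a i)) (fun i => Num.min N%:R (b i))) y)%:C%C
   = F y * (\1_(cube N) y)%:C%C * (\1_(tbox a b) y)%:C%C.
  by rewrite -tboxI indicI/= rmorphM mulrA.
have ReM (z : R[i]) (r : R) : complex.Re (z * r%:C%C) = complex.Re z * r.
  by case: z => x y /=; rewrite mulr0 subr0.
have ImM (z : R[i]) (r : R) : complex.Im (z * r%:C%C) = complex.Im z * r.
  by case: z => x y /=; rewrite mulr0 add0r.
have h1 : \forall y \ae leb, complex.Re (F y * (\1_(cube N) y)%:C%C) = 0.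
  apply: key; first exact: Ii.1.
  move=> a b; rewrite -[RHS](congr1 (@complex.Re R) (cint_indic_tbox
    (fun i => Num.max (- N%:R) (a i)) (fun i => Num.min N%:R (b i))))/=.
  by apply: eq_Rintegral => y _; rewrite cubeI [in RHS]ReM.
have h2 : \forall y \ae leb, complex.Im (F y * (\1_(cube N) y)%:C%C) = 0.
  apply: key; first exact: Ii.2.
  move=> a b; rewrite -[RHS](congr1 (@complex.Im R) (cint_indic_tbox
    (fun i => Num.max (- N%:R) (a i)) (fun i => Num.min N%:R (b i))))/=.
  by apply: eq_Rintegral => y _; rewrite cubeI [in RHS]ImM.
by apply: filterS2 h1 h2 => y; case: (_ * _) => x z /= -> ->.
Qed.

End zero_on_boxes.

(** The inverse integral [h] is bounded and f is integrable, so their difference fits the previous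
    criterion. Its integrals against products of bumps vanish by [cint_tprod_fourier]. *)
Theorem fourier_inversion (f : n.-tuple R -> R[i]) :
  cintegrable leb setT f -> cintegrable leb setT (fourier f) ->
  \forall x \ae leb, cint leb setT (fun w => fourier f w * expi (dotp x w)) =
    ((2 * pi) ^+ n)%:C%C * f x.
Proof.
move=> fi Ff.
pose h x := cint leb setT (fun w => fourier f w * expi (dotp x w)).
pose c : R[i] := ((2 * pi) ^+ n)%:C%C.
have hM x : normc (h x) <= 2 * \int[leb]_w normc (fourier f w).
  rewrite (le_trans (normc_cint (cintegrableM_expi Ff (measurable_dotpr x))))//.
  rewrite (@eq_Rintegral _ _ _ _ _ (fun w => normc (fourier f w)))// => w _.
  by rewrite Normc.normcM normc_expi mulr1.
have mh : cmeasurable h.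
  apply: (@cmeasurable_cint1 _ _ _ _ _ leb
    (fun z => fourier f z.2 * expi (dotp z.1 z.2))).
  apply: cmeasurableM.
    exact: (cmeasurable_comp (cintegrable_cmeasurable Ff) measurable_snd).
  by apply: cmeasurable_expi; exact: measurable_dotp.
have : \forall x \ae leb, h x - c * f x = 0.
  apply: (@ae_eq0_boxes _ (fun x => c * f x) (2 * \int[leb]_w normc (fourier f w))).
  - exact: le_trans (normc_ge0 _) (hM (nseq_tuple n 0)).
  - by apply: cmeasurableB => //; exact: cintegrable_cmeasurable (cintegrableZl _ fi).
  - exact: cintegrableZl.
  - move=> y; rewrite addrC; apply: le_trans (normcD _ _) _.
    by rewrite normcN lerD2l hM.
  move=> a b k ab.
  pose phi i := bump (a i) (b i) k.
  have phi01 i t : 0 <= phi i t <= 1 by rewrite bump_ge0// bump_le1.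
  have := cint_tprod_fourier phi01 (fun i => (bump_fourier (ab i) k).1)
    (fun i => (bump_fourier (ab i) k).2.1) (fun i => (bump_fourier (ab i) k).2.2) fi Ff.
  pose T (y : n.-tuple R) : R[i] := \prod_(i < n) (phi i (tnth y i))%:C%C.
  have Ti : cintegrable leb setT T.
    exact: cintegrable_tprod_real (fun i => (bump_fourier (ab i) k).1).
  have fTi : cintegrable leb setT (fun y => f y * T y).
    apply: (cintegrableM_bounded (M := 1) fi); first exact: cintegrable_cmeasurable Ti.
    exact: normc_tprod_le1 phi01.
  have hTi : cintegrable leb setT (fun y => T y * h y).
    exact: (cintegrableM_bounded Ti mh hM).
  move=> TE; rewrite (_ : (fun y => _) = (fun y => T y * h y + - c * (f y * T y))).
    rewrite cintD//; last exact: cintegrableZl.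
    by rewrite cintZl// -[X in X + _]TE mulNr subrr.
  by apply/funext => y; rewrite -/(T y); ring.
by apply: filterS => x /eqP; rewrite subr_eq0 => /eqP.
Qed.
End tuple_inversion.

(** * Polar coordinates for complex integrands *)

Section conull_domain.
Context {R : realType} {d : measure_display} {T : measurableType d}.
Variables (mu : {measure set T -> \bar R}) (D : set T).
Hypotheses (mD : measurable D) (D0 : mu (~` D) = 0%E).

Lemma ge0_integral_setC0 (f : T -> \bar R) : measurable_fun setT f ->
  (forall x, (0 <= f x)%E) -> (\int[mu]_(x in D) f x = \int[mu]_x f x)%E.
Proof.
move=> mf f0; rewrite [RHS](ge0_negligible_integral (N := ~` D))//.
  by rewrite setDE setTI setCK.
exact: measurableC.
Qed.

Lemma cint_setC0 (g : T -> R[i]) : cmeasurable g -> cint mu D g = cint mu setT g.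
Proof.
have h (f : T -> R) : measurable_fun setT f ->
    \int[mu]_(x in D) f x = \int[mu]_x f x.
  move=> /measurable_EFinP mf; rewrite /Rintegral integralE [in RHS]integralE.
  by rewrite !ge0_integral_setC0//; [exact: measurable_funeneg|exact: measurable_funepos].
by move=> [g1 g2]; rewrite /cint !h.
Qed.

End conull_domain.

Lemma integral_max0 {R : realType} {d : measure_display} {T : measurableType d}
    (mu : {measure set T -> \bar R}) (h : T -> R) :
  (\int[mu]_x (EFin \o h)^\+%E x = \int[mu]_x (Num.max (h x) 0)%:E)%E /\
  (\int[mu]_x (EFin \o h)^\-%E x = \int[mu]_x (Num.max (- h x) 0)%:E)%E.
Proof.
by split; apply: eq_integral => x _; rewrite ?funeposE ?funenegE /= -?EFinN -EFin_max.
Qed.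

Section surface_sigma_finite.
Context {R : realType} {n : nat}.

Let surface_measure_sigma_finite : sigma_finite setT (@surface_measure R n).
Proof.
exists (fun=> setT) => [|_]; first by rewrite bigcup_const.
by split => //; exact: surface_measure_fin.
Qed.

HB.instance Definition _ := Measure_isSigmaFinite.Build _ _ _
  (@surface_measure R n) surface_measure_sigma_finite.

End surface_sigma_finite.

Section complex_polar.
Context {R : realType}.
Local Notation lambda := (@lebesgue_measure R).
Local Notation leb n := (@lebesgue_tuple R n).
Local Notation sigma n := (@surface_measure R n).
Variables (n m : nat).
Hypothesis nm : n = m.+1.

Lemma measurable_radial (g : n.-tuple R -> R) : measurable_fun setT g ->
  measurable_fun setT (fun z : n.-tuple R * measurableTypeR R =>
    `|z.2| ^+ m * g (tscale z.2 z.1)).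
Proof.
move=> mg; apply: measurable_funM.
  by apply: measurable_funX; apply: measurableT_comp => //; exact: measurable_snd.
have msw : measurable_fun setT (fun z : n.-tuple R * measurableTypeR R => (z.2, z.1)).
  by apply/measurable_fun_pairP; split; [exact: measurable_snd|exact: measurable_fst].
exact: (measurableT_comp mg (measurableT_comp (@measurable_tscale2 R n) msw)).
Qed.

(** The surface measure is carried by the sphere, so the first variable may run over all of R^n;
    this lets the formula be read as an integral over a plain product measure. *)
Lemma ge0_polar_prod (g : n.-tuple R -> R) : measurable_fun setT g ->
  (forall x, 0 <= g x) ->
  (\int[(sigma n \x lambda)%E]_z (`|z.2| ^+ m * g (tscale z.2 z.1))%:E =
   2%:E * \int[leb n]_x (g x)%:E)%E.
Proof.
move=> mg g0; rewrite -(ge0_polar nm mg g0).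
have mr := measurable_radial mg.
have r0 z : (0 <= (`|z.2| ^+ m * g (tscale z.2 z.1))%:E)%E.
  by rewrite lee_fin mulr_ge0// exprn_ge0.
have mEr : measurable_fun setT (fun z : n.-tuple R * measurableTypeR R =>
    (`|z.2| ^+ m * g (tscale z.2 z.1))%:E) by exact/measurable_EFinP.
rewrite (@fubini_tonelli1 _ _ _ _ _ (sigma n) lambda _ mEr r0).
apply/esym; apply: ge0_integral_setC0.
- exact: measurable_unit_sphere.
- exact: surface_measureC.
- by apply: (measurable_integral1 lambda mr) => z; rewrite mulr_ge0// exprn_ge0.
- by move=> x; apply: integral_ge0 => a _; exact: (r0 (x, a)).
Qed.

Let polar_real (g : n.-tuple R -> R) : (leb n).-integrable setT (EFin \o g) ->
  (sigma n \x lambda)%E.-integrable setT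
    (EFin \o (fun z => `|z.2| ^+ m * g (tscale z.2 z.1))) /\
  \int[(sigma n \x lambda)%E]_z (`|z.2| ^+ m * g (tscale z.2 z.1)) =
  2 * \int[leb n]_x g x.
Proof.
move=> gi; have [/measurable_EFinP mg goo] := integrableP _ _ _ gi.
have mng : measurable_fun setT (fun x => `|g x|) by exact: measurableT_comp.
split.
  apply/integrableP; split; first by apply/measurable_EFinP; exact: measurable_radial.
  rewrite (_ : \int[_]_x _ = 2%:E * \int[leb n]_x `|g x|%:E)%E.
    by rewrite lte_mul_pinfty.
  rewrite -(ge0_polar_prod mng)//; apply: eq_integral => z _ /=.
  by rewrite normrM normrX normr_id.
(* The weight |a|^m is nonnegative, hence commutes with taking positive and negative parts, and the
   nonnegative formula applies to each. *)
pose gp x := Num.max (g x) 0; pose gn x := Num.max (- g x) 0.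
have mgp : measurable_fun setT gp by exact: measurable_maxr.
have mgn : measurable_fun setT gn by apply: measurable_maxr => //; exact: measurableT_comp.
pose h (z : n.-tuple R * measurableTypeR R) : R := `|z.2| ^+ m * g (tscale z.2 z.1).
have [gpE gnE] := integral_max0 (leb n) g.
have [hpE hnE] := integral_max0 (sigma n \x lambda)%E h.
have hp : (\int[(sigma n \x lambda)%E]_z (Num.max (h z) 0)%:E =
    2%:E * \int[leb n]_x (gp x)%:E)%E.
  rewrite -ge0_polar_prod//; last by move=> x; rewrite le_max lexx orbT.
  by apply: eq_integral => z _; rewrite maxr_pMr ?exprn_ge0// mulr0.
have hn : (\int[(sigma n \x lambda)%E]_z (Num.max (- h z) 0)%:E =
    2%:E * \int[leb n]_x (gn x)%:E)%E.
  rewrite -ge0_polar_prod//; last by move=> x; rewrite le_max lexx orbT.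
  by apply: eq_integral => z _; rewrite maxr_pMr ?exprn_ge0// mulr0 mulrN.
rewrite /Rintegral integralE [in RHS]integralE gpE gnE hpE hnE hp hn.
have := integrable_pos_fin_num measurableT gi; rewrite gpE => /fineK <-.
have := integrable_neg_fin_num measurableT gi; rewrite gnE => /fineK <-.
by rewrite /= mulrBr.
Qed.

Lemma polar (g : n.-tuple R -> R[i]) : cintegrable (leb n) setT g ->
  cintegrable (sigma n \x lambda)%E setT
    (fun z => (`|z.2| ^+ m)%:C%C * g (tscale z.2 z.1)) /\
  cint (sigma n \x lambda)%E setT
    (fun z => (`|z.2| ^+ m)%:C%C * g (tscale z.2 z.1)) =
  2%:R%:C%C * cint (leb n) setT g.
Proof.
move=> [/polar_real [i1 e1] /polar_real[i2 e2]].
have ReM (z : R[i]) (r : R) : complex.Re (r%:C%C * z) = r * complex.Re z.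
  by case: z => x y /=; rewrite mul0r subr0.
have ImM (z : R[i]) (r : R) : complex.Im (r%:C%C * z) = r * complex.Im z.
  by case: z => x y /=; rewrite mul0r addr0.
split.
  split; [under eq_fun do rewrite ReM|under eq_fun do rewrite ImM]; [exact: i1|exact: i2].
apply/eqP; rewrite eq_complex ReM ImM /cint/= -e1 -e2.
by apply/andP; split; apply/eqP; apply: eq_Rintegral => z _; rewrite ?ReM ?ImM.
Qed.

End complex_polar.

(** * The directional Stockwell transform *)

Lemma conj_real {R : realType} (r : R) : r%:C%C^* = r%:C%C :> R[i].
Proof. by apply/eqP; rewrite eq_complex/= oppr0 !eqxx. Qed.

Lemma conjM {R : realType} (z w : R[i]) : (z * w)^* = z^* * w^*.
Proof. exact: rmorphM. Qed.

Section stockwell_formula.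
Context {R : realType} {n : nat}.
Local Notation lambda := (@lebesgue_measure R).
Local Notation leb := (@lebesgue_tuple R n).
Variables (psi : R -> R[i]) (f : n.-tuple R -> R[i]).
Hypotheses (psi_schwartz : schwartz psi) (fi : cintegrable leb setT f).

Lemma dotp_tscale (a : R) (x y : n.-tuple R) : dotp x (tscale a y) = a * dotp x y.
Proof.
by rewrite /dotp mulr_sumr; apply: eq_bigr => i _; rewrite tnth_tscale mulrCA.
Qed.

Lemma normc_fourier (w : n.-tuple R) :
  normc (fourier f w) <= 2 * \int[leb]_x normc (f x).
Proof.
have mN : measurable_fun setT (fun x => - dotp x w).
  apply: measurableT_comp => //.
  under [X in measurable_fun _ X]funext do rewrite dotpC.
  exact: measurable_dotpr.
rewrite (le_trans (normc_cint (cintegrableM_expi fi mN)))//.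
rewrite (@eq_Rintegral _ _ _ _ _ (fun x => normc (f x)))// => x _.
by rewrite Normc.normcM normc_expi mulr1.
Qed.

Let c0 : R := (2 * pi) `^ (n%:R / 2).

Let c0_gt0 : 0 < c0.
Proof. by rewrite powR_gt0// mulr_gt0// pi_gt0. Qed.

Let pi2_neq0 : (2 * pi : R) != 0.
Proof. by rewrite mulf_neq0// gt_eqF// pi_gt0. Qed.

Lemma conj_schwartz_inversion (s : R) : (psi s)^* = ((2 * pi)^-1)%:C%C *
  cint lambda setT (fun w => (fourier1 psi w)^* * expi (- (w * s))).
Proof.
have mM : measurable_fun setT (fun w : R => w * s) by exact: measurable_funM.
have iF := schwartz_cintegrable_fourier1 psi_schwartz.
transitivity (((2 * pi)^-1)%:C%C *
    (cint lambda setT (fun w => fourier1 psi w * expi (w * s)))^*).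
  rewrite schwartz_inversion// conjM conj_real mulrA.
  by rewrite -rmorphM/= mulVf// mul1r.
rewrite -cint_conj; last exact: (cintegrableM_expi iF mM).
by congr (_ * cint _ _ _); apply/funext => w; rewrite rmorphM/= -expiN.
Qed.

Let Pi : cintegrable lambda setT (fun w => (fourier1 psi w)^*).
Proof. exact/cintegrable_conj/schwartz_cintegrable_fourier1. Qed.

(** Expand the conjugate of psi by inversion and integrate in y first. The modulation adds 1 to the
    frequency w, so f is transformed at a (1 + w) u. As a function of b the transform is then a
    one-dimensional Fourier integral. *)
Lemma stockwellE (u : n.-tuple R) (b a : R) :
  stockwell psi f u b a = (`|a| / (2 * pi * c0))%:C%C *
    cint lambda setT (fun w => (fourier1 psi w)^* *
      fourier f (tscale (a * (1 + w)) u) * expi (w * (a * b))).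
Proof.
(* All the phases are gathered in one kernel of modulus 1; its exponent is also -a (1 + w) (y . u) +
   w a b. *)
pose K (z : n.-tuple R * measurableTypeR R) : R[i] :=
  expi (- (a * dotp z.1 u) - z.2 * (a * (dotp z.1 u - b))).
have mdu : measurable_fun setT (fun y : n.-tuple R => dotp y u).
  under [X in measurable_fun _ X]funext do rewrite dotpC.
  exact: measurable_dotpr.
have mdz : measurable_fun setT (fun z : n.-tuple R * measurableTypeR R => dotp z.1 u).
  exact: (measurableT_comp mdu measurable_fst).
have mK : cmeasurable K.
  apply: cmeasurable_expi; apply: measurable_funB.
    by apply: measurableT_comp => //; exact: measurable_funM.
  apply: measurable_funM; first exact: measurable_snd.
  by apply: measurable_funM => //; exact: measurable_funB.
have K1 z : normc (K z) <= 1 by rewrite normc_expi.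
pose c : R[i] := (`|a| / (2 * pi * c0))%:C%C.
transitivity (c * cint leb setT (fun y => f y *
    cint lambda setT (fun w => (fourier1 psi w)^* * K (y, w)))).
  rewrite -cintZl; last exact: (cintegrable_kernel_cint fi Pi mK K1).
  congr (cint _ _ _); apply/funext => y.
  rewrite /atom -/c0 !conjM conj_real -expiN conj_schwartz_inversion.
  have -> : c = (`|a| / c0)%:C%C * ((2 * pi)^-1)%:C%C.
    by rewrite -rmorphM/= /c invfM mulrA mulrAC.
  rewrite (_ : cint _ _ (fun w => _ * K (y, w)) =
      cint lambda setT (fun w => (fourier1 psi w)^* *
      expi (- (w * (a * (dotp y u - b))))) * expi (- (a * dotp y u))); first by ring.
  rewrite -cintZr; last first.
    apply: cintegrableM_expi => //; apply: measurableT_comp => //.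
    exact: measurable_funM.
  congr (cint _ _ _); apply/funext => w.
  by rewrite /K/= expiD mulrCA mulrC.
rewrite (cint_kernel_swap fi Pi mK K1); congr (_ * cint _ _ _); apply/funext => w.
rewrite -mulrA; congr (_ * _).
rewrite /fourier -cintZr; last first.
  apply: cintegrableM_expi => //; apply: measurableT_comp => //.
  under [X in measurable_fun _ X]funext do rewrite dotpC.
  exact: measurable_dotpr.
congr (cint _ _ _); apply/funext => y; rewrite -mulrA -expiD dotp_tscale.
by congr (_ * expi _) => /=; ring.
Qed.

End stockwell_formula.

(** * The innermost integral, over b *)

Section reconstruction_slice.
Context {R : realType} {n : nat}.
Local Notation lambda := (@lebesgue_measure R).
Local Notation leb := (@lebesgue_tuple R n).
Variables (psi eta : R -> R[i]) (f : n.-tuple R -> R[i]).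
Hypotheses (psi_schwartz : schwartz psi) (eta_schwartz : schwartz eta).
Hypotheses (n_ge2 : (2 <= n)%N) (fi : cintegrable leb setT f).

Definition window_product (w : R) : R[i] := (fourier1 psi w)^* * fourier1 eta w.

Definition modulated_fourier (x z : n.-tuple R) : R[i] := fourier f z * expi (dotp x z).

Definition slice (x u : n.-tuple R) (a b : R) : R[i] :=
  stockwell psi f u b a * atom eta u b a x * (`|a| ^+ (n - 2))%:C%C.

Let c0 : R := (2 * pi) `^ (n%:R / 2).

Let c0_gt0 : 0 < c0.
Proof. by rewrite powR_gt0// mulr_gt0// pi_gt0. Qed.

Let c0X2 : c0 * c0 = (2 * pi) ^+ n.
Proof.
have p0 : 0 < 2 * pi :> R by rewrite mulr_gt0// pi_gt0.
rewrite /c0 -powRD; last by apply/implyP => _; rewrite gt_eqF.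
by rewrite -splitr powR_mulrn// ltW.
Qed.

Lemma cmeasurable_modulated_fourier x : cmeasurable (modulated_fourier x).
Proof.
apply: cmeasurableM; first exact: cmeasurable_fourier.
by apply: cmeasurable_expi; exact: measurable_dotpr.
Qed.

Lemma measurable_tscalel (u : n.-tuple R) (g : R -> R) : measurable_fun setT g ->
  measurable_fun setT (fun w : R => tscale (g w) u).
Proof.
move=> mg.
have mp : measurable_fun setT (fun w : R => (g w, u)).
  by apply/measurable_fun_pairP; split => //; exact: measurable_cst.
exact: (measurableT_comp (@measurable_tscale2 R n) mp).
Qed.

Lemma cintegrable_window_product : cintegrable lambda setT window_product.
Proof.
have ei := schwartz_cintegrable eta_schwartz.
apply: (cintegrableM_bounded (M := 2 * \int[lambda]_t normc (eta t))).
- exact/cintegrable_conj/schwartz_cintegrable_fourier1.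
- exact: cmeasurable_fourier1.
- by move=> w; exact: normc_fourier1.
Qed.

(** By [stockwellE] the b-dependence is exp(i w a b) against a translate and dilate of eta, which is
    integrable in b; exchanging the integrals produces the transform of eta at w. The phases combine
    into exp(i a (1 + w) (x . u)), the one in [modulated_fourier]. The powers of |a| are 1 + 1 + (n
    - 2) from the two atoms and the weight, less 1 from the substitution in b. *)
Lemma cint_slice (x u : n.-tuple R) (a : R) : a != 0 ->
  cintegrable lambda setT (slice x u a) /\
  cint lambda setT (slice x u a) = (((2 * pi) ^+ n.+1)^-1)%:C%C *
    cint lambda setT (fun xi => (`|a| ^+ n.-1)%:C%C *
      (window_product (xi - 1) * modulated_fourier x (tscale (a * xi) u))).
Proof.
move=> a0.
have maff : measurable_fun setT (fun w : R => a * (1 + w)).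
  by apply: measurable_funM => //; exact: measurable_funD.
have mfh : cmeasurable (fun w : R => fourier f (tscale (a * (1 + w)) u)).
  exact: (cmeasurable_comp (cmeasurable_fourier fi) (measurable_tscalel u maff)).
pose G w := (fourier1 psi w)^* * fourier f (tscale (a * (1 + w)) u).
have Gi : cintegrable lambda setT G.
  apply: (cintegrableM_bounded (M := 2 * \int[leb]_y normc (f y))) => //.
    exact/cintegrable_conj/schwartz_cintegrable_fourier1.
  by move=> w; exact: normc_fourier.
pose d := dotp x u.
have ei := schwartz_cintegrable eta_schwartz.
have na0 : - a != 0 by rewrite oppr_eq0.
have ebi : cintegrable lambda setT (fun b => eta (- a * b + a * d)).
  exact: cintegrable_affine.
pose K (z : measurableTypeR R * measurableTypeR R) : R[i] := expi (z.2 * (a * z.1)).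
have mK : cmeasurable K.
  apply: cmeasurable_expi; apply: measurable_funM; first exact: measurable_snd.
  by apply: measurable_funM => //; exact: measurable_fst.
have K1 z : normc (K z) <= 1 by rewrite normc_expi.
pose c : R[i] := ((`|a| / (2 * pi * c0)) * (`|a| / c0) * `|a| ^+ (n - 2))%:C%C * expi (a * d).
have sE b : slice x u a b =
    c * (eta (- a * b + a * d) * cint lambda setT (fun w => G w * K (b, w))).
  rewrite /slice stockwellE// /atom -/c0 -/d /c !rmorphM/=.
  rewrite (_ : a * (d - b) = - a * b + a * d); last by ring.
  rewrite /K/= /G; ring.
under [X in cintegrable _ _ X /\ _]funext do rewrite sE.
under [X in _ /\ cint _ _ X = _]funext do rewrite sE.
have kci := cintegrable_kernel_cint ebi Gi mK K1.
split; first exact: cintegrableZl.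
rewrite (cintZl _ kci) (cint_kernel_swap ebi Gi mK K1).
have inner w : cint lambda setT (fun b => eta (- a * b + a * d) * K (b, w)) =
    (`|a|^-1)%:C%C * (fourier1 eta w * expi (w * (a * d))).
  pose g s := eta s * expi (- (s * w)) * expi (w * (a * d)).
  have gi' : cintegrable lambda setT (fun s => eta s * expi (- (s * w))).
    apply: cintegrableM_expi => //; apply: measurableT_comp => //.
    exact: measurable_funM.
  have gi : cintegrable lambda setT g by apply: cintegrableM_expi.
  rewrite -cintZr// -[X in X^-1]normrN -(cint_affine (a * d) na0 gi).
  congr (cint _ _ _); apply/funext => b; rewrite /g -mulrA -expiD.
  by congr (_ * expi _) => /=; ring.
under [X in _ * cint _ _ X]funext do rewrite inner.
pose h w := window_product w * modulated_fourier x (tscale (a * (1 + w)) u).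
have hi : cintegrable lambda setT h.
  apply: (cintegrableM_bounded (M := 2 * \int[leb]_y normc (f y))).
  - exact: cintegrable_window_product.
  - exact: (cmeasurable_comp (cmeasurable_modulated_fourier x) (measurable_tscalel u maff)).
  - by move=> w; rewrite Normc.normcM normc_expi mulr1; exact: normc_fourier.
(* The translation w = xi - 1, matching the variable of the window density. *)
have := cint_affine (-1) (oner_neq0 R) hi; rewrite normr1 invr1 mul1r => hE.
pose kap : R := ((2 * pi) ^+ n.+1)^-1 * `|a| ^+ n.-1.
transitivity (kap%:C%C * cint lambda setT h); last first.
  rewrite rmorphM -mulrA -hE; congr (_ * _).
  rewrite -cintZl; last exact: (cintegrable_affine (-1) (oner_neq0 R) hi).
  congr (cint _ _ _); apply/funext => xi.
  by rewrite /h mul1r addrCA subrr addr0.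
have -> : kap = `|a| / (2 * pi * c0) * (`|a| / c0) * `|a| ^+ (n - 2) / `|a|.
  have field_aux (p r A q : R) : p != 0 -> r != 0 -> A != 0 ->
      (p * (r * r))^-1 * (A * q) = A / (p * r) * (A / r) * q / A.
    by move=> ? ? ?; field; apply/and3P.
  (* Subtraction of naturals is truncated; this equality is where 2 <= n enters. *)
  rewrite /kap (_ : n.-1 = (n - 2).+1); last by rewrite -subSn// -subn1 subSS.
  rewrite exprS -c0X2 exprS field_aux ?normr_eq0//; last 2 first.
  - by rewrite gt_eqF// mulr_gt0// pi_gt0.
  - by rewrite gt_eqF.
rewrite (_ : (fun w => _) = (fun w => (`|a|^-1)%:C%C * expi (- (a * d)) * h w)); last first.
  apply/funext => w; rewrite /h /G /window_product /modulated_fourier dotp_tscale -/d.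
  rewrite (_ : expi (w * (a * d)) = expi (- (a * d)) * expi (a * (1 + w) * d)).
    by ring.
  by rewrite -expiD; congr expi; ring.
rewrite cintZl// mulrA; congr (_ * _).
by rewrite /c mulrACA [expi _ * _]mulrC expiNM mulr1 -rmorphM.
Qed.

End reconstruction_slice.

Section product_sigma_finite.
Context {R : realType} {d1 d2 : measure_display}.
Context {T1 : measurableType d1} {T2 : measurableType d2}.
Variables (m1 : {sigma_finite_measure set T1 -> \bar R}).
Variables (m2 : {sigma_finite_measure set T2 -> \bar R}).

(* The library's sigma-finite instance on [m1 \x m2] is not inferred: it is
   shadowed by the one for products of subprobabilities. *)
Definition product_sf (A : set (T1 * T2)) : \bar R := (m1 \x m2)%E A.

Let product_sf0 : product_sf set0 = 0%E. Proof. exact: measure0. Qed.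

Let product_sf_ge0 A : (0 <= product_sf A)%E. Proof. exact: measure_ge0. Qed.

Let product_sf_sigma_additive : semi_sigma_additive product_sf.
Proof. exact: measure_semi_sigma_additive. Qed.

HB.instance Definition _ := isMeasure.Build _ _ _ product_sf
  product_sf0 product_sf_ge0 product_sf_sigma_additive.

Let product_sf_sigma_finite : sigma_finite setT product_sf.
Proof.
have /sigma_finiteP[F [TF ndF Foo]] := sigma_finiteT m1.
have /sigma_finiteP[G [TG ndG Goo]] := sigma_finiteT m2.
exists (fun k => F k `*` G k) => [|k].
  apply/esym; rewrite -subTset => -[x y] _.
  have [i _ Fx] : (\bigcup_k F k) x by rewrite -TF.
  have [j _ Gy] : (\bigcup_k G k) y by rewrite -TG.
  exists (maxn i j) => //; split => /=.
    by move: Fx; exact/subsetPset/ndF/leq_maxl.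
  by move: Gy; exact/subsetPset/ndG/leq_maxr.
have [mF Fk] := Foo k; have [mG Gk] := Goo k.
split; first exact: measurableX.
by rewrite /product_sf product_measure1E// lte_mul_pinfty// ge0_fin_numE.
Qed.

HB.instance Definition _ := Measure_isSigmaFinite.Build _ _ _ product_sf
  product_sf_sigma_finite.

End product_sigma_finite.

(** * Joint integrability in direction, scale and frequency *)

Section radial_fubini.
Context {R : realType}.
Local Notation lambda := (@lebesgue_measure R).
Variables (n m : nat).
Hypothesis nm : n = m.+1.
Local Notation leb := (@lebesgue_tuple R n).
Local Notation sigma := (@surface_measure R n).
Local Notation polar_measure := (product_sf sigma lambda).
Variables (H : R -> R[i]) (k : n.-tuple R -> R[i]).
Hypotheses (mH : cmeasurable H) (ki : cintegrable leb setT k).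

Let wd (xi : R) : R[i] := H (xi - 1) * ((`|xi| ^+ n)^-1)%:C%C.
Hypothesis wdi : cintegrable lambda setT wd.

Definition radial_kernel (z : (n.-tuple R * measurableTypeR R) * measurableTypeR R) : R[i] :=
  (`|z.1.2| ^+ m)%:C%C * (H (z.2 - 1) * k (tscale (z.1.2 * z.2) z.1.1)).

Let mk : cmeasurable k. Proof. exact: cintegrable_cmeasurable ki. Qed.

Let mJ : cmeasurable radial_kernel.
Proof.
have m1 : measurable_fun setT (fun z : (n.-tuple R * measurableTypeR R) * measurableTypeR R => z.1.2).
  exact: (measurableT_comp measurable_snd measurable_fst).
apply: cmeasurableM.
  by apply: cmeasurable_real; apply: measurable_funX; apply: measurableT_comp.
apply: cmeasurableM.
  apply: (cmeasurable_comp mH); apply: measurable_funB => //; exact: measurable_snd.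
apply: (cmeasurable_comp mk).
have mp : measurable_fun setT (fun z : (n.-tuple R * measurableTypeR R) * measurableTypeR R =>
    (z.1.2 * z.2, z.1.1)).
  apply/measurable_fun_pairP; split => /=.
    by apply: measurable_funM => //; exact: measurable_snd.
  exact: (measurableT_comp measurable_fst measurable_fst).
exact: (measurableT_comp (@measurable_tscale2 R n) mp).
Qed.

Let ae_neq0 : \forall xi \ae lambda, (xi : measurableTypeR R) != 0.
Proof.
exists [set 0]; split => //; first exact: lebesgue_measure_set1.
by move=> x /= /negP; rewrite negbK => /eqP.
Qed.

(** Tonelli with xi outermost: for xi != 0, the polar formula and the dilation by xi turn the inner
    integral of the modulus into 2 |xi|^-n |H(xi - 1)| times the L^1 norm of k. This is integrable
    in xi precisely because the window density is. *)
Lemma cintegrable_radial_kernel :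
  cintegrable (polar_measure \x lambda)%E setT radial_kernel.
Proof.
apply: (cintegrable_prodP2 mJ).
have mwd := measurable_normc (cintegrable_cmeasurable wdi).
have Kfin : (\int[leb]_x (normc (k x))%:E \is a fin_num)%E.
  rewrite ge0_fin_numE; first exact: cintegrable_lty ki.
  by apply: integral_ge0 => x _; rewrite lee_fin normc_ge0.
pose K : R := 2 * fine (\int[leb]_x (normc (k x))%:E).
have K0 : 0 <= K.
  by rewrite mulr_ge0// fine_ge0// integral_ge0// => x _; rewrite lee_fin normc_ge0.
pose Phi (xi : measurableTypeR R) : \bar R :=
  (\int[polar_measure]_z (normc (radial_kernel (z, xi)))%:E)%E.
suff PhiE : (\int[lambda]_xi Phi xi = \int[lambda]_xi (K%:E * (normc (wd xi))%:E))%E.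
  change (\int[lambda]_xi Phi xi < +oo)%E; rewrite PhiE.
rewrite ge0_integralZl//; last 2 first.
    by apply/measurable_EFinP.
    by move=> x _; rewrite lee_fin normc_ge0.
  rewrite lte_mul_pinfty// ?lee_fin//.
  exact: cintegrable_lty wdi.
apply: ae_eq_integral => //.
- apply: (measurable_integral2 polar_measure (measurable_normc mJ)).
  by move=> z; exact: normc_ge0.
- by apply: measurable_funeM; exact/measurable_EFinP.
apply: filterS ae_neq0 => xi xi0 _; rewrite /Phi.
(* Reading (a xi) u as the dilate by xi of the polar point a u gives the shape of the polar formula
   for y |-> |k(xi y)|. *)
rewrite (eq_integral (fun z : n.-tuple R * measurableTypeR R => (normc (H (xi - 1)))%:E *
  (`|z.2| ^+ m * normc (k (tscale xi (tscale z.2 z.1))))%:E)%E); last first.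
  move=> z _; rewrite /radial_kernel/= !Normc.normcM normc_real -EFinM.
  rewrite (ger0_norm (exprn_ge0 _ (normr_ge0 _))) tscaleA (mulrC xi).
  by congr (_%:E); ring.
have mkx : measurable_fun setT (fun y => normc (k (tscale xi y))).
  exact: (measurableT_comp (measurable_normc mk) (@measurable_tscale R n xi)).
have mr := measurable_radial m mkx.
have mEr : measurable_fun setT (fun z : n.-tuple R * measurableTypeR R =>
    (`|z.2| ^+ m * normc (k (tscale xi (tscale z.2 z.1))))%:E) by exact/measurable_EFinP.
rewrite ge0_integralZl//; last 2 first.
- by move=> z _; rewrite lee_fin mulr_ge0 ?normc_ge0// exprn_ge0.
- by rewrite lee_fin normc_ge0.
have := ge0_polar_prod nm mkx (fun y => normc_ge0 _) => ->.
have mEk : measurable_fun setT (fun y => (normc (k y))%:E).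
  exact/measurable_EFinP/measurable_normc.
rewrite (ge0_integral_tscale xi0 mEk); last by move=> y; rewrite lee_fin normc_ge0.
rewrite -(fineK Kfin) -!EFinM; congr (_%:E).
rewrite /K /wd Normc.normcM normc_real (ger0_norm (x := `|xi| ^- n)) ?invr_ge0 ?exprn_ge0//.
by ring.
Qed.

Lemma cint_radial_kernel : cint (polar_measure \x lambda)%E setT radial_kernel =
  2%:R%:C%C * cint leb setT k * cint lambda setT wd.
Proof.
have Ji := cintegrable_radial_kernel.
rewrite -cint_fubini2// -cintZl//.
apply: ae_eq_cint.
- exact: cintegrable_cmeasurable (cintegrable_fubini2 Ji).
- exact: cintegrable_cmeasurable (cintegrableZl _ wdi).
apply: filterS ae_neq0 => xi xi0.
have kxi := cintegrable_tscale xi0 ki.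
have [pi_ pe] := polar nm kxi.
transitivity (H (xi - 1) * cint polar_measure setT
   (fun z => (`|z.2| ^+ m)%:C%C * k (tscale xi (tscale z.2 z.1)))).
  rewrite -cintZl//; congr (cint _ _ _); apply/funext => z.
  by rewrite /radial_kernel/= tscaleA (mulrC xi) mulrCA.
transitivity (H (xi - 1) * (2%:R%:C%C * cint leb setT (fun y => k (tscale xi y)))).
  by congr (_ * _); exact: pe.
rewrite (cint_tscale xi0 ki) /wd.
by ring.
Qed.

End radial_fubini.

(** * The iterated integral *)

Section reconstruction.
Context {R : realType}.
Local Notation lambda := (@lebesgue_measure R).
Variables (n : nat) (psi eta : R -> R[i]) (f : n.-tuple R -> R[i]).
Local Notation leb := (@lebesgue_tuple R n).
Local Notation sigma := (@surface_measure R n).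
Hypotheses (n_ge2 : (2 <= n)%N) (psi_schwartz : schwartz psi).
Hypotheses (eta_schwartz : schwartz eta).
Hypothesis window_i : cintegrable lambda setT (window_density n psi eta).
Hypotheses (fi : cintegrable leb setT f) (Ff : cintegrable leb setT (fourier f)).
Variable x : n.-tuple R.

Local Notation H := (window_product psi eta).
Local Notation k := (modulated_fourier f x).
Local Notation F := (slice psi eta f x).
Local Notation J := (radial_kernel n.-1 H k).

Let nm : n = n.-1.+1. Proof. by rewrite prednK// (ltn_trans _ n_ge2). Qed.

Let mH : cmeasurable H.
Proof. exact: cintegrable_cmeasurable (cintegrable_window_product psi_schwartz eta_schwartz). Qed.

Let ki : cintegrable leb setT k.
Proof. by apply: cintegrableM_expi => //; exact: measurable_dotpr. Qed.

Let kap : R[i] := (((2 * pi) ^+ n.+1)^-1)%:C%C.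

Let g (z : n.-tuple R * measurableTypeR R) : R[i] :=
  kap * cint lambda setT (fun xi => J (z, xi)).

Let Ji : cintegrable (product_sf sigma lambda \x lambda)%E setT J.
Proof. exact: (cintegrable_radial_kernel nm mH ki window_i). Qed.

Let gi : cintegrable (sigma \x lambda)%E setT g.
Proof. exact: (cintegrableZl kap (cintegrable_fubini1 Ji)). Qed.

Let FE u a : a != 0 -> cintegrable lambda setT (F u a) /\ cint lambda setT (F u a) = g (u, a).
Proof.
move=> a0; have [Fi ->] := cint_slice psi_schwartz eta_schwartz n_ge2 fi x u a0.
by [].
Qed.

Let mg u : cmeasurable (fun a : R => g (u, a)).
Proof. exact: (cmeasurable_comp (cintegrable_cmeasurable gi) (pair1_measurable u)). Qed.

Let mRp : measurable (Rpunctured : set (measurableTypeR R)).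
Proof.
rewrite (_ : Rpunctured = ~` [set 0]); first exact: measurableC.
by apply/seteqP; split => a /=; [move=> /eqP|move=> /eqP].
Qed.

Let Rp0 : lambda (~` Rpunctured) = 0%E.
Proof.
rewrite (_ : ~` Rpunctured = [set 0]); first exact: lebesgue_measure_set1.
apply/seteqP; split => a /=; last by move=> -> /eqP.
by move=> /negP; rewrite negbK => /eqP.
Qed.

Let cintF u : cint lambda Rpunctured (fun a => cint lambda setT (F u a)) =
  cint lambda setT (fun a => g (u, a)).
Proof.
rewrite -(@cint_setC0 _ _ _ lambda _ mRp Rp0 _ (mg u)).
by congr Complex; apply: eq_Rintegral => a; rewrite inE => a0; rewrite (FE u a0).2.
Qed.

(** The b-integral exists for every u and every a != 0. The integrability in a, obtained from Fubini
    on the product of sphere and scales, holds only for almost every u. *)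
Lemma iterated_integrable_slice : iterated_integrable F.
Proof.
split.
- by apply: aeW => u _; apply: aeW => a a0; exact: (FE u a0).1.
- apply: filterS (ae_cintegrable1 gi) => u gu _.
  have [g1 g2] := @cintegrableS _ _ _ lambda _ _ mRp gu.
  split; [apply: eq_integrable g1|apply: eq_integrable g2] => // a;
    by rewrite inE => a0; rewrite (FE u a0).2.
- under [X in cintegrable _ _ X]funext do rewrite cintF.
  apply: cintegrableS; first exact: measurable_unit_sphere.
  exact: cintegrable_fubini1 gi.
Qed.

Lemma iterated_cint_slice : iterated_cint F =
  kap * (2%:R%:C%C * cint leb setT k * cint lambda setT (window_density n psi eta)).
Proof.
rewrite /iterated_cint; under [X in cint _ _ X]funext do rewrite cintF.
have gu := cintegrable_fubini1 gi.
rewrite cint_setC0; last 3 first.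
- exact: measurable_unit_sphere.
- exact: surface_measureC.
- exact: cintegrable_cmeasurable gu.
rewrite (cint_fubini1 gi).
(* The same measure under the name that carries the sigma-finite structure, so that Fubini applies
   once more with xi. *)
transitivity (cint (product_sf sigma lambda) setT g); first by [].
rewrite /g cintZl; last exact: (cintegrable_fubini1 Ji).
by rewrite (cint_fubini1 Ji) (cint_radial_kernel nm mH ki window_i).
Qed.

End reconstruction.

Theorem proposition3p5 (R : realType) (n : nat) (psi eta : R -> R[i])
    (f : n.-tuple R -> R[i]) (n_ge2 : (2 <= n)%N)
    (psi_schwartz : schwartz psi) (psi_nontrivial : exists t, psi t != 0)
    (eta_window : reconstruction_window n psi eta)
    (f_L1 : cintegrable lebesgue_tuple setT f)
    (fhat_L1 : cintegrable lebesgue_tuple setT (fourier f)) :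
  \forall x \ae @lebesgue_tuple R n,
    let F (u : n.-tuple R) (a b : R) : R[i] :=
      stockwell psi f u b a * atom eta u b a x * (`|a| ^+ (n - 2))%:C%C in
    iterated_integrable F /\
    f x = (window_constant n psi eta)^-1 * iterated_cint F.
Proof.
have [eta_schwartz window_i C0] := eta_window.
(* The reconstruction is shown at every x where the inversion formula for f holds. *)
apply: filterS (fourier_inversion f_L1 fhat_L1) => x fx.
split; first exact: iterated_integrable_slice.
rewrite (iterated_cint_slice n_ge2 psi_schwartz eta_schwartz window_i f_L1 fhat_L1).
rewrite [cint _ _ (modulated_fourier f x)]fx.
apply: (mulfI C0); rewrite mulVKf// /window_constant mulrAC mulrA mulrA.
have pi2 : (2 * pi : R) != 0 by rewrite mulf_neq0// gt_eqF// pi_gt0.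
(* The constants collected along the way: 2 (2 pi)^n / (2 pi)^(n+1) is the 1 / pi of the window
   constant. *)
have -> : (pi^-1)%:C%C =
    (((2 * pi) ^+ n.+1)^-1)%:C%C * (2%:R%:C%C * ((2 * pi) ^+ n)%:C%C) :> R[i].
  rewrite -!rmorphM; congr (_%:C%C); rewrite exprSr invfM mulrC mulrACA.
  by rewrite mulrA divfK ?expf_neq0// invfM mulrA mulfV ?mul1r// pnatr_eq0.
by ring.
Qed.
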